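(* Let $K$ be a convex disc in the hyperbolic plane $\mathbb{H}^2$ and let $n\geq 3$ be an integer. If $P\in\mathcal{P}_H(n)$ is such that $\operatorname{dev}(K,P)=\delta_{\operatorname{dev}_H}(K,n)$, where $\delta_{\operatorname{dev}_H}(K,n)=\inf\{\operatorname{dev}(K,Q): Q\in\mathcal{P}_H(n)\}$, then $P$ is inscribed in $K$, that is, $P\subset K$ and the vertices of $P$ are on the boundary of $K$.
   Context: $\mathbb{H}^2$ is the hyperbolic plane of constant curvature $-1$; all notions (length, convexity, perimeter, polygon) are hyperbolic. A compact set $K\subset\mathbb{H}^2$ is convex if for all $x,y\in K$ the geodesic segment $xy$ is contained in $K$; a convex disc is a compact convex set with non-empty interior. $\operatorname{Per}(\cdot)$ denotes the perimeter (the length of the boundary). The perimeter deviation of two convex discs $K$ and $L$ is $\operatorname{dev}(K,L)=\operatorname{Per}(K\cup L)-\operatorname{Per}(K\cap L)$. For $n\ge 3$, $\mathcal{P}_H(n)$ denotes the set of all convex polygons in $\mathbb{H}^2$ with at most $n$ vertices. *)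

(* Defs.v *)
From HB Require Import structures.
From mathcomp Require Import all_boot all_order all_algebra.
From mathcomp Require Import all_classical all_reals all_analysis.
From mathcomp Require Import ring lra.

Set Implicit Arguments.
Unset Strict Implicit.
Unset Printing Implicit Defensive.

Import Order.TTheory GRing.Theory Num.Theory.

Local Open Scope classical_set_scope.
Local Open Scope ring_scope.

Section arcosh.
Context {R : realType}.
Implicit Types a b c : R.

Definition arcosh a : R := ln (a + Num.sqrt (a ^+ 2 - 1)).

Let s a := Num.sqrt (a ^+ 2 - 1).

Let sqs a : 1 <= a -> s a ^+ 2 = a ^+ 2 - 1.
Proof. by move=> a1; rewrite sqr_sqrtr//; nra. Qed.

Let s_ge0 a : 0 <= s a. Proof. exact: sqrtr_ge0. Qed.

Let arg_ge1 a : 1 <= a -> 1 <= a + s a.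
Proof. by have := s_ge0 a; lra. Qed.

Lemma arcosh1 : arcosh 1 = 0.
Proof. by rewrite /arcosh expr1n subrr sqrtr0 addr0 ln1. Qed.

Lemma arcosh_eq0 a : 1 <= a -> arcosh a = 0 -> a = 1.
Proof.
move=> a1 /eqP; rewrite /arcosh -/(s a) ln_eq0; last first.
  by have := arg_ge1 a1; lra.
by move=> /eqP; have := s_ge0 a; lra.
Qed.

Lemma arcosh_triangle a b c : 1 <= a -> 1 <= b -> 1 <= c ->
  (c - a * b) ^+ 2 <= (a ^+ 2 - 1) * (b ^+ 2 - 1) ->
  arcosh c <= arcosh a + arcosh b.
Proof.
move=> a1 b1 c1 h.
have a1' := arg_ge1 a1; have b1' := arg_ge1 b1; have c1' := arg_ge1 c1.
rewrite /arcosh -/(s a) -/(s b) -/(s c).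
rewrite -lnM ?posrE; [|lra|lra].
rewrite ler_ln ?posrE; [|lra|nra].
have sa0 := s_ge0 a; have sb0 := s_ge0 b.
have sa2 := sqs a1; have sb2 := sqs b1.
pose w := a * b + s a * s b.
have sab0 : 0 <= s a * s b by exact: mulr_ge0.
have cw : c <= w.
  rewrite -sa2 -sb2 -exprMn in h.
  have : `|c - a * b| <= s a * s b by rewrite -ler_sqr ?nnegrE// real_normK// num_real.
  by have := ler_norm (c - a * b); rewrite /w; lra.
have vE : w ^+ 2 - 1 = (a * s b + b * s a) ^+ 2.
  rewrite /w.
  transitivity (a ^+ 2 * b ^+ 2 + (s a) ^+ 2 * (s b) ^+ 2 - 1
    + 2 * (a * b * s a * s b)); first by ring.
  rewrite sa2 sb2 sqrrD !exprMn sa2 sb2; ring.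
have scw : s c <= a * s b + b * s a.
  have v0 : 0 <= a * s b + b * s a by apply: addr_ge0; apply: mulr_ge0 => //; lra.
  rewrite -[leRHS]ger0_norm// -sqrtr_sqr -vE /s ler_wsqrtr// lerD2r.
  by rewrite ler_sqr ?nnegrE//; lra.
have -> : (a + s a) * (b + s b) = w + (a * s b + b * s a) by rewrite /w; ring.
exact: lerD.
Qed.

End arcosh.

(* Hyperboloid model: the sheet [t > 0] of [t^2 - x^2 - y^2 = 1], with
   distance [arcosh (t t' - x x' - y y')]; it has curvature -1. *)
Section hyperbolic_plane.
Context (R : realType).

Definition minkowski (p q : R * R * R) : R :=
  p.2 * q.2 - p.1.1 * q.1.1 - p.1.2 * q.1.2.

Record hplane := HPlane {
  hpt : R * R * R ;
  hptP : (minkowski hpt hpt == 1) && (0 < hpt.2) }.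

HB.instance Definition _ := [isSub for hpt].
HB.instance Definition _ := [Choice of hplane by <:].

Definition hdist (p q : hplane) : R := arcosh (minkowski (hpt p) (hpt q)).

Let minkowski_hpt p :
  (hpt p).2 ^+ 2 = 1 + (hpt p).1.1 ^+ 2 + (hpt p).1.2 ^+ 2 /\ 0 < (hpt p).2.
Proof.
case: p => -[[x y] t] /= /andP[/eqP+ t0]; rewrite /minkowski/= => h; split=> //.
by move: h; rewrite !expr2; lra.
Qed.

Lemma minkowskiC p q : minkowski p q = minkowski q p.
Proof. by rewrite /minkowski; ring. Qed.

Lemma minkowski_ge1 p q : 1 <= minkowski (hpt p) (hpt q).
Proof.
have [+ +] := minkowski_hpt p; have [+ +] := minkowski_hpt q.
case: p q => -[[x y] t] /= _ [[[x' y'] t'] /= _]; rewrite /minkowski/=.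
move=> h' t'0 h t0.
have tt0 : 0 < t * t' by exact: mulr_gt0.
have e : (t * t') ^+ 2 = (1 + x * x' + y * y') ^+ 2
    + ((x - x') ^+ 2 + (y - y') ^+ 2 + (x * y' - y * x') ^+ 2).
  by rewrite exprMn h h'; ring.
have : (1 + x * x' + y * y') ^+ 2 <= (t * t') ^+ 2.
  by rewrite e lerDl !addr_ge0// sqr_ge0.
rewrite -ler_sqrt ?sqr_ge0// !sqrtr_sqr (ger0_norm (ltW tt0)).
have := ler_norm (1 + x * x' + y * y'); lra.
Qed.

Lemma hdistxx p : hdist p p = 0.
Proof.
by case: p => p /[dup] /andP[/eqP h _] ?; rewrite /hdist/= h arcosh1.
Qed.

Lemma hdist_sym p q : hdist p q = hdist q p.
Proof. by rewrite /hdist minkowskiC. Qed.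

Lemma hdist_positivity p q : hdist p q = 0 -> p = q.
Proof.
move=> /(arcosh_eq0 (minkowski_ge1 p q)) pq; apply: val_inj => /=.
have := pq; have [+ +] := minkowski_hpt p; have [+ +] := minkowski_hpt q.
case: p q {pq} => -[[x y] t] /= _ [[[x' y'] t'] /= _]; rewrite /minkowski/=.
move=> h' t'0 h t0 e1.
have tt : t * t' = 1 + x * x' + y * y' by lra.
have e : (t * t') ^+ 2 = (1 + x * x' + y * y') ^+ 2
    + ((x - x') ^+ 2 + (y - y') ^+ 2 + (x * y' - y * x') ^+ 2).
  by rewrite exprMn h h'; ring.
rewrite tt in e.
have z0 := sqr_ge0 (x - x'); have z1 := sqr_ge0 (y - y').
have z2 := sqr_ge0 (x * y' - y * x').
have /eqP : (x - x') ^+ 2 = 0 by lra.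
rewrite sqrf_eq0 subr_eq0 => /eqP xx'.
have /eqP : (y - y') ^+ 2 = 0 by lra.
rewrite sqrf_eq0 subr_eq0 => /eqP yy'.
subst x' y'; congr (_, _, _); apply/eqP.
by rewrite -(eqrXn2 (n := 2)) ?ltW// h h'.
Qed.

Lemma hdist_triangle q p r : hdist p r <= hdist p q + hdist q r.
Proof.
apply: arcosh_triangle; rewrite ?minkowski_ge1// -subr_ge0.
have [+ _] := minkowski_hpt p; have [+ _] := minkowski_hpt q.
have [+ _] := minkowski_hpt r.
case: p q r => -[[x y] t] /= _ [[[x' y'] t'] /= _] [[[x'' y''] t''] /= _].
rewrite /minkowski/= => h'' h' h.
set a := _ - _ - y * y'; set b := _ - _ - y' * y''; set c := _ - _ - y * y''.
pose D := t * (x' * y'' - y' * x'') - t' * (x * y'' - y * x'')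
  + t'' * (x * y' - y * x').
pose g := t ^+ 2 - x ^+ 2 - y ^+ 2; pose g' := t' ^+ 2 - x' ^+ 2 - y' ^+ 2.
pose g'' := t'' ^+ 2 - x'' ^+ 2 - y'' ^+ 2.
have E : g * g' * g'' + 2 * a * b * c - g * b ^+ 2 - g' * c ^+ 2 - g'' * a ^+ 2
   = D ^+ 2 by rewrite /g /g' /g'' /a /b /c /D; ring.
have g1 : g = 1 by rewrite /g; lra.
have g'1 : g' = 1 by rewrite /g'; lra.
have g''1 : g'' = 1 by rewrite /g''; lra.
rewrite g1 g'1 g''1 in E.
suff -> : (a ^+ 2 - 1) * (b ^+ 2 - 1) - (c - a * b) ^+ 2 = D ^+ 2.
  exact: sqr_ge0.
by rewrite -E; ring.
Qed.

HB.instance Definition _ := isMetric.Build R hplane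
  hdistxx hdist_positivity hdist_sym hdist_triangle.

End hyperbolic_plane.

Section length_measure.
Context {R : realType} {T : metricType R}.
Implicit Types A : set T.

(* The value [0] is adjoined so that the empty set has diameter 0. *)
Definition diameter A : \bar R :=
  ereal_sup (0%E |` [set (mdist p.1 p.2)%:E | p in A `*` A]).

Definition hausdorff1_content (d : R) A : \bar R :=
  ereal_inf [set (\sum_(0 <= i <oo) diameter (U i))%E | U in
    [set U : (set T)^nat | A `<=` \bigcup_i U i /\
                           forall i, (diameter (U i) <= d%:E)%E]].

(* One-dimensional Hausdorff measure; it assigns to a rectifiable simple
   curve its length. *)
Definition hausdorff1 A : \bar R :=
  ereal_sup [set hausdorff1_content d A | d in [set d : R | 0 < d]].

Definition boundary A : set T := closure A `\` A°.

Definition Per A : \bar R := hausdorff1 (boundary A).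

(* The perimeters are finite for convex discs and for unions and
   intersections of two of them, so no [+oo - +oo] occurs there. *)
Definition dev A B : \bar R := (Per (A `|` B) - Per (A `&` B))%E.

End length_measure.

Section convexity.
Context {R : realType} {T : metricType R}.
Implicit Types (x y : T) (K P V : set T) (n : nat).

Definition geodesic x y (g : R -> T) : Prop :=
  [/\ g 0 = x, g (mdist x y) = y &
      {in `[0, mdist x y] &, forall s t, mdist (g s) (g t) = `|s - t|}].

(* In the hyperbolic plane there is exactly one geodesic from x to y. *)
Definition geodesic_segment x y : set T :=
  [set z | exists2 g, geodesic x y g & (g @` `[0, mdist x y]) z].

Definition geodesically_convex K : Prop :=
  forall x y, K x -> K y -> geodesic_segment x y `<=` K.

Definition convex_disc K : Prop :=
  [/\ compact K, geodesically_convex K & K° !=set0].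

Definition convex_hull V : set T := smallest geodesically_convex V.

Definition convex_polygon P : Prop :=
  P° !=set0 /\ exists2 V : set T, finite_set V & P = convex_hull V.

(* The vertices of a convex polygon are its extreme points. *)
Definition vertices P : set T :=
  [set v | P v /\ forall x y, P x -> P y ->
                  geodesic_segment x y v -> v = x \/ v = y].

Definition polygons n : set (set T) :=
  [set P | convex_polygon P /\ (vertices P #<= `I_n)%card].

Definition delta_dev K n : \bar R := ereal_inf [set dev K Q | Q in polygons n].

Definition inscribed P K : Prop := P `<=` K /\ vertices P `<=` boundary K.

End convexity.

(* Main.v *)
From HB Require Import structures.
From mathcomp Require Import all_boot all_order all_algebra.
From mathcomp Require Import all_classical all_reals all_analysis.
From mathcomp Require Import ring lra zify.
Require Import Defs.

Set Implicit Arguments.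
Unset Strict Implicit.
Unset Printing Implicit Defensive.

Import Order.TTheory GRing.Theory Num.Theory.
Import numFieldNormedType.Exports.

Local Open Scope classical_set_scope.
Local Open Scope ring_scope.

(* Write [C] for the intersection of [K] and [P].  The nearest point projection onto a convex
   set is 1-Lipschitz and the boundary measures of union and intersection are modular, so
   [dev K P = Per K + Per P - 2 Per C] as soon as [C] has interior points; a minimal [P] has
   such a [C], since a segment [xy] in [K] is beaten by a thin triangle in [K] of perimeter
   greater than [2 |xy|].  Every side of a minimal [P] meets [K], for otherwise a vertex could
   be moved along the next side without changing [C].  Let [t_i] in [K] lie on the side
   [v_i v_(i+1)], and at each vertex cut off the isosceles corner of [P] whose base supports [C],
   touching [C] at [w_i].  The truncated polygon has perimeter at least [Per C], and convexity
   of the hyperbolic distance makes this perimeter at most half the sum of the perimeters of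
   [P] and of the polygon of the [w_i], strictly if some [v_i] is outside [K].  The polygon of the [w_i] lies in [K], and would have a smaller deviation
   than [P].  Hence [P] is contained in [K], and a vertex in the interior of [K] could be moved
   outwards, which would increase the perimeter. *)

(** All geometry takes place in the ambient Minkowski space: a segment is the set of nonnegative
    combinations of its ends, a half-plane is a linear inequality, orientation is the sign of
    [det3]. Convexity arguments thus become linear algebra, and metric ones polynomial inequalities.
    The corners are cut isosceles because nothing is known about where the base touches C. Let c be
    the cosine of the two equal base angles. A point w of the base lies beyond the perpendiculars to
    the two sides at the ends of the base by at least c times its distances to these ends, and such
    amounts add up to c times the base wherever w lies. Two points beyond perpendiculars to a common
    line, on opposite sides, are at least as far apart as the two feet plus both amounts; this is
    the form in which convexity of the distance is used. Since the w_i are uncontrolled, they may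
    coincide, hence a weak cyclic order beside the strict one. They may even be collinear; the
    closed path through them then has length at most twice a distance in K, and a thin triangle
    takes the place of their polygon. *)

HB.lock Definition ch (R : realType) (x : R) := (expR x + expR (- x)) / 2.
HB.lock Definition sh (R : realType) (x : R) := (expR x - expR (- x)) / 2.
Arguments ch {R} x.
Arguments sh {R} x.

(** * Hyperbolic cosine and sine *)

Section hyperbolic_functions.
Context {R : realType}.
Implicit Types x y k : R.

Let chE : @ch R = fun x => (expR x + expR (- x)) / 2.
Proof. by rewrite unlock. Qed.

Let shE : @sh R = fun x => (expR x - expR (- x)) / 2.
Proof. by rewrite unlock. Qed.

Lemma ch0 : ch (0 : R) = 1. Proof. by rewrite !chE oppr0 expR0; lra. Qed.

Lemma sh0 : sh (0 : R) = 0. Proof. by rewrite !shE oppr0 expR0; lra. Qed.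

Lemma chN x : ch (- x) = ch x. Proof. by rewrite !chE opprK addrC. Qed.

Lemma shN x : sh (- x) = - sh x. Proof. by rewrite !shE opprK; lra. Qed.

Let expRVN x : expR x * expR (- x) = 1.
Proof. by rewrite -expRD subrr expR0. Qed.

Lemma ch2 x : ch x ^+ 2 = 1 + sh x ^+ 2.
Proof.
rewrite !chE !shE; have := expRVN x.
set a := expR x; set b := expR (- x) => ab.
have -> : ((a + b) / 2) ^+ 2 = a * b + ((a - b) / 2) ^+ 2 by field.
by rewrite ab.
Qed.

Lemma chD x y : ch (x + y) = ch x * ch y + sh x * sh y.
Proof. by rewrite !chE !shE opprD !expRD; field. Qed.

Lemma shD x y : sh (x + y) = sh x * ch y + ch x * sh y.
Proof. by rewrite !chE !shE opprD !expRD; field. Qed.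

Lemma chB x y : ch (x - y) = ch x * ch y - sh x * sh y.
Proof. by rewrite chD chN shN mulrN. Qed.

Lemma shB x y : sh (x - y) = sh x * ch y - ch x * sh y.
Proof. by rewrite shD chN shN mulrN. Qed.

Lemma ch_gt0 x : 0 < ch x.
Proof. by rewrite !chE divr_gt0// addr_gt0 ?expR_gt0. Qed.

Lemma ch_ge1 x : 1 <= ch x.
Proof.
rewrite -(@ler_pXn2r _ 2) ?nnegrE ?ler01 ?(ltW (ch_gt0 _))//.
by rewrite expr1n ch2 lerDl sqr_ge0.
Qed.

Lemma sh_ltr x y : (sh x < sh y) = (x < y).
Proof.
have mono (a b : R) : a < b -> sh a < sh b.
  move=> ab; rewrite !shE.
  have : expR a < expR b by rewrite ltr_expR.
  have : expR (- b) < expR (- a) by rewrite ltr_expR ltrN2.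
  by lra.
apply/idP/idP; last exact: mono.
apply: contraTT; rewrite -!leNgt le_eqVlt => /orP[/eqP->//|/mono/ltW//].
Qed.

Lemma sh_ler x y : (sh x <= sh y) = (x <= y).
Proof. by rewrite !leNgt sh_ltr. Qed.

Lemma sh_gt0 x : (0 < sh x) = (0 < x).
Proof. by rewrite -{1}sh0 sh_ltr. Qed.

Lemma sh_ge0 x : (0 <= sh x) = (0 <= x).
Proof. by rewrite -{1}sh0 sh_ler. Qed.

Lemma ch_ltr x y : 0 <= x -> 0 <= y -> (ch x < ch y) = (x < y).
Proof.
move=> x0 y0; rewrite -(@ltr_pXn2r _ 2) ?nnegrE ?(ltW (ch_gt0 _))//.
by rewrite !ch2 ltrD2l ltr_pXn2r ?nnegrE ?sh_ge0// sh_ltr.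
Qed.

Lemma ch_ler x y : 0 <= x -> 0 <= y -> (ch x <= ch y) = (x <= y).
Proof. by move=> x0 y0; rewrite !leNgt ch_ltr. Qed.

Lemma sh_ge x : 0 <= x -> x <= sh x.
Proof.
rewrite le_eqVlt => /orP[/eqP<-|x0]; first by rewrite sh0.
have dsh (t : R) : is_derive t 1 (@sh R) (ch t).
  by rewrite !chE !shE; apply: is_derive_eq; rewrite /GRing.scale/=; lra.
have csh : {within `[0, x], continuous (@sh R)}.
  apply: continuous_subspaceT => t; apply: differentiable_continuous.
  by apply/derivable1_diffP; have [] := dsh t.
have [c _] := MVT x0 (fun t _ => dsh t) csh.
by rewrite sh0 !subr0 => ->; rewrite ler_peMl ?ch_ge1// ltW.
Qed.

(* On the nonnegative reals [sh] is convex and vanishes at 0. *)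
Lemma sh_convex k x : 0 <= k <= 1 -> 0 <= x -> sh (k * x) <= k * sh x.
Proof.
move=> /andP[k0 k1]; rewrite le_eqVlt => /orP[/eqP<-|x0].
  by rewrite mulr0 sh0 mulr0.
pose g t := k * sh t - sh (k * t).
have dg (t : R) : is_derive t 1 g (k * (ch t - ch (k * t))).
  rewrite /g !chE !shE; apply: is_derive_eq; rewrite /GRing.scale/=; lra.
have cg : {within `[0, x], continuous g}.
  apply: continuous_subspaceT => t; apply: differentiable_continuous.
  by apply/derivable1_diffP; have [] := dg t.
have [c] := MVT x0 (fun t _ => dg t) cg.
rewrite in_itv/= => /andP[c0 cx].
rewrite {2}/g mulr0 sh0 mulr0 !subr0 /g => E; rewrite -subr_ge0 E.
apply: mulr_ge0; last exact: ltW.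
apply: mulr_ge0 => //; rewrite subr_ge0 ch_ler ?mulr_ge0 ?(ltW c0)//.
by rewrite ler_piMl// ltW.
Qed.

Lemma arcosh_ge0 x : 1 <= x -> 0 <= arcosh x.
Proof.
by move=> x1; rewrite /arcosh ln_ge0//; have := sqrtr_ge0 (x ^+ 2 - 1); lra.
Qed.

Lemma arcoshK x : 1 <= x -> ch (arcosh x) = x.
Proof.
move=> x1; rewrite !chE /arcosh; set s := Num.sqrt _.
have s0 : 0 <= s by exact: sqrtr_ge0.
have s2 : s ^+ 2 = x ^+ 2 - 1 by rewrite sqr_sqrtr//; nra.
rewrite expRN lnK ?posrE; last by lra.
have -> : (x + s)^-1 = x - s.
  apply: (@mulfI _ (x + s)); first by rewrite gt_eqF//; lra.
  rewrite divff; last by rewrite gt_eqF//; lra.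
  by rewrite mulrC -subr_sqr s2; lra.
by lra.
Qed.

Lemma chK x : 0 <= x -> arcosh (ch x) = x.
Proof.
move=> x0; have := arcoshK (ch_ge1 x).
have a0 := arcosh_ge0 (ch_ge1 x).
move=> /eqP; rewrite eq_le !ch_ler// -eq_le => /eqP//.
Qed.

Lemma continuous_ch : continuous (@ch R).
Proof.
move=> t; have dch : is_derive t 1 (@ch R) (sh t).
  by rewrite !chE !shE; apply: is_derive_eq; rewrite /GRing.scale/=; lra.
by apply/differentiable_continuous/derivable1_diffP; have [] := dch.
Qed.

Lemma continuous_sh : continuous (@sh R).
Proof.
move=> t; have dsh : is_derive t 1 (@sh R) (ch t).
  by rewrite !chE !shE; apply: is_derive_eq; rewrite /GRing.scale/=; lra.
by apply/differentiable_continuous/derivable1_diffP; have [] := dsh.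
Qed.

Lemma ch_double x : ch (x + x) = 1 + 2 * sh x ^+ 2.
Proof. by rewrite chD -!expr2 ch2; ring. Qed.

Lemma ch_ge_sq x : 1 + x ^+ 2 / 2 <= ch x.
Proof.
wlog x0 : x / 0 <= x => [hw|].
  have [/hw//|x0] := leP 0 x.
  by rewrite -sqrrN -chN; apply: hw; lra.
have -> : x = x / 2 + x / 2 by field.
rewrite ch_double lerD2l.
have -> : (x / 2 + x / 2) ^+ 2 / 2 = 2 * (x / 2) ^+ 2 by field.
by rewrite ler_pM2l// ler_pXn2r ?nnegrE ?sh_ge0 ?divr_ge0// sh_ge// divr_ge0.
Qed.

End hyperbolic_functions.

(** * Linear algebra of Minkowski space *)

Section minkowski_space.
Context {R : realType}.
Local Notation vec := (R * R * R)%type.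
Implicit Types x y z : vec.

(** One binary operation on the bare product type lets a single family of rewriting rules expand
    [minkowski] and [det3]; a mere multiple of [x] is written [lin a x 0 x]. *)
Definition lin (a : R) x (b : R) y : vec :=
  (a * x.1.1 + b * y.1.1, a * x.1.2 + b * y.1.2, a * x.2 + b * y.2).

Definition det3 x y z : R :=
  x.1.1 * (y.1.2 * z.2 - y.2 * z.1.2) - x.1.2 * (y.1.1 * z.2 - y.2 * z.1.1)
  + x.2 * (y.1.1 * z.1.2 - y.1.2 * z.1.1).

(** The Lorentzian cross product, with signs chosen so that pairing with it is [det3 x y]: it is the
    normal of the plane through the origin that cuts out the line [xy]. *)
Definition mcross x y : vec :=
  (x.2 * y.1.2 - x.1.2 * y.2, x.1.1 * y.2 - x.2 * y.1.1,
   x.1.1 * y.1.2 - x.1.2 * y.1.1).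

Lemma vec_eq x y : x.1.1 = y.1.1 -> x.1.2 = y.1.2 -> x.2 = y.2 -> x = y.
Proof. by move: x y => [[? ?] ?] [[? ?] ?] /= -> -> ->. Qed.

Lemma mink_linl a x b y z :
  minkowski (lin a x b y) z = a * minkowski x z + b * minkowski y z.
Proof. by rewrite /minkowski /lin/=; ring. Qed.

Lemma mink_linr a x b y z :
  minkowski z (lin a x b y) = a * minkowski z x + b * minkowski z y.
Proof. by rewrite /minkowski /lin/=; ring. Qed.

Definition mink_lin := (mink_linl, mink_linr).

Lemma det3_lin1 a x b y z t :
  det3 (lin a x b y) z t = a * det3 x z t + b * det3 y z t.
Proof. by rewrite /det3 /lin/=; ring. Qed.

Lemma det3_lin2 a x b y z t :
  det3 z (lin a x b y) t = a * det3 z x t + b * det3 z y t.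
Proof. by rewrite /det3 /lin/=; ring. Qed.

Lemma det3_lin3 a x b y z t :
  det3 z t (lin a x b y) = a * det3 z t x + b * det3 z t y.
Proof. by rewrite /det3 /lin/=; ring. Qed.

Definition det3_lin := (det3_lin1, det3_lin2, det3_lin3).

Lemma det3C x y z : det3 x y z = det3 y z x.
Proof. by rewrite /det3; ring. Qed.

Lemma det3N x y z : det3 x y z = - det3 y x z.
Proof. by rewrite /det3; ring. Qed.

Lemma det3xx x y : det3 x x y = 0. Proof. by rewrite /det3; ring. Qed.

Lemma det3xyx x y : det3 x y x = 0. Proof. by rewrite /det3; ring. Qed.

Lemma det3yxx x y : det3 y x x = 0. Proof. by rewrite /det3; ring. Qed.

Definition det3_0 := (det3xx, det3xyx, det3yxx).

Lemma mink_cross x y z : minkowski (mcross x y) z = det3 x y z.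
Proof. by rewrite /minkowski /mcross /det3/=; ring. Qed.

(** The Gram determinant of two triples. No sign appears, since the matrix of the form has
    determinant 1. *)
Lemma gram_det x y z x' y' z' :
  det3 x y z * det3 x' y' z' =
    minkowski x x' * (minkowski y y' * minkowski z z' - minkowski y z' * minkowski z y')
  - minkowski x y' * (minkowski y x' * minkowski z z' - minkowski y z' * minkowski z x')
  + minkowski x z' * (minkowski y x' * minkowski z y' - minkowski y y' * minkowski z x').
Proof. by rewrite /det3 /minkowski; ring. Qed.

(** Coordinates of [z] in the frame [x], [y], [mcross x y], multiplied by the Gram determinant of
    [x] and [y] so that no division occurs. *)
Lemma decomp2 x y z :
  lin (minkowski x x * minkowski y y - minkowski x y ^+ 2) z 0 z =
  lin 1 (lin (minkowski z x * minkowski y y - minkowski x y * minkowski z y) x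
             (minkowski z y * minkowski x x - minkowski x y * minkowski z x) y)
      (det3 x y z) (mcross x y).
Proof.
by rewrite /det3 /minkowski /lin /mcross; apply: vec_eq => /=; ring.
Qed.

Lemma cramer x y z t :
  lin (det3 x y z) t 0 t =
  lin 1 (lin (det3 t y z) x (det3 x t z) y) (det3 x y t) z.
Proof. by rewrite /det3 /lin; apply: vec_eq => /=; ring. Qed.

End minkowski_space.

(** * Points, rays and geodesic segments on the hyperboloid *)

Section hyperbolic_points.
Context {R : realType}.
Local Notation vec := (R * R * R)%type.
Local Notation H := (hplane R).
Local Notation "<< x , y >>" := (minkowski x y).
Local Coercion hpt : hplane >-> prod.
Implicit Types (x y z : H) (u : vec).

Lemma minkxx x : <<x, x>> = 1.
Proof. by case: x => x /= /andP[/eqP]. Qed.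

Lemma hpt2_gt0 x : 0 < (hpt x).2.
Proof. by case: x => x /= /andP[]. Qed.

Lemma hpt_inj : injective (@hpt R). Proof. exact: val_inj. Qed.

Lemma mdistE x y : mdist x y = arcosh <<x, y>>. Proof. by []. Qed.

Lemma ch_mdist x y : ch (mdist x y) = <<x, y>>.
Proof. by rewrite mdistE arcoshK// minkowski_ge1. Qed.

Lemma mink_gt0 x y : 0 < <<x, y>>.
Proof. by rewrite -ch_mdist ch_gt0. Qed.

Lemma mink1_eq x y : <<x, y>> = 1 -> x = y.
Proof. by move=> xy1; apply: hdist_positivity; rewrite /hdist xy1 arcosh1. Qed.

Lemma mink_gt1 x y : x != y -> 1 < <<x, y>>.
Proof.
move=> xy; rewrite lt_neqAle minkowski_ge1 andbT.
by apply: contra xy => /eqP/esym/mink1_eq->.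
Qed.

(** Reversed Cauchy-Schwarz: a timelike vector in the past cone pairs negatively with every point of
    the upper sheet. *)
Lemma future u x : 0 < <<u, u>> -> 0 < <<u, x>> -> 0 < u.2.
Proof.
have := minkxx x; have := hpt2_gt0 x.
case: x => -[[a b] c] /= _; case: u => -[p q] r; rewrite /minkowski/= => c0 h1 h2 h3.
rewrite ltNge; apply/negP => r0.
have cr : c * r <= 0 by rewrite pmulr_rle0.
have e1 : p * a + q * b <= r * c by nra.
have e2 : (p * a + q * b) ^+ 2 >= (r * c) ^+ 2 by nra.
have e3 : (p * a + q * b) ^+ 2 <= (p ^+ 2 + q ^+ 2) * (a ^+ 2 + b ^+ 2).
  by have := sqr_ge0 (p * b - q * a); nra.
have c2 : a ^+ 2 + b ^+ 2 = c ^+ 2 - 1 by nra.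
have : (p ^+ 2 + q ^+ 2) * (c ^+ 2 - 1) < r ^+ 2 * c ^+ 2.
  have : p ^+ 2 + q ^+ 2 < r ^+ 2 by nra.
  have := sqr_ge0 p; have := sqr_ge0 q; have := sqr_ge0 c.
  have : 0 < c ^+ 2 by rewrite exprn_gt0.
  by nra.
by rewrite -c2 -exprMn; lra.
Qed.

Let o_proof : (<<(0, 0, 1) : vec, (0, 0, 1)>> == 1) && (0 < ((0, 0, 1) : vec).2).
Proof. by rewrite /minkowski/= !(mul0r, subr0) mulr1 eqxx ltr01. Qed.

Definition horigin : H := HPlane o_proof.

(** Radial projection to the sheet. Its default value is [horigin], so every use goes through the
    positivity conditions of [hnormalE]. *)
Definition hnormal u : H :=
  insubd horigin (lin (Num.sqrt <<u, u>>)^-1 u 0 u).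

Lemma hnormalE u x : 0 < <<u, u>> -> 0 < <<u, x>> ->
  hpt (hnormal u) = lin (Num.sqrt <<u, u>>)^-1 u 0 u.
Proof.
move=> uu ux; rewrite /hnormal /insubd insubT//=.
rewrite !mink_lin !mul0r !addr0 mulrA -expr2 exprVn sqr_sqrtr ?ltW//.
rewrite mulVf; last by rewrite gt_eqF.
rewrite eqxx/= mulr_gt0//.
  by rewrite invr_gt0 sqrtr_gt0.
exact: future ux.
Qed.

Lemma hnormal1 u x : <<u, u>> = 1 -> 0 < <<u, x>> -> hpt (hnormal u) = u.
Proof.
move=> u1 ux; rewrite (hnormalE _ ux) ?u1// sqrtr1 invr1.
by apply: vec_eq; rewrite /lin/=; ring.
Qed.

Definition tangent x u := <<x, u>> = 0 /\ <<u, u>> = -1.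

Definition ray x u (s : R) : H := hnormal (lin (ch s) x (sh s) u).

Lemma rayE x u s : tangent x u -> hpt (ray x u s) = lin (ch s) x (sh s) u.
Proof.
move=> [xu uu]; apply: (@hnormal1 _ x); rewrite !mink_lin minkxx.
  rewrite uu xu (minkowskiC u) xu.
  have := ch2 s; nra.
by rewrite (minkowskiC u) xu mulr0 addr0 mulr1 ch_gt0.
Qed.

Lemma mink_ray x u s t : tangent x u -> <<ray x u s, ray x u t>> = ch (s - t).
Proof.
move=> xu; rewrite !rayE// !mink_lin minkxx.
by case: xu => xu ->; rewrite (minkowskiC u) xu chB; ring.
Qed.

Lemma mdist_ray x u s t : tangent x u -> mdist (ray x u s) (ray x u t) = `|s - t|.
Proof.
move=> xu; rewrite mdistE mink_ray//.
have [st|st] := leP 0 (s - t); first by rewrite chK ?ger0_norm.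
by rewrite ltr0_norm// -chN chK// lerNr oppr0 ltW.
Qed.

Lemma ray0 x u : tangent x u -> ray x u 0 = x.
Proof.
move=> xu; apply: hpt_inj; rewrite rayE// ch0 sh0.
by apply: vec_eq; rewrite /lin/=; ring.
Qed.

(** The component of [y] orthogonal to [x], normalized: the initial velocity of the geodesic from
    [x] to [y]. Meaningful only for distinct points. *)
Definition hdir x y : vec :=
  lin (sh (mdist x y))^-1 (hpt y) (- ch (mdist x y) / sh (mdist x y)) (hpt x).

Lemma sh_mdist_gt0 x y : x != y -> 0 < sh (mdist x y).
Proof. by move=> xy; rewrite sh_gt0 mdist_gt0. Qed.

Lemma tangent_hdir x y : x != y -> tangent x (hdir x y).
Proof.
move=> xy; have s0 := sh_mdist_gt0 xy; rewrite /tangent /hdir !mink_lin !minkxx.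
rewrite (minkowskiC y) -ch_mdist; have := ch2 (mdist x y).
move: s0; set c := ch _; set s := sh _ => s0 c2; split.
  by field; rewrite gt_eqF.
transitivity ((1 - c ^+ 2) / s ^+ 2); first by field; rewrite gt_eqF.
by rewrite c2; field; rewrite gt_eqF.
Qed.

Lemma ray_hdir x y : x != y -> ray x (hdir x y) (mdist x y) = y.
Proof.
move=> xy; apply: hpt_inj; rewrite (rayE _ (tangent_hdir xy)) /hdir.
have := sh_mdist_gt0 xy; set c := ch _; set s := sh _ => s0.
by apply: vec_eq; rewrite /lin/=; field; rewrite gt_eqF.
Qed.

(** The trace on the sheet of the cone spanned by [x] and [y]. The coefficients are left
    unnormalized, since [hpt z] being on the sheet fixes their scale; the case x = y is covered as
    well. *)
Definition seg x y : set H :=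
  [set z | exists a b, [/\ 0 <= a, 0 <= b & hpt z = lin a x b y]].

Lemma seg_refl x z : seg x x z -> z = x.
Proof.
move=> [a [b [a0 b0 E]]].
have h : (a + b) ^+ 2 = 1.
  by have := minkxx z; rewrite {1 2}E !mink_lin !minkxx => <-; ring.
have ab1 : a + b = 1.
  apply/eqP; rewrite -(@eqrXn2 _ 2) ?expr1n ?h//; exact: addr_ge0.
apply: hpt_inj; rewrite E; apply: vec_eq; rewrite /lin/= -mulrDl ab1 mul1r//.
Qed.

Lemma segxx x : seg x x x.
Proof.
by exists 1, 0; split=> //; apply: vec_eq; rewrite /lin/=; ring.
Qed.

Lemma segl x y : seg x y x.
Proof.
by exists 1, 0; split=> //; apply: vec_eq; rewrite /lin/=; ring.
Qed.

Lemma segr x y : seg x y y.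
Proof.
by exists 0, 1; split=> //; apply: vec_eq; rewrite /lin/=; ring.
Qed.

Lemma segC x y : seg x y = seg y x.
Proof.
rewrite predeqE => z; split => -[a [b [a0 b0 E]]]; exists b, a; split => //;
  by rewrite E; apply: vec_eq; rewrite /lin/=; ring.
Qed.

Lemma ray_hdirE x y s : x != y ->
  hpt (ray x (hdir x y) s) =
  lin (sh (mdist x y - s) / sh (mdist x y)) x (sh s / sh (mdist x y)) y.
Proof.
move=> xy; rewrite (rayE _ (tangent_hdir xy)) /hdir shB.
have := sh_mdist_gt0 xy; set c := ch (mdist _ _); set t := sh (mdist _ _) => s0.
by apply: vec_eq; rewrite /lin/=; field; rewrite gt_eqF.
Qed.

Lemma seg_rayP x y z : x != y -> seg x y z <->
  exists2 s : R, 0 <= s <= mdist x y & z = ray x (hdir x y) s.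
Proof.
move=> xy; have xu := tangent_hdir xy; have s0 := sh_mdist_gt0 xy; split; last first.
  move=> [s /andP[s0' sd] ->]; exists (sh (mdist x y - s) / sh (mdist x y)), (sh s / sh (mdist x y)).
  by split; rewrite ?ray_hdirE// divr_ge0 ?sh_ge0 ?subr_ge0 ?mdist_ge0.
move=> [a [b [a0 b0 E]]]; exists (mdist x z).
  rewrite mdist_ge0/= -ch_ler ?mdist_ge0// !ch_mdist E mink_linr minkxx mulr1.
  have := minkxx z; rewrite {1 2}E !mink_lin !minkxx (minkowskiC y x).
  have := minkowski_ge1 x y; set m := << _, _ >> => m1 h.
  have b1 : b <= 1.
    rewrite -(@ler_pXn2r _ 2) ?nnegrE// expr1n -h; have := mulr_ge0 a0 b0; nra.
  (* In terms of distances from [x] this is [sh (mdist x z) = b * sh (mdist x y)], with b at most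
     1. *)
  have h2 : (a + b * m) ^+ 2 <= m ^+ 2.
    rewrite (_ : (a + b * m) ^+ 2 = 1 + b ^+ 2 * (m ^+ 2 - 1)); last by lra.
    have : b ^+ 2 <= 1 by rewrite expr_le1.
    have : 1 <= m ^+ 2 by rewrite expr_ge1//; lra.
    by nra.
  by rewrite ler_pXn2r ?nnegrE// in h2; [apply: addr_ge0 => //; apply: mulr_ge0|]; lra.
apply: hpt_inj; rewrite rayE//.
have e1 : ch (mdist x z) = a + b * ch (mdist x y).
  by rewrite !ch_mdist E mink_linr minkxx mulr1.
have e2 : sh (mdist x z) = b * sh (mdist x y).
  apply/eqP; rewrite -(@eqrXn2 _ 2) ?mulr_ge0 ?sh_ge0 ?mdist_ge0//.
  have := ch2 (mdist x z); rewrite e1 => h1; have := ch2 (mdist x y).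
  have := minkxx z; rewrite {1 2}E !mink_lin !minkxx (minkowskiC y x) -ch_mdist.
  set c := ch _ in h1 *; set t := sh (mdist x y) => h c2; apply/eqP.
  rewrite exprMn; have -> : t ^+ 2 = c ^+ 2 - 1 by rewrite c2; ring.
  have -> : sh (mdist x z) ^+ 2 = (a + b * c) ^+ 2 - 1 by rewrite h1; ring.
  by lra.
rewrite E e1 e2 /hdir; move: s0; set c := ch _; set t := sh _ => s0.
by apply: vec_eq; rewrite /lin/=; field; rewrite gt_eqF.
Qed.

Lemma geodesic_segmentE x y : geodesic_segment x y = seg x y.
Proof.
rewrite predeqE => z; split.
  move=> [g [g0 gd giso] [s/=]]; rewrite in_itv/= => /andP[s0 sd] <-.
  have [xy|xy] := eqVneq x y.
    move: sd; rewrite -xy mdistxx => sd.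
    have -> : s = 0 by apply/eqP; rewrite eq_le sd.
    by rewrite g0; exact: segxx.
  apply/seg_rayP => //; exists s; first by rewrite s0.
  (* The product of [g s] with the ray point involves only its products with [x] and [y], which the
     isometry prescribes; it equals 1, so the two points coincide. *)
  have xu := tangent_hdir xy; apply: mink1_eq; rewrite rayE// mink_linr.
  have d0 := mdist_ge0 x y.
  have i0 : (0 : R) \in `[0, mdist x y] by rewrite in_itv/= lexx.
  have i1 : mdist x y \in `[0, mdist x y] by rewrite in_itv/= lexx andbT.
  have is_ : s \in `[0, mdist x y] by rewrite in_itv/= s0.
  have e1 : <<g s, x>> = ch s.
    by rewrite -ch_mdist -[in LHS]g0 giso// subr0 ger0_norm.
  have e2 : <<g s, y>> = ch (mdist x y - s).
    by rewrite -ch_mdist -[in LHS]gd giso// distrC ger0_norm// subr_ge0.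
  rewrite /hdir mink_linr e1 e2 chB; have := ch2 s; have := ch2 (mdist x y).
  have := sh_mdist_gt0 xy; set c := ch (mdist _ _); set t := sh (mdist _ _) => t0 h1 h2.
  transitivity (ch s ^+ 2 - sh s ^+ 2); first by field; rewrite gt_eqF.
  by rewrite h2; ring.
have [<-|xy] := eqVneq x y.
  move=> /seg_refl->; exists (fun=> x).
    by split => // s t; rewrite mdistxx !in_itv/= => /le_anti <- /le_anti <-; rewrite subrr normr0.
  by exists 0 => //=; rewrite mdistxx in_itv/= lexx.
move=> /(seg_rayP _ xy)[s /andP[s0 sd] ->]; exists (ray x (hdir x y)).
  split; first exact: ray0 (tangent_hdir xy).
    exact: ray_hdir.
  by move=> a b _ _; rewrite mdist_ray//; exact: tangent_hdir.
by exists s => //=; rewrite in_itv/= s0.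
Qed.

Lemma geodesically_convexP (K : set H) : geodesically_convex K <->
  forall x y, K x -> K y -> seg x y `<=` K.
Proof.
by split => h x y Kx Ky; have := h x y Kx Ky; rewrite geodesic_segmentE.
Qed.

Lemma seg_mdist x y z : seg x y z -> mdist x y = mdist x z + mdist z y.
Proof.
have [<-|xy] := eqVneq x y; first by move=> /seg_refl->; rewrite mdistxx addr0.
move=> /(seg_rayP _ xy)[s /andP[s0 sd] ->]; have xu := tangent_hdir xy.
rewrite -{2}(ray0 xu) -{5}(ray_hdir xy) !mdist_ray// sub0r normrN ger0_norm//.
by rewrite distrC ger0_norm ?subr_ge0//; ring.
Qed.

End hyperbolic_points.

(** * One-dimensional Hausdorff measure as a metric outer measure *)

Section hausdorff_outer.
Context {R : realType} {T : metricType R}.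
Implicit Types (A B X : set T) (d : R).
Local Open Scope ereal_scope.

Lemma diameter_ge0 A : 0 <= diameter A.
Proof. by apply: ereal_sup_ubound; left. Qed.

Lemma diameter_set0 : diameter (@set0 T) = 0.
Proof.
apply/eqP; rewrite eq_le diameter_ge0 andbT; apply: ge_ereal_sup => e [->//|].
by move=> [p [] []].
Qed.

Lemma diameter_ge A x y : A x -> A y -> (mdist x y)%:E <= diameter A.
Proof. by move=> Ax Ay; apply: ereal_sup_ubound; right; exists (x, y). Qed.

Lemma diameter_le A (e : \bar R) : 0 <= e ->
  (forall x y, A x -> A y -> (mdist x y)%:E <= e) -> diameter A <= e.
Proof.
move=> e0 h; apply: ge_ereal_sup => f [->//|].
by move=> [[x y] [/= Ax Ay] <-]; exact: h.
Qed.

Lemma content_ge0 d A : 0 <= hausdorff1_content d A.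
Proof.
apply: le_ereal_inf_tmp => _ [U _ <-].
by apply: nneseries_ge0 => i _ _; exact: diameter_ge0.
Qed.

Lemma content_lbound d A (U : (set T)^nat) : A `<=` \bigcup_i U i ->
  (forall i, diameter (U i) <= d%:E) ->
  hausdorff1_content d A <= \sum_(0 <= i <oo) diameter (U i).
Proof. by move=> AU Ud; apply: ereal_inf_lbound; exists U. Qed.

Lemma le_content d A B : A `<=` B ->
  hausdorff1_content d A <= hausdorff1_content d B.
Proof.
move=> AB; apply: le_ereal_inf_tmp => _ [U [BU Ud] <-].
by apply: content_lbound => //; exact: subset_trans BU.
Qed.

Lemma content_antimono d e A : (d <= e)%R ->
  hausdorff1_content e A <= hausdorff1_content d A.
Proof.
move=> de; apply: le_ereal_inf_tmp => _ [U [BU Ud] <-].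
by apply: content_lbound => // i; rewrite (le_trans (Ud i))// lee_fin.
Qed.

Lemma content_set0 d : (0 < d)%R -> hausdorff1_content d (@set0 T) = 0.
Proof.
move=> d0; apply/eqP; rewrite eq_le content_ge0 andbT.
apply: (le_trans (content_lbound (U := fun=> set0) _ _)) => //.
  by move=> i; rewrite diameter_set0 lee_fin ltW.
by rewrite eseries0// => i _ _; rewrite diameter_set0.
Qed.

Lemma hausdorff1_ge d A : (0 < d)%R -> hausdorff1_content d A <= hausdorff1 A.
Proof. by move=> d0; apply: ereal_sup_ubound; exists d. Qed.

Lemma hausdorff1_le A (e : \bar R) :
  (forall d, (0 < d)%R -> hausdorff1_content d A <= e) -> hausdorff1 A <= e.
Proof. by move=> h; apply: ge_ereal_sup => _ [d /= d0 <-]; exact: h. Qed.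

Lemma content_bigcup d (A : (set T)^nat) : (0 < d)%R ->
  hausdorff1_content d (\bigcup_n A n) <=
  \sum_(0 <= n <oo) hausdorff1_content d (A n).
Proof.
move=> d0; have [[i ioo]|/forallNP Aoo] := pselect (exists i, hausdorff1_content d (A i) = +oo).
  rewrite (eseries_pinfty _ _ ioo) ?leey// => n _.
  by rewrite -ltNye (lt_le_trans _ (content_ge0 _ _)).
apply/lee_addgt0Pr => e e0.
apply: le_trans (epsilon_trick _ _ (ltW e0)); last first.
  by move=> n; exact: content_ge0.
have /choice[G PG] (n : nat) : exists B : (set T)^nat,
    [/\ A n `<=` \bigcup_k B k, forall k, diameter (B k) <= d%:E &
      \sum_(0 <= k <oo) diameter (B k) <=
        hausdorff1_content d (A n) + (e / (2 ^ n.+1)%:R)%:E].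
  have en : (0 < e / (2 ^ n.+1)%:R)%R by rewrite divr_gt0// ltr0n expn_gt0.
  have fin : hausdorff1_content d (A n) \is a fin_num.
    by rewrite ge0_fin_numE ?content_ge0// ltey; exact/eqP/Aoo.
  have [_ [B [AB Bd] <-] /ltW h] := lb_ereal_inf_adherent en fin.
  by exists B.
have g0 n k : 0 <= diameter (G n k) by exact: diameter_ge0.
apply: (@le_trans _ _ (\sum_(0 <= n <oo) \sum_(0 <= k <oo) diameter (G n k))); last first.
  apply: lee_nneseries => n //; last by move=> _; have [] := PG n.
  by move=> _ _; apply: nneseries_ge0 => k *; exact: g0.
have /card_esym/ppcard_eqP[f] := card_nat2.
pose U i := G (f i).1 (f i).2.
apply: (le_trans (content_lbound (U := U) _ _)).
- move=> x [n _ Anx]; have [/(_ x Anx)[k _ Gx] _ _] := PG n.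
  by exists (f^-1%FUN (n, k)) => //; rewrite /U invK ?inE.
- by move=> i; have [_ + _] := PG (f i).1; exact.
rewrite (eq_eseriesr (fun n _ => nneseries_esumT (g0 n))).
rewrite [leRHS]nneseries_esumT; last by move=> n; exact: esum_ge0.
rewrite nneseries_esumT; last by move=> i; exact: g0.
rewrite esum_esum//.
rewrite (@reindex_esum _ _ _ [set: nat] _ f)//.
split => [i _ /=|x y _ _ fxy|z _]; first by split.
- by apply: (@inj _ _ _ f) fxy; rewrite inE.
- by exists (f^-1%FUN z) => //; rewrite invK ?inE.
Qed.

Lemma hausdorff1_ge0 A : 0 <= hausdorff1 A.
Proof. exact: le_trans (content_ge0 1 A) (hausdorff1_ge A ltr01). Qed.

Lemma hausdorff1_set0 : hausdorff1 (@set0 T) = 0.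
Proof.
apply/eqP; rewrite eq_le hausdorff1_ge0 andbT.
by apply: hausdorff1_le => d /content_set0->.
Qed.

Lemma le_hausdorff1 : {homo @hausdorff1 R T : A B / A `<=` B >-> A <= B}.
Proof.
move=> A B AB; apply: hausdorff1_le => d d0.
exact: le_trans (le_content _ AB) (hausdorff1_ge _ d0).
Qed.

Lemma hausdorff1_sigma_subadditive :
  sigma_subadditive (@hausdorff1 R T).
Proof.
move=> A; apply: hausdorff1_le => d d0.
apply: (le_trans (content_bigcup _ d0)).
apply: lee_nneseries => n *; first exact: content_ge0.
exact: hausdorff1_ge.
Qed.

HB.instance Definition _ := isOuterMeasure.Build R T (@hausdorff1 R T)
  hausdorff1_set0 hausdorff1_ge0 le_hausdorff1 hausdorff1_sigma_subadditive.

Lemma hausdorff1U A B : hausdorff1 (A `|` B) <= hausdorff1 A + hausdorff1 B.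
Proof. exact: outer_measureU2. Qed.

Let sup_add_le (S : set (\bar R)) (b c : \bar R) : S !=set0 -> 0 <= b ->
  (forall s, S s -> 0 <= s) -> (forall s, S s -> s + b <= c) -> ereal_sup S + b <= c.
Proof.
move=> [s0 Ss0] b0 S0 Sb; have := Sb _ Ss0; have := S0 _ Ss0.
case: b b0 Sb => [b| |]// b0 Sb s00.
  move=> _; rewrite -leeBrDr//; apply: ge_ereal_sup => s Ss.
  by rewrite leeBrDr// Sb.
rewrite addey; last by rewrite -ltNye (lt_le_trans _ s00)// ltNy0.
by rewrite leye_eq => /eqP ->; rewrite leey.
Qed.

(* Covers by sets of diameter less than [e] split into a cover of [A] and a cover of [B]. *)
Lemma hausdorff1_separated A B (e : R) : (0 < e)%R ->
  (forall x y, A x -> B y -> (e <= mdist x y)%R) ->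
  hausdorff1 A + hausdorff1 B <= hausdorff1 (A `|` B).
Proof.
move=> e0 AB.
have key d : (0 < d < e)%R ->
    hausdorff1_content d A + hausdorff1_content d B <= hausdorff1 (A `|` B).
  move=> /andP[d0 de].
  apply: le_trans (hausdorff1_ge _ d0); apply: le_ereal_inf_tmp => _ [U [ABU Ud] <-].
  pose V (C : set T) i := [set x | U i x /\ (U i `&` C) !=set0].
  have VU C i : diameter (V C i) <= diameter (U i).
    by apply: diameter_le (diameter_ge0 _) _ => x y [Ux _] [Uy _]; exact: diameter_ge.
  have cV C : C `<=` A `|` B -> hausdorff1_content d C <= \sum_(0 <= i <oo) diameter (V C i).
    move=> CAB; apply: content_lbound => [x Cx|i]; last exact: le_trans (VU _ _) (Ud i).
    by have [i _ Ux] := ABU x (CAB _ Cx); exists i => //; split => //; exists x.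
  apply: (le_trans (leeD (cV A (@subsetUl _ _ _)) (cV B (@subsetUr _ _ _)))).
  rewrite -nneseriesD; [|by move=> *; exact: diameter_ge0|by move=> *; exact: diameter_ge0].
  apply: lee_nneseries => [i _ _|i _]; first by rewrite adde_ge0 ?diameter_ge0.
  have [[x [Ux Ax]]|UA] := pselect ((U i `&` A) !=set0).
    have -> : V B i = set0.
      rewrite -subset0 => z [_ [y [Uy By]]].
      have := diameter_ge Ux Uy => /le_trans/(_ (Ud i)); rewrite lee_fin.
      by move=> /(le_trans (AB _ _ Ax By)); rewrite leNgt de.
    by rewrite diameter_set0 adde0; exact: VU.
  have -> : V A i = set0 by rewrite -subset0 => z [].
  by rewrite diameter_set0 add0e; exact: VU.
have key2 d1 d2 : (0 < d1)%R -> (0 < d2)%R ->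
    hausdorff1_content d1 A + hausdorff1_content d2 B <= hausdorff1 (A `|` B).
  move=> d10 d20; pose d := Num.min (Num.min d1 d2) (e / 2)%R.
  have dd : (0 < d < e)%R.
    rewrite /d !lt_min d10 d20/= divr_gt0//= gt_min; apply/orP; right.
    by rewrite ltr_pdivrMr// ltr_pMr// ltr1n.
  apply: (le_trans _ (key d dd)); apply: leeD; apply: content_antimono.
    by rewrite /d !ge_min lexx.
  by rewrite /d !ge_min lexx orbT.
apply: sup_add_le => //.
- by exists (hausdorff1_content 1 A), 1%R => //=.
- exact: hausdorff1_ge0.
- by move=> _ [d _ <-]; exact: content_ge0.
move=> _ [d1 /= d10 <-]; rewrite addeC; apply: sup_add_le => //.
- by exists (hausdorff1_content 1 B), 1%R => //=.
- exact: content_ge0.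
- by move=> _ [d _ <-]; exact: content_ge0.
- by move=> _ [d2 /= d20 <-]; rewrite addeC; exact: key2.
Qed.

End hausdorff_outer.

(** * Caratheodory measurability of closed sets *)

Section hausdorff_closed.
Context {R : realType} {T : metricType R}.
Implicit Types (A B X F : set T).
Local Open Scope ereal_scope.

Let far F X n := [set x | X x /\ forall y, F y -> (n.+1%:R^-1 <= mdist x y)%R].

Let far_mono F X m n : (m <= n)%N -> far F X m `<=` far F X n.
Proof.
move=> mn x [Xx h]; split => // y Fy; apply: le_trans (h y Fy).
by rewrite lef_pV2 ?posrE ?ltr0n// ler_nat.
Qed.

Let far_separated F X m n : (m < n)%N -> exists2 e : R, (0 < e)%R &
  forall x y, far F X m x -> (X `\` far F X n) y -> (e <= mdist x y)%R.
Proof.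
move=> mn; exists (m.+1%:R^-1 - n.+1%:R^-1)%R.
  by rewrite subr_gt0 ltf_pV2 ?posrE ?ltr0n// ltr_nat.
move=> x y [Xx Fx] [Xy /= Fy].
have [z Fz zy] : exists2 z, F z & (mdist y z < n.+1%:R^-1)%R.
  apply: contrapT => h; apply: Fy; split => // z Fz.
  by rewrite leNgt; apply/negP => yz; apply: h; exists z.
have := Fx z Fz; have := metric_triangle x y z; move: zy.
by move=> zy t h; rewrite lerBlDr (le_trans h)// (le_trans t)// lerD2l ltW.
Qed.

Let shell F X n := far F X n.+1 `\` far F X n.

Let shell_far F X n : shell F X n `<=` far F X n.+1. Proof. by move=> x []. Qed.

(** Shells whose indices have the same parity are at positive distance from one another, so their
    measures add up inside [X]. *)
Let shell_sum F X p n :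
  \sum_(0 <= k < n) hausdorff1 (shell F X (p + k.*2)) <= hausdorff1 X.
Proof.
have farX k : far F X k `<=` X by move=> x [].
case: n => [|n]; first by rewrite big_nil hausdorff1_ge0.
apply: le_trans (le_hausdorff1 (farX (p + n.*2).+1)).
elim: n => [|n IH].
  by rewrite big_nat_recr//= big_nil add0e double0 addn0; exact: le_hausdorff1.
rewrite big_nat_recr//=; apply: (le_trans (leeD IH (lexx _))).
rewrite doubleS !addnS; set i := (p + n.*2)%N.
have [e e0 he] := @far_separated F X i.+1 i.+2 (leqnn _).
apply: (@le_trans _ _ (hausdorff1 (far F X i.+1 `|` shell F X i.+2))).
  by apply: (hausdorff1_separated e0) => x y fx [[fy _] nfy]; apply: he.
apply: le_hausdorff1 => x [|/shell_far//].
by apply: (far_mono (leqW (leqnSn _))).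
Qed.

Let shell_series F X : hausdorff1 X < +oo ->
  \sum_(0 <= k <oo) hausdorff1 (shell F X k) < +oo.
Proof.
move=> Xoo; apply: (@le_lt_trans _ _ (hausdorff1 X + hausdorff1 X)); last first.
  by rewrite lte_add_pinfty.
apply: lime_le; first by apply: is_cvg_nneseries => *; exact: hausdorff1_ge0.
near=> n.
have h m : \sum_(0 <= k < m.*2) hausdorff1 (shell F X k) =
    \sum_(0 <= k < m) hausdorff1 (shell F X (0 + k.*2)) +
    \sum_(0 <= k < m) hausdorff1 (shell F X (1 + k.*2)).
  elim: m => [|m IH]; first by rewrite !big_nil adde0.
  by rewrite doubleS !big_nat_recr//= IH add0n add1n -!addeA; congr (_ + _); rewrite addeCA.
apply: (@le_trans _ _ (\sum_(0 <= k < n.*2) hausdorff1 (shell F X k))).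
  rewrite [leRHS](big_cat_nat (n := n))//=; last by rewrite -addnn leq_addr.
  by rewrite leeDl// sume_ge0// => *; exact: hausdorff1_ge0.
by rewrite h; apply: leeD; exact: shell_sum.
Unshelve. all: by end_near. Qed.

(** The part of [X] outside [F] is exhausted by the sets [far F X n], each at positive distance from
    [F]. What is left after stage n lies in the later shells, whose measures form a convergent
    series (each parity sums to at most the measure of [X]), so it tends to zero. *)
Lemma closed_caratheodory F : closed F -> (@hausdorff1 R T).-caratheodory F.
Proof.
move=> cF; apply: le_caratheodory_measurable => X.
rewrite [leLHS]/= [leRHS]/=.
have [Xoo|] := ltP (hausdorff1 X) +oo; last by rewrite leye_eq => /eqP->; rewrite leey.
have tail := nneseries_tail_cvg (shell_series F Xoo) (fun k _ => hausdorff1_ge0 _).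
apply/lee_addgt0Pr => e e0.
have [n _ hn] : \forall n \near \oo, \sum_(n <= k <oo) hausdorff1 (shell F X k) < e%:E.
  by apply: (tail [set x | x < e%:E]); apply: open_ereal_lt'; rewrite lte_fin.
have XF : X `&` ~` F `<=` far F X n `|` \bigcup_k shell F X (k + n).
  move=> x [Xx nFx].
  have /nbhs_ballP[r /= r0 rF] : nbhs x (~` F) by apply: open_nbhs_nbhs; split => //; rewrite openC.
  have [m hm] : exists m, far F X m x.
    have [m _ /(_ m (leqnn _)) hm] := near_infty_natSinv_lt (PosNum r0).
    exists m; split => // y Fy; rewrite leNgt; apply/negP => xy.
    apply: (rF y) => //; rewrite ballEmdist/=; exact: lt_trans hm.
  elim: m hm => [|m IH] hm; first by left; apply: far_mono hm.
  have [/IH//|nm] := pselect (far F X m x).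
  have [mn|nm'] := leqP m.+1 n; first by left; apply: far_mono hm.
  by right; exists (m - n)%N => //; rewrite subnK.
have [d d0 hd] := @far_separated F X n n.+1 (leqnn _).
have sep : hausdorff1 (X `&` F) + hausdorff1 (far F X n) <= hausdorff1 X.
  apply: le_trans (le_hausdorff1 (_ : (X `&` F) `|` far F X n `<=` X)); last first.
    by move=> x [[]|[]].
  apply: (@hausdorff1_separated _ _ _ _ n.+1%:R^-1) => [|x y [_ Fx] [_ h]].
    by rewrite invr_gt0 ltr0n.
  by rewrite metric_sym; exact: h.
apply: (@le_trans _ _ (hausdorff1 (X `&` F) + (hausdorff1 (far F X n) + e%:E))).
  rewrite leeD2l//; apply: (le_trans (le_hausdorff1 XF)).
  apply: (le_trans (hausdorff1U _ _)); rewrite leeD2l//.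
  apply: (le_trans (hausdorff1_sigma_subadditive _)).
  apply: le_trans (ltW (hn n (leqnn _))).
  by rewrite -nneseries_addn// => *; exact: hausdorff1_ge0.
by rewrite addeA leeD2r.
Qed.

Lemma hausdorff1_split F X : closed F ->
  hausdorff1 X = hausdorff1 (X `&` F) + hausdorff1 (X `\` F).
Proof. by move=> /closed_caratheodory/(_ X). Qed.

Lemma hausdorff1_UI A B : closed A ->
  hausdorff1 (A `|` B) + hausdorff1 (A `&` B) = hausdorff1 A + hausdorff1 B.
Proof.
move=> cA; rewrite (hausdorff1_split (A `|` B) cA) (hausdorff1_split B cA).
rewrite setUK setDUl setDv set0U (setIC B) -addeA; congr (_ + _).
by rewrite addeC.
Qed.

End hausdorff_closed.

(** * Hausdorff measure and Lipschitz maps *)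

Section hausdorff_lipschitz.
Context {R : realType}.
Local Open Scope ereal_scope.

Lemma hausdorff1_lip {T T' : metricType R} (f : T -> T') (A : set T) :
  (forall x y, A x -> A y -> (mdist (f x) (f y) <= mdist x y)%R) ->
  hausdorff1 (f @` A) <= hausdorff1 A.
Proof.
move=> lip; apply: hausdorff1_le => d d0; apply: le_trans (hausdorff1_ge _ d0).
apply: le_ereal_inf_tmp => _ [U [AU Ud] <-].
have VU i : diameter (f @` (A `&` U i)) <= diameter (U i).
  apply: diameter_le (diameter_ge0 _) _ => _ _ [x [Ax Ux] <-] [y [Ay Uy] <-].
  by apply: le_trans (diameter_ge Ux Uy); rewrite lee_fin lip.
apply: (@le_trans _ _ (\sum_(0 <= i <oo) diameter (f @` (A `&` U i)))).
  apply: content_lbound => [_ [x Ax <-]|i]; last exact: le_trans (VU _) (Ud i).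
  by have [i _ Ux] := AU x Ax; exists i => //; exists x.
by apply: lee_nneseries => [i _ _|i _]; [exact: diameter_ge0|exact: VU].
Qed.

Lemma hausdorff1_curve {T : metricType R} (f : R -> T) (L : R) : (0 <= L)%R ->
  (forall s t, s \in `[0%R, L] -> t \in `[0%R, L] ->
     (mdist (f s) (f t) <= `|s - t|)%R) ->
  hausdorff1 (f @` `[0%R, L]) <= L%:E.
Proof.
move=> L0 lip; apply: hausdorff1_le => d d0.
have [N hN] : exists N : nat, (L / N.+1%:R <= d)%R.
  exists (Num.truncn (L / d)); rewrite ler_pdivrMr ?ltr0n//.
  rewrite mulrC -ler_pdivrMr//; apply: ltW; exact: truncnS_gt.
pose h := (L / N.+1%:R)%R; have h0 : (0 <= h)%R by rewrite divr_ge0.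
pose U i := if (i < N.+1)%N then
  f @` [set t | t \in `[0%R, L] /\ (h * i%:R <= t <= h * i.+1%:R)%R] else set0.
have Ud i : diameter (U i) <= (if (i < N.+1)%N then h else 0%R)%:E.
  rewrite /U; case: ifPn => _; last by rewrite diameter_set0.
  apply: diameter_le; first by rewrite lee_fin.
  move=> _ _ [s [s0 /andP[s1 s2]] <-] [t [t0 /andP[t1 t2]] <-].
  rewrite lee_fin (le_trans (lip _ _ s0 t0))// ler_norml.
  by move: s1 s2 t1 t2; rewrite -natr1 mulrDr mulr1; lra.
have hL : (h * N.+1%:R = L)%R by rewrite /h divfK// pnatr_eq0.
apply: (le_trans (content_lbound (U := U) _ _)).
- move=> y [t /=]; rewrite in_itv/= => /andP[t0 tL] <- {y}.
  have [->|t0'] := eqVneq t 0%R.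
    exists 0%N => //; rewrite /U ltnS leq0n; exists 0%R => //=.
    by rewrite in_itv/= lexx L0 mulr0 mulr1 lexx h0.
  have tgt : (0 < t)%R by rewrite lt_neqAle eq_sym t0'.
  have hgt : (0 < h)%R.
    rewrite lt_neqAle h0 andbT eq_sym; apply: contraTneq (lt_le_trans tgt tL).
    by rewrite -hL => ->; rewrite mul0r ltxx.
  (* At the right end the truncated quotient would be [N.+1], one index too far. *)
  have [->|tL'] := eqVneq t L.
    exists N => //; rewrite /U ltnSn; exists L => //=; split.
      by rewrite in_itv/= L0 lexx.
    by rewrite -hL lexx andbT ler_wpM2l// ler_nat.
  have tltL : (t < L)%R by rewrite lt_neqAle tL'.
  exists (Num.truncn (t / h)) => //.
  have /andP[k1 k2] := truncn_itv (divr_ge0 t0 h0).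
  have kN : (Num.truncn (t / h) < N.+1)%N.
    rewrite -(ltr_nat R); apply: (le_lt_trans k1).
    by rewrite ltr_pdivrMr// mulrC hL.
  rewrite /U kN; exists t => //=; split; first by rewrite in_itv/= t0 tL.
  rewrite mulrC -ler_pdivlMr// k1/= mulrC -ler_pdivrMr//; exact: ltW.
- move=> i; apply: (le_trans (Ud i)); rewrite lee_fin; case: ifP => // _.
  exact: ltW.
apply: (@le_trans _ _ (\sum_(0 <= i <oo) (if (i < N.+1)%N then h else 0%R)%:E)).
  by apply: lee_nneseries => [i _ _|i _]; [exact: diameter_ge0|exact: Ud].
rewrite (nneseries_split 0 N.+1)/=; last by move=> k _; case: ifP; rewrite lee_fin.
rewrite add0n eseries0 ?adde0; last by move=> i Ni _; rewrite ltnNge Ni.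
rewrite sumEFin lee_fin (eq_big_nat _ _ (F2 := fun=> h)); last by move=> i /andP[_ ->].
by rewrite big_const_nat subn0 iter_addr_0 -mulr_natr hL.
Qed.

(** A 1-Lipschitz function turns a cover of [A] into a cover of the interval by intervals no longer
    than the diameters; subadditivity of Lebesgue measure bounds their total length from below. *)
Lemma hausdorff1_ge_itv {T : metricType R} (f : T -> R) (A : set T) (a b : R) :
  (a <= b)%R -> `[a, b]%classic `<=` f @` A ->
  (forall x y, A x -> A y -> (`|f x - f y| <= mdist x y)%R) ->
  (b - a)%:E <= hausdorff1 A.
Proof.
move=> ab abA lip; apply: le_trans (hausdorff1_ge _ ltr01).
apply: le_ereal_inf_tmp => _ [U [AU Ud] <-].
have dfin i : diameter (U i) \is a fin_num.
  by rewrite ge0_fin_numE ?diameter_ge0//; apply: le_lt_trans (Ud i) _; rewrite ltey.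
pose E i := f @` (A `&` U i).
(* The infimum of an empty image would be a default value, hence the separate case. *)
pose I i : set R := if pselect (E i !=set0) then
  `[inf (E i), (inf (E i) + fine (diameter (U i)))%R]%classic else set0.
have mI i : measurable (I i) by rewrite /I; case: pselect => ? //=; exact: measurable_itv.
have EI i : E i `<=` I i.
  move=> r Er; rewrite /I; case: pselect => [E0|] /=; last by case; exists r.
  have lbE : lbound (E i) (r - fine (diameter (U i)))%R.
    move=> _ [y [Ay Uy] <-]; move: Er => [x [Ax Ux] <-].
    have : (`|f x - f y| <= fine (diameter (U i)))%R.
      apply: (le_trans (lip _ _ Ax Ay)); rewrite -lee_fin fineK//.
      exact: diameter_ge.
    by rewrite ler_norml => /andP[_]; lra.
  rewrite /= in_itv/= ge_inf//=; last by exists (r - fine (diameter (U i)))%R.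
  by rewrite -lerBlDr; exact: lb_le_inf.
have lI i : lebesgue_measure (I i) <= diameter (U i).
  rewrite /I; case: pselect => ? /=; last by rewrite measure0 diameter_ge0.
  rewrite lebesgue_measure_itv/= lte_fin; case: ifP => _; last exact: diameter_ge0.
  by rewrite -EFinB addrAC subrr add0r fineK.
have <- : lebesgue_measure `[a, b]%classic = (b - a)%:E.
  rewrite lebesgue_measure_itv/= lte_fin -EFinB.
  by case: ltgtP ab => // -> _; rewrite subrr.
apply: (@le_trans _ _ (\sum_(0 <= i <oo) lebesgue_measure (I i))).
  apply: measure_sigma_subadditive => //.
  move=> r /abA[x Ax <-]; have [i _ Ux] := AU x Ax.
  by exists i => //; apply: EI; exists x.
by apply: lee_nneseries.
Qed.

Lemma hausdorff1_set1 {T : metricType R} (x : T) : hausdorff1 [set x] = 0.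
Proof.
apply/eqP; rewrite eq_le hausdorff1_ge0 andbT.
have /= := @hausdorff1_curve T (fun=> x) 0%R (lexx _).
rewrite (_ : _ @` _ = [set x]); first by apply => s t _ _; rewrite mdistxx.
rewrite predeqE => y; split => [[_ _ <-]//|->]; exists 0%R => //=.
by rewrite in_itv/= lexx.
Qed.

End hausdorff_lipschitz.

(** * Topology of the hyperbolic plane and interiors of convex sets *)

Section hyperbolic_topology.
Context {R : realType}.
Local Notation vec := (R * R * R)%type.
Local Notation H := (hplane R).
Local Notation "<< x , y >>" := (minkowski x y).
Local Coercion hpt : hplane >-> prod.
Implicit Types (x y z : H) (u : vec) (C K : set H).

(* Instance search unfolds the neighbourhoods of [hplane] to this form. *)
#[export] Instance hplane_nbhs_filter x : Filter (nbhs x) := nbhs_filter x.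

Lemma mdist_continuous y : continuous (fun x : H => mdist x y : R).
Proof.
move=> x; apply/(@pseudometric_normed_Zmodule.cvgrPdist_lt R R^o _ (nbhs x) (nbhs_filter x)) => e e0; near=> z.
have xz : mdist x z < e.
  by near: z; apply/nbhs_ballP; exists e => //= z; rewrite ballEmdist.
apply: le_lt_trans xz; rewrite ler_norml; apply/andP; split.
  have := metric_triangle z x y; rewrite (metric_sym z x); rewrite lerBrDr; lra.
by have := metric_triangle x z y; lra.
Unshelve. all: by end_near. Qed.

Let mink_continuous_pt y : continuous (fun x : H => <<x, y>> : R).
Proof.
rewrite (_ : (fun x => _) = (@ch R) \o (fun x : H => mdist x y : R)).
  by move=> x; apply: continuous_comp; [exact: mdist_continuous|exact: continuous_ch].
by apply/funext => x /=; rewrite ch_mdist.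
Qed.

(** Products with points are continuous because distances are. Together with [horigin], the points
    (1, 0, sqrt2) and (0, 1, sqrt2) form a basis, so products with these three recover all
    coordinates. *)
Let sqrt2 := Num.sqrt (2 : R).
Let sqrt22 : sqrt2 ^+ 2 = 2. Proof. by rewrite sqr_sqrtr. Qed.
Let ex_proof : (<<(1, 0, sqrt2) : vec, (1, 0, sqrt2)>> == 1) && (0 < ((1, 0, sqrt2) : vec).2).
Proof.
rewrite /minkowski/= sqrtr_gt0 ltr0n andbT; apply/eqP.
by rewrite -expr2 sqrt22; ring.
Qed.
Let ey_proof : (<<(0, 1, sqrt2) : vec, (0, 1, sqrt2)>> == 1) && (0 < ((0, 1, sqrt2) : vec).2).
Proof.
rewrite /minkowski/= sqrtr_gt0 ltr0n andbT; apply/eqP.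
by rewrite -expr2 sqrt22; ring.
Qed.

Lemma hpt2_continuous : continuous (fun x : H => (hpt x).2 : R).
Proof.
rewrite (_ : (fun x => _) = (fun x : H => <<x, horigin>> : R)); first exact: mink_continuous_pt.
by apply/funext => x; rewrite /minkowski/=; ring.
Qed.

Lemma hpt11_continuous : continuous (fun x : H => (hpt x).1.1 : R).
Proof.
rewrite (_ : (fun x => _) =
    (fun x : H => sqrt2 * (hpt x).2 - <<x, HPlane ex_proof>> : R)).
  move=> x; apply: cvgB; last exact: mink_continuous_pt.
  by apply: cvgM; [exact: cvg_cst|exact: hpt2_continuous].
by apply/funext => x; rewrite /minkowski/=; ring.
Qed.

Lemma hpt12_continuous : continuous (fun x : H => (hpt x).1.2 : R).
Proof.
rewrite (_ : (fun x => _) =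
    (fun x : H => sqrt2 * (hpt x).2 - <<x, HPlane ey_proof>> : R)).
  move=> x; apply: cvgB; last exact: mink_continuous_pt.
  by apply: cvgM; [exact: cvg_cst|exact: hpt2_continuous].
by apply/funext => x; rewrite /minkowski/=; ring.
Qed.

Lemma mink_cvg (S : Type) (F : set_system S) (FF : Filter F) (v w : S -> vec) u u' :
  (v t).1.1 @[t --> F] --> u.1.1 -> (v t).1.2 @[t --> F] --> u.1.2 ->
  (v t).2 @[t --> F] --> u.2 ->
  (w t).1.1 @[t --> F] --> u'.1.1 -> (w t).1.2 @[t --> F] --> u'.1.2 ->
  (w t).2 @[t --> F] --> u'.2 ->
  <<v t, w t>> @[t --> F] --> <<u, u'>>.
Proof. by move=> *; apply: cvgB; [apply: cvgB|]; apply: cvgM. Qed.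

Lemma mink_continuous u : continuous (fun x : H => <<u, x>> : R).
Proof.
move=> x; apply: mink_cvg; try exact: cvg_cst.
- exact: hpt11_continuous.
- exact: hpt12_continuous.
- exact: hpt2_continuous.
Qed.

Lemma nbhs_minkP x (A : set H) :
  nbhs x A <-> exists2 c : R, 1 < c & forall z, <<x, z>> < c -> A z.
Proof.
split.
  move=> /nbhs_ballP[r /= r0 rA]; exists (ch r).
    by rewrite -(ch0 (R := R)) ch_ltr// ltW.
  move=> z; rewrite -ch_mdist ch_ltr ?mdist_ge0 ?(ltW r0)// => xz; apply: rA.
  by rewrite ballEmdist.
move=> [c c1 cA]; apply: filterS cA _.
have : nbhs x ((fun z : H => <<x, z>> : R) @^-1` [set r | r < c]).
  apply: mink_continuous; apply: (@open_nbhs_nbhs _ (<<x, x>> : R)); split; last by rewrite /= minkxx.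
  exact: open_lt.
by [].
Qed.

(** The tool for perturbing points: move the vector linearly off the sheet, then project back. It
    yields both the eventual validity of [hnormalE] and the convergence. *)
Lemma hnormal_cvg (S : Type) (F : set_system S) (FF : Filter F) (v : S -> vec) z :
  (v t).1.1 @[t --> F] --> z.1.1 -> (v t).1.2 @[t --> F] --> z.1.2 ->
  (v t).2 @[t --> F] --> z.2 ->
  (\forall t \near F, 0 < <<v t, v t>> /\ 0 < <<v t, z>>) /\
  (hnormal (v t) @[t --> F] --> z).
Proof.
move=> v1 v2 v3.
have vv : <<v t, v t>> @[t --> F] --> (1 : R).
  by rewrite -(minkxx z); exact: mink_cvg.
have vz : <<v t, z>> @[t --> F] --> (1 : R).
  by rewrite -(minkxx z); apply: mink_cvg => //; exact: cvg_cst.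
have h1 : \forall t \near F, 0 < <<v t, v t>> by apply: (cvgr_gt _ vv).
have h2 : \forall t \near F, 0 < <<v t, z>> by apply: (cvgr_gt _ vz).
split; first by near=> t; split; near: t.
move=> A /nbhs_minkP[c c1 cA].
have q : <<v t, z>> / Num.sqrt <<v t, v t>> @[t --> F] --> (1 / Num.sqrt 1 : R).
  apply: cvgM => //; apply: cvgV; first by rewrite sqrtr1 oner_neq0.
  apply: (continuous_cvg _ _ vv); exact: sqrt_continuous.
suff hc : \forall t \near F, <<z, hnormal (v t)>> < c.
  by apply: filterS hc => t; exact: cA.
near=> t; have t1 : 0 < <<v t, v t>> by near: t.
have t2 : 0 < <<v t, z>> by near: t.
rewrite (hnormalE t1 t2) mink_linr mul0r addr0 minkowskiC mulrC.
near: t; by apply: (cvgr_lt _ q); rewrite sqrtr1 divr1.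
Unshelve. all: by end_near. Qed.

Lemma closed_halfspace u : closed [set x : H | 0 <= <<u, x>>].
Proof.
apply: (@preimage_closed _ _ (fun x : H => <<u, x>> : R) [set r | 0 <= r]).
  by move=> x _; exact: mink_continuous.
exact: closed_ge.
Qed.

Lemma open_halfspace u : open [set x : H | 0 < <<u, x>>].
Proof.
apply: (@open_comp _ _ (fun x : H => <<u, x>> : R) [set r | 0 < r]).
  by move=> x _; exact: mink_continuous.
exact: open_gt.
Qed.

Lemma compact_closedH C : compact C -> closed C.
Proof. by move=> cC; apply: compact_closed cC; exact: metric_hausdorff. Qed.

Lemma compact_min (f : H -> R) C : continuous f -> compact C -> C !=set0 ->
  exists2 c, C c & forall x, C x -> f c <= f x.
Proof.
move=> cf cC C0; have [|c] := @compact_EVT_min _ R f C C0 cC.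
  exact: continuous_subspaceT.
by rewrite inE => Cc h; exists c => // x Cx; apply: h; rewrite inE.
Qed.

Lemma compact_max (f : H -> R) C : continuous f -> compact C -> C !=set0 ->
  exists2 c, C c & forall x, C x -> f x <= f c.
Proof.
move=> cf cC C0; have [|c] := @compact_EVT_max _ R f C C0 cC.
  exact: continuous_subspaceT.
by rewrite inE => Cc h; exists c => // x Cx; apply: h; rewrite inE.
Qed.

Lemma normal_seg x y (a b : R) : 0 <= a -> 0 <= b -> 0 < a + b ->
  exists2 s, 0 < s & exists2 z, seg x y z & hpt z = lin (s * a) x (s * b) y.
Proof.
move=> a0 b0 ab0; pose v : vec := lin a x b y; have m1 := minkowski_ge1 x y.
have vv : 0 < <<v, v>>.
  rewrite /v !mink_lin !minkxx (minkowskiC y x); set m := << _, _ >> in m1 *.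
  have : 0 < (a + b) ^+ 2 by rewrite exprn_gt0.
  have : a * b <= a * b * m by rewrite ler_peMr// mulr_ge0.
  by lra.
have vx : 0 < <<v, x>>.
  rewrite /v !mink_lin minkxx (minkowskiC y x); set m := << _, _ >> in m1 *.
  by have : b <= b * m; [rewrite ler_peMr|lra].
have s0 : 0 < (Num.sqrt <<v, v>>)^-1 by rewrite invr_gt0 sqrtr_gt0.
exists (Num.sqrt <<v, v>>)^-1 => //.
have E : hpt (hnormal v) = lin ((Num.sqrt <<v, v>>)^-1 * a) x ((Num.sqrt <<v, v>>)^-1 * b) y.
  by rewrite (hnormalE vv vx); apply: vec_eq; rewrite /v /lin/=; ring.
exists (hnormal v) => //; exists ((Num.sqrt <<v, v>>)^-1 * a), ((Num.sqrt <<v, v>>)^-1 * b).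
by rewrite E !mulr_ge0// ltW.
Qed.

Lemma convex_lin C x y z (a b : R) : geodesically_convex C -> C x -> C y ->
  0 <= a -> 0 <= b -> hpt z = lin a x b y -> C z.
Proof.
move=> /geodesically_convexP cC Cx Cy a0 b0 E.
by apply: (cC x y Cx Cy); exists a, b.
Qed.

Lemma convex_lin3 C x y z t (a b c : R) : geodesically_convex C -> C x -> C y -> C z ->
  0 <= a -> 0 <= b -> 0 <= c -> hpt t = lin 1 (lin a x b y) c z -> C t.
Proof.
move=> cC Cx Cy Cz a0 b0 c0 E.
have : 0 <= a + b by exact: addr_ge0.
rewrite le_eqVlt => /orP[/eqP/esym ab0|ab0].
  have {ab0}[a0' b0'] : a = 0 /\ b = 0 by split; lra.
  apply: (convex_lin cC Cz Cz c0 (lexx 0)).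
  by rewrite E a0' b0'; apply: vec_eq; rewrite /lin/=; ring.
have [s s0 [w ws wE]] := normal_seg x y a0 b0 ab0.
have Cw : C w by move/geodesically_convexP : cC; apply; [exact: Cx|exact: Cy|].
apply: (convex_lin cC Cw Cz _ c0 (a := s^-1)); first by rewrite invr_ge0 ltW.
rewrite E wE; apply: vec_eq; rewrite /lin/=; field; rewrite gt_eqF//.
Qed.

(** Solving [x = a z + b y] for z gives a map that is continuous at [x]. Hence any x' near [x] is a
    combination of [y] and a point of [K] close to [z]. *)
Lemma interior_lin K x y z (a b : R) : geodesically_convex K -> K° z -> K y ->
  0 < a -> 0 <= b -> hpt x = lin a z b y -> K° x.
Proof.
move=> cK Kz Ky a0 b0 E; rewrite /interior.
pose v x' : vec := lin a^-1 (hpt x') (- b / a) y.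
have vx : v x = z.
  rewrite /v E; apply: vec_eq; rewrite /lin/=; field; rewrite gt_eqF//.
have [] := @hnormal_cvg H (nbhs x) _ v z.
- rewrite -vx /v /lin/=; apply: cvgD; last exact: cvg_cst.
  by apply: cvgM; [exact: cvg_cst|exact: hpt11_continuous].
- rewrite -vx /v /lin/=; apply: cvgD; last exact: cvg_cst.
  by apply: cvgM; [exact: cvg_cst|exact: hpt12_continuous].
- rewrite -vx /v /lin/=; apply: cvgD; last exact: cvg_cst.
  by apply: cvgM; [exact: cvg_cst|exact: hpt2_continuous].
move=> h1 /(_ _ Kz) h2; near=> x'.
have [vv vz] : 0 < <<v x', v x'>> /\ 0 < <<v x', z>> by near: x'.
have Kv : K (hnormal (v x')) by near: x'.
have s0 : 0 < Num.sqrt <<v x', v x'>> by rewrite sqrtr_gt0.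
apply: (convex_lin cK Kv Ky _ b0 (a := a * Num.sqrt <<v x', v x'>>)).
  by rewrite mulr_ge0// ltW.
rewrite (hnormalE vv vz); move: s0; set s := Num.sqrt _ => s0.
by apply: vec_eq; rewrite /v /lin/=; field; rewrite !gt_eqF.
Unshelve. all: by end_near. Qed.

Lemma cvg_lin0 (a b : R) : a + e * b @[e --> 0^'+] --> a.
Proof.
have : a + e * b @[e --> 0^'+] --> a + 0 * b.
  apply: cvgD; first exact: cvg_cst.
  by apply: cvgM; [exact: cvg_at_right_filter|exact: cvg_cst].
by rewrite mul0r addr0.
Qed.

(** The Cramer coefficients of a point are its orientations against the three sides, so the open
    triangle is an intersection of three open half-planes; it contains [p], obtained by joining a
    point of one side to the third vertex. *)
Lemma triangle_interior C x y z : geodesically_convex C -> C x -> C y -> C z ->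
  0 < det3 x y z -> C° !=set0.
Proof.
move=> cC Cx Cy Cz D0.
have [s s0 [w ws wE]] := normal_seg x y ler01 ler01 (addr_gt0 ltr01 ltr01).
have [r r0 [p ps pE]] := normal_seg w z ler01 ler01 (addr_gt0 ltr01 ltr01).
pose A : set H := [set t | 0 < <<mcross y z, t>>] `&`
  ([set t | 0 < <<mcross z x, t>>] `&` [set t | 0 < <<mcross x y, t>>]).
exists p; apply: (@filterS _ _ _ A).
  move=> t [/= + [+]]; rewrite !mink_cross => h1 h2 h3.
  apply: (convex_lin3 (t := t) (a := det3 y z t / det3 x y z)
    (b := det3 z x t / det3 x y z) (c := det3 x y t / det3 x y z) cC Cx Cy Cz);
    rewrite ?divr_ge0// ?ltW//.
  have := cramer x y z t; rewrite -(det3C t y z) (det3C x t z) (det3C t z x) => E.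
  have := congr1 (fun u : vec => u.1.1) E; have := congr1 (fun u : vec => u.1.2) E.
  have := congr1 (fun u : vec => u.2) E; rewrite /lin/= !mul0r !addr0 !mul1r => E1 E2 E3.
  apply: vec_eq; rewrite /lin/=; apply: (mulfI (lt0r_neq0 D0)); rewrite ?E1 ?E2 ?E3;
    by field; rewrite gt_eqF.
have oA : open A by apply: openI; [|apply: openI]; exact: open_halfspace.
apply: open_nbhs_nbhs; split => //.
rewrite /A /= !mink_cross pE wE !det3_lin !det3_0 -(det3C x y z) -(det3C y z x) -(det3C x y z).
by rewrite !(mulr0, addr0, add0r, mulr1) ?mulr_gt0.
Qed.

End hyperbolic_topology.

(** * Nearest point projection and finiteness of perimeters *)

Section nearest_point_projection.
Context {R : realType}.
Local Notation vec := (R * R * R)%type.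
Local Notation H := (hplane R).
Local Notation "<< x , y >>" := (minkowski x y).
Local Coercion hpt : hplane >-> prod.
Implicit Types (x y z a b : H) (u : vec) (C K S : set H).

Lemma mdist_le_mink x y x' y' : <<x, y>> <= <<x', y'>> -> mdist x y <= mdist x' y'.
Proof. by rewrite -!ch_mdist ch_ler ?mdist_ge0. Qed.

(** By the hyperbolic law of cosines the hypotheses say that the quadrilateral a a' b' b has no
    acute angle at a' and b'. Gram determinants on the frame a', b' express [<<a, b>>] through the
    other products, up to a term bounded by Cauchy-Schwarz. *)
Lemma obtuse_expand a b a' b' : <<a, a'>> * <<a', b'>> <= <<a, b'>> ->
  <<b, b'>> * <<a', b'>> <= <<b, a'>> -> <<a', b'>> <= <<a, b>>.
Proof.
have [<- _ _|ab'] := eqVneq a' b'; first by rewrite minkxx minkowski_ge1.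
have m1 := mink_gt1 ab'.
have E1 := gram_det a a' b' b a' b'; have E2 := gram_det a a' b' a a' b'.
have E3 := gram_det b a' b' b a' b'; move: E1 E2 E3.
rewrite !minkxx !(minkowskiC b' a') !(minkowskiC a' a) !(minkowskiC b' a)
  !(minkowskiC a' b) !(minkowskiC b' b).
move: m1 (minkowski_ge1 a a') (minkowski_ge1 b b').
set m := <<a', b'>>; set A := <<a, a'>>; set B := <<b, b'>>.
set A' := <<a, b'>>; set B' := <<b, a'>>; set w := <<a, b>>.
set E := det3 a a' b'; set E' := det3 b a' b'.
move=> m1 A1 B1 EE E2 E'2 hA hB.
pose n := m ^+ 2 - 1; have n0 : 0 < n by rewrite subr_gt0 expr_gt1//; lra.
pose c := A' - A * m; pose c' := B' - B * m.
have c0 : 0 <= c by rewrite subr_ge0.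
have c'0 : 0 <= c' by rewrite subr_ge0.
have wE : n * w = - (E * E') + m * A * B * n + A * c' * n + c * B * n + m * c * c'.
  by rewrite EE /n /c /c'; ring.
have E2' : E ^+ 2 <= n * (A ^+ 2 - 1).
  have -> : E ^+ 2 = n * (A ^+ 2 - 1) - c ^+ 2 by rewrite [LHS]expr2 E2 /n /c; ring.
  by rewrite gerBl sqr_ge0.
have E'2' : E' ^+ 2 <= n * (B ^+ 2 - 1).
  have -> : E' ^+ 2 = n * (B ^+ 2 - 1) - c' ^+ 2 by rewrite [LHS]expr2 E'2 /n /c'; ring.
  by rewrite gerBl sqr_ge0.
have AB1 : 0 <= A * B - 1 by nra.
have EE' : E * E' <= n * (A * B - 1).
  have h : (E * E') ^+ 2 <= (n * (A * B - 1)) ^+ 2.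
    rewrite exprMn; apply: (le_trans (ler_pM (sqr_ge0 _) (sqr_ge0 _) E2' E'2')).
    rewrite -subr_ge0; have -> : (n * (A * B - 1)) ^+ 2 -
      n * (A ^+ 2 - 1) * (n * (B ^+ 2 - 1)) = (n * (A - B)) ^+ 2 by ring.
    exact: sqr_ge0.
  apply: (le_trans (ler_norm _)); rewrite -ler_sqr ?nnegrE//; last first.
    by rewrite mulr_ge0// ltW.
  by rewrite real_normK// num_real.
rewrite -(ler_pM2l n0) wE.
have t1 : 0 <= A * c' * n by rewrite !mulr_ge0//; lra.
have t2 : 0 <= c * B * n by rewrite !mulr_ge0//; lra.
have t3 : 0 <= m * c * c' by rewrite !mulr_ge0//; lra.
have t4 : 0 <= n * ((m - 1) * (A * B - 1)) by rewrite !mulr_ge0//; lra.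
by lra.
Qed.

Lemma nearest_obtuse C a a' : geodesically_convex C -> C a' ->
  (forall z, C z -> <<a, a'>> <= <<a, z>>) ->
  forall z, C z -> <<a, a'>> * <<a', z>> <= <<a, z>>.
Proof.
move=> /geodesically_convexP cC Ca' near_a z Cz; rewrite leNgt; apply/negP => lt.
have A1 := minkowski_ge1 a a'.
(* An acute angle at a' makes a small move towards [z] shorten the distance to [a]. The denominator
   keeps t so small that the second-order term [t * <<a, z>> ^+ 2] stays below the first-order
   gain. *)
pose t := (<<a, a'>> * <<a', z>> - <<a, z>>) / (1 + <<a, z>> ^+ 2).
have B0 : 0 < 1 + <<a, z>> ^+ 2 by rewrite ltr_wpDr ?sqr_ge0.
have t0 : 0 < t by rewrite divr_gt0// subr_gt0.
have [s s0 [p ps pE]] := normal_seg a' z ler01 (ltW t0) (ltr_pwDl ltr01 (ltW t0)).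
have /near_a : C p by exact: cC ps.
have := minkxx p; rewrite {1 2 3}pE !mink_lin !minkxx (minkowskiC z a').
have tE : t * (1 + <<a, z>> ^+ 2) = <<a, a'>> * <<a', z>> - <<a, z>>.
  by rewrite /t divfK// gt_eqF.
move: lt tE A1; set A := <<a, a'>>; set B := <<a, z>>; set m := <<a', z>>.
move=> lt tE A1 nrm le1.
have h1 : A ^+ 2 <= (s * (A + t * B)) ^+ 2.
  by rewrite ler_sqr ?nnegrE; [|lra|]; lra.
have sq : s ^+ 2 * (1 + 2 * t * m + t ^+ 2) = 1 by lra.
have s20 : 0 < s ^+ 2 by rewrite exprn_gt0.
have h2 : A ^+ 2 * (1 + 2 * t * m + t ^+ 2) <= (A + t * B) ^+ 2.
  rewrite -(ler_pM2l s20) mulrCA sq mulr1; move: h1; rewrite exprMn//.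
have h3 : 2 * A * (A * m - B) <= t * (B ^+ 2 - A ^+ 2).
  rewrite -(ler_pM2l t0); lra.
have h4 : t * B ^+ 2 < A * m - B by rewrite -tE mulrDr mulr1 ltrDr.
have h5 : 0 <= t * A ^+ 2 by rewrite mulr_ge0 ?sqr_ge0// ltW.
have h6 : A * m - B <= A * (A * m - B) by rewrite ler_peMl// subr_ge0 ltW.
by lra.
Qed.

(* The nearest point projection onto [C] is 1-Lipschitz and maps the point of [S] on an
   outward normal ray back to the foot of that ray. *)
Lemma Per_le C S : compact C -> geodesically_convex C -> C !=set0 -> compact S ->
  (forall a u, C a -> tangent a u -> (forall z, C z -> 0 <= <<u, z>>) ->
     exists2 s, 0 <= s & S (ray a u s)) ->
  (Per C <= hausdorff1 S)%E.
Proof.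
move=> kC cC C0 kS hitS.
have /choice[p Pp] a : exists a', C a' /\ forall z, C z -> <<a, a'>> * <<a', z>> <= <<a, z>>.
  have [a' Ca' h] := compact_min (mink_continuous (u := a)) kC C0.
  by exists a'; split => //; exact: nearest_obtuse.
have pC a : C (p a) by have [] := Pp a.
have plip a b : mdist (p a) (p b) <= mdist a b.
  apply: mdist_le_mink; have [_ ha] := Pp a; have [_ hb] := Pp b.
  by apply: obtuse_expand; [exact: ha|rewrite (minkowskiC (p a)) hb].
have puniq a a' : C a' -> (forall z, C z -> <<a, a'>> * <<a', z>> <= <<a, z>>) -> p a = a'.
  move=> Ca' h; apply/esym/mink1_eq/eqP; rewrite eq_le minkowski_ge1 andbT -(minkxx a).
  have [_ ha] := Pp a; apply: obtuse_expand; first exact: h.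
  by rewrite (minkowskiC a') ha.
have pcont : continuous p.
  move=> a A /nbhs_ballP[r /= r0 rA]; apply/nbhs_ballP; exists r => //= b.
  rewrite ballEmdist /= => ab; apply: rA; rewrite ballEmdist/=.
  exact: le_lt_trans ab.
have cpS : closed (p @` S).
  apply: compact_closedH; apply: continuous_compact => //.
  exact: continuous_subspaceT.
suff bC : boundary C `<=` p @` S.
  by apply: (le_trans (le_hausdorff1 bC)); apply: hausdorff1_lip.
move=> x [clx nix]; have {clx}Cx : C x by apply: (compact_closedH kC).
apply: cpS => A /nbhs_ballP[r /= r0 rA].
have [a nCa xa] : exists2 a, ~ C a & mdist x a < r / 2.
  apply: contrapT => h; apply: nix; apply/nbhs_ballP; exists (r / 2); first exact: divr_gt0.
  move=> a; rewrite ballEmdist/= => xa; apply: contrapT => nCa; apply: h.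
  by exists a.
have paa : p a != a by apply/eqP => paa; apply: nCa; rewrite -paa.
have tu := tangent_hdir paa.
have hu z : C z -> 0 <= <<hdir (p a) a, z>>.
  move=> Cz; rewrite /hdir mink_linl ch_mdist.
  rewrite -mulrA mulNr mulrCA -mulrBr.
  rewrite mulr_ge0 ?invr_ge0 ?(ltW (sh_mdist_gt0 paa))//.
  by have [_ /(_ z Cz)] := Pp a; rewrite (minkowskiC (p a) a) subr_ge0.
move: (hdir (p a) a) tu hu => u tu hu.
have [s s0 Ss] := hitS (p a) _ (pC a) tu hu.
exists (p a); split.
  exists (ray (p a) u s) => //; apply: puniq => // z Cz.
  rewrite !rayE// !mink_linl minkxx; have [+ _] := tu.
  rewrite minkowskiC => ->; rewrite mulr0 addr0 mulr1 lerDl mulr_ge0 ?sh_ge0//.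
  exact: hu.
apply: rA; rewrite ballEmdist/=; apply: (le_lt_trans (metric_triangle _ a _)).
rewrite (splitr r) ltrD//; apply: le_lt_trans xa; rewrite metric_sym.
rewrite (metric_sym x).
apply: mdist_le_mink; rewrite minkowskiC; have [_ /(_ x Cx)] := Pp a.
by apply: le_trans; rewrite ler_peMr ?minkowski_ge1// ltW ?mink_gt0.
Qed.

Lemma curve_continuous (f : R -> H) :
  (forall s t, mdist (f s) (f t) <= `|s - t|) -> continuous f.
Proof.
move=> lip t A /nbhs_ballP[r /= r0 rA]; apply/nbhs_ballP; exists r => //= s ts.
by apply: rA; rewrite ballEmdist/=; exact: le_lt_trans ts.
Qed.

Lemma curve_compact (f : R -> H) (L : R) :
  (forall s t, mdist (f s) (f t) <= `|s - t|) -> compact (f @` `[0, L]).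
Proof.
move=> /curve_continuous cf; apply: continuous_compact; last exact: segment_compact.
exact: continuous_subspaceT.
Qed.

(** The hyperboloid as a graph over the Euclidean plane. *)
Let hgraph (x y : R) : H := hnormal (x, y, Num.sqrt (1 + x ^+ 2 + y ^+ 2)).

Let hgraphE (x y : R) : hpt (hgraph x y) = (x, y, Num.sqrt (1 + x ^+ 2 + y ^+ 2)).
Proof.
have h : 0 < 1 + x ^+ 2 + y ^+ 2.
  by have := sqr_ge0 x; have := sqr_ge0 y; lra.
apply: (hnormal1 (x := horigin)); rewrite /minkowski/=.
  by rewrite -!expr2 sqr_sqrtr ?ltW//; ring.
by rewrite !mulr0 mulr1 !subr0 sqrtr_gt0.
Qed.

(** The last coordinate enters Minkowski squares with the opposite sign, so lifting to the graph
    does not increase lengths. *)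
Let hgraph_lip (x y x' y' e : R) : (x - x') ^+ 2 + (y - y') ^+ 2 <= e ^+ 2 ->
  mdist (hgraph x y) (hgraph x' y') <= `|e|.
Proof.
move=> he; rewrite -ch_ler ?mdist_ge0// ch_mdist !hgraphE.
apply: le_trans (ch_ge_sq _); rewrite real_normK ?num_real// /minkowski/=.
have h : 0 <= 1 + x ^+ 2 + y ^+ 2 by have := sqr_ge0 x; have := sqr_ge0 y; lra.
have h' : 0 <= 1 + x' ^+ 2 + y' ^+ 2 by have := sqr_ge0 x'; have := sqr_ge0 y'; lra.
have := sqr_sqrtr h; have := sqr_sqrtr h'.
set t := Num.sqrt _; set t' := Num.sqrt _ => e1 e2.
by have := sqr_ge0 (t - t'); lra.
Qed.

Let hpt_graph (p : H) : p = hgraph (hpt p).1.1 (hpt p).1.2.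
Proof.
apply: hpt_inj; rewrite hgraphE; have := minkxx p; have := hpt2_gt0 p.
case: (hpt p) => -[x y] t; rewrite /minkowski/= => t0 h; apply: vec_eq => //=.
rewrite (_ : 1 + _ + _ = t ^+ 2); last by lra.
by rewrite sqrtr_sqr gtr0_norm.
Qed.

Lemma ch_unbounded (B : R) : exists2 s, 0 <= s & B < ch s.
Proof.
exists (1 + `|B|); first by have := normr_ge0 B; lra.
apply: lt_le_trans (ch_ge_sq _); have := ler_norm B; have := normr_ge0 B; nra.
Qed.

(** In the chart [C] lies in an open square of half side M. Every geodesic ray leaving [C] crosses
    the lifted boundary of this square, which has finite length, and [Per_le] applies. *)
Lemma Per_finite C : compact C -> geodesically_convex C -> C !=set0 ->
  (Per C < +oo)%E.
Proof.
move=> kC cC C0; have [q Cq hq] := compact_max hpt2_continuous kC C0.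
pose M := (hpt q).2; have M0 : 0 < M by exact: hpt2_gt0.
have small (p : H) : C p -> `|(hpt p).1.1| < M /\ `|(hpt p).1.2| < M.
  move=> /hq; rewrite -/M; have := minkxx p; have := hpt2_gt0 p.
  case: (hpt p) => -[x y] t; rewrite /minkowski/= => t0 h tM.
  have t2 : t ^+ 2 <= M ^+ 2 by rewrite ler_sqr ?nnegrE// ltW.
  have := sqr_ge0 x; have := sqr_ge0 y => y2 x2.
  by split; rewrite -ltr_sqr ?nnegrE ?(ltW M0)// real_normK ?num_real//; lra.
pose g1 s := hgraph M (s - M); pose g2 s := hgraph (- M) (s - M).
pose g3 s := hgraph (s - M) M; pose g4 s := hgraph (s - M) (- M).
have l1 s t : mdist (g1 s) (g1 t) <= `|s - t| by apply: hgraph_lip; lra.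
have l2 s t : mdist (g2 s) (g2 t) <= `|s - t| by apply: hgraph_lip; lra.
have l3 s t : mdist (g3 s) (g3 t) <= `|s - t| by apply: hgraph_lip; lra.
have l4 s t : mdist (g4 s) (g4 t) <= `|s - t| by apply: hgraph_lip; lra.
pose I := `[0, M + M]%classic.
pose S := (g1 @` I `|` g2 @` I) `|` (g3 @` I `|` g4 @` I).
have MM0 : 0 <= M + M by lra.
apply: (@le_lt_trans _ _ (hausdorff1 S)); last first.
  have fin g : (forall s t : R, mdist (g s) (g t) <= `|s - t|) -> (hausdorff1 (g @` I : set H) < +oo)%E.
    move=> lg; apply: (@le_lt_trans _ _ (M + M)%:E); last exact: ltey.
    by apply: hausdorff1_curve => // s t _ _.
  apply: (le_lt_trans (hausdorff1U _ _)); apply: lte_add_pinfty;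
    by apply: (le_lt_trans (hausdorff1U _ _)); apply: lte_add_pinfty; apply: fin.
apply: Per_le => //.
  by repeat apply: compactU; apply: curve_compact.
move=> a u Ca tu _.
pose g s := Num.max `|(hpt (ray a u s)).1.1| `|(hpt (ray a u s)).1.2|.
have cray : continuous (ray a u).
  by apply: curve_continuous => s t; rewrite mdist_ray.
have cg : continuous g.
  move=> s; apply: (@continuous_max _ _ (fun s => `|(hpt (ray a u s)).1.1|) (fun s => `|(hpt (ray a u s)).1.2|)).
    apply: (@continuous_comp _ _ _ (ray a u) (fun p : H => `|(hpt p).1.1|)); first exact: cray.
    apply: (@continuous_comp _ _ _ (fun p : H => (hpt p).1.1 : R) Num.norm); first exact: hpt11_continuous.
    exact: norm_continuous.
  apply: (@continuous_comp _ _ _ (ray a u) (fun p : H => `|(hpt p).1.2|)); first exact: cray.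
  apply: (@continuous_comp _ _ _ (fun p : H => (hpt p).1.2 : R) Num.norm); first exact: hpt12_continuous.
  exact: norm_continuous.
(* While the ray stays in the square, [ch s], its product with [a], is at most this bound: the last
   coordinates are at most 1 + 2 M^2 and M, and each of the other two terms is at most M^2. *)
have [s s0 hs] := ch_unbounded ((1 + M ^+ 2 + M ^+ 2) * M + 2 * M ^+ 2).
have gs : M < g s.
  rewrite ltNge; apply/negP; rewrite ge_max => /andP[].
  move: hs; rewrite -[s in ch s]subr0 -(mink_ray s 0 tu) (ray0 tu).
  have [] := small a Ca; have := hq a Ca; rewrite -/M.
  have := hpt2_gt0 a; have := minkxx (ray a u s); have := hpt2_gt0 (ray a u s).
  case: (hpt a) => -[x y] t; case: (hpt (ray a u s)) => -[x' y'] t' /=.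
  rewrite /minkowski/= => t'0 n' t0 tM; rewrite ltr_norml => /andP[xl xr].
  rewrite ltr_norml => /andP[yl yr] hs; rewrite !ler_norml => /andP[xl' xr'] /andP[yl' yr'].
  have x'2 : x' ^+ 2 <= M ^+ 2 by nra.
  have y'2 : y' ^+ 2 <= M ^+ 2 by nra.
  have t'b : t' <= 1 + M ^+ 2 + M ^+ 2.
    rewrite leNgt; apply/negP => h; have : 1 <= t' by nra.
    by nra.
  have : t' * t <= (1 + M ^+ 2 + M ^+ 2) * M by apply: ler_pM => //; exact: ltW.
  have : - (x' * x) <= M ^+ 2 by nra.
  have : - (y' * y) <= M ^+ 2 by nra.
  by lra.
have g0 : g 0 < M by rewrite /g (ray0 tu) gt_max; apply/andP/small.
have [|c] := @IVT _ g 0 s M s0 (continuous_subspaceT cg).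
  by rewrite ge_min (ltW g0)/= le_max (ltW gs) orbT.
rewrite in_itv/= => /andP[c0 _] gc; exists c => //.
rewrite (hpt_graph (ray a u c)); move: gc; rewrite /g.
case: (hpt _) => -[x y] t /= gc.
have : `|x| <= M /\ `|y| <= M by split; rewrite -gc le_max lexx ?orbT.
rewrite !ler_norml => -[/andP[xl xr] /andP[yl yr]].
have : (`|x| == M) || (`|y| == M).
  by move: gc; rewrite /Num.max; case: ifP => _ ->; rewrite eqxx ?orbT.
rewrite !eqr_norml !(ltW M0) !andbT => /orP[/orP[]|/orP[]] /eqP E.
- by left; left; exists (y + M); rewrite /I /g1 /= ?in_itv/= ?addrK ?E//; lra.
- by left; right; exists (y + M); rewrite /I /g2 /= ?in_itv/= ?addrK ?E//; lra.
- by right; left; exists (x + M); rewrite /I /g3 /= ?in_itv/= ?addrK ?E//; lra.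
- by right; right; exists (x + M); rewrite /I /g4 /= ?in_itv/= ?addrK ?E//; lra.
Qed.

End nearest_point_projection.

(** * Lengths of segments, boundaries of unions and intersections *)

Section perimeter_deviation.
Context {R : realType}.
Local Notation vec := (R * R * R)%type.
Local Notation H := (hplane R).
Local Notation "<< x , y >>" := (minkowski x y).
Local Coercion hpt : hplane >-> prod.
Implicit Types (x y z a b : H) (u : vec) (C K P S : set H).

Lemma seg_curve x y : exists2 f : R -> H,
  (forall s t, mdist (f s) (f t) <= `|s - t|) & seg x y = f @` `[0, mdist x y].
Proof.
have [<-|xy] := eqVneq x y.
  exists (fun=> x); first by move=> s t; rewrite mdistxx.
  rewrite predeqE => z; split => [/seg_refl->|[_ _ <-]]; last exact: segxx.
  by exists 0 => //=; rewrite mdistxx in_itv/= lexx.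
exists (ray x (hdir x y)); first by move=> s t; rewrite mdist_ray//; exact: tangent_hdir.
rewrite predeqE => z; split => [/(seg_rayP _ xy)[s sd ->]|[s + <-]].
  by exists s.
by rewrite /= in_itv/= => sd; apply/(seg_rayP _ xy); exists s.
Qed.

Lemma seg_compact x y : compact (seg x y).
Proof. by have [f lf ->] := seg_curve x y; exact: curve_compact. Qed.

Lemma seg_closed x y : closed (seg x y).
Proof. by apply: compact_closedH; exact: seg_compact. Qed.

Lemma hausdorff1_seg x y : hausdorff1 (seg x y) = (mdist x y)%:E.
Proof.
apply/eqP; rewrite eq_le; apply/andP; split.
  have [f lf ->] := seg_curve x y; apply: hausdorff1_curve => [|s t _ _]; last exact: lf.
  exact: mdist_ge0.
rewrite -[mdist x y]subr0; apply: (@hausdorff1_ge_itv _ _ (mdist x)).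
- exact: mdist_ge0.
- move=> s; rewrite /= in_itv/= => /andP[s0 sd].
  have [xy|xy] := eqVneq x y.
    exists x; first by rewrite -xy; exact: segxx.
    by apply/esym/eqP; rewrite mdistxx eq_le s0 andbT; move: sd; rewrite xy mdistxx.
  exists (ray x (hdir x y) s); first by apply/(seg_rayP _ xy); exists s; rewrite ?s0.
  have tu := tangent_hdir xy; rewrite -{1}(ray0 tu) mdist_ray// sub0r normrN ger0_norm//.
- move=> a b _ _; rewrite ler_norml; apply/andP; split.
    by have := metric_triangle x a b; lra.
  by have := metric_triangle x b a; rewrite (metric_sym b a); lra.
Qed.

Lemma seg_ray x u (s1 s s2 : R) : tangent x u -> s1 <= s <= s2 ->
  seg (ray x u s1) (ray x u s2) (ray x u s).
Proof.
move=> tu /andP[h1 h2]; have [e|ne] := eqVneq s1 s2.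
  have -> : s = s1 by apply/eqP; rewrite eq_le h1 andbT e.
  exact: segl.
have d0 : 0 < sh (s2 - s1) by rewrite sh_gt0 subr_gt0 lt_neqAle ne (le_trans h1 h2).
exists (sh (s2 - s) / sh (s2 - s1)), (sh (s - s1) / sh (s2 - s1)); split.
- by rewrite divr_ge0 ?(ltW d0)// sh_ge0 subr_ge0.
- by rewrite divr_ge0 ?(ltW d0)// sh_ge0 subr_ge0.
rewrite !rayE//.
have c1 : ch s = (sh (s2 - s) * ch s1 + sh (s - s1) * ch s2) / sh (s2 - s1).
  by apply: (canRL (mulfK (lt0r_neq0 d0))); rewrite !shB; ring.
have c2 : sh s = (sh (s2 - s) * sh s1 + sh (s - s1) * sh s2) / sh (s2 - s1).
  by apply: (canRL (mulfK (lt0r_neq0 d0))); rewrite !shB; ring.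
by apply: vec_eq; rewrite /lin/= {1}c1 {1}c2; field; rewrite gt_eqF.
Qed.

Lemma line_ray x y z : x != y -> det3 x y z = 0 -> exists s, z = ray x (hdir x y) s.
Proof.
move=> xy D0; have tu := tangent_hdir xy; have [xu uu] := tu.
have : det3 x (hdir x y) z = 0 by rewrite /hdir !det3_lin det3xx D0; ring.
move: (hdir x y) tu xu uu => u tu xu uu Du.
have E := decomp2 (hpt x) u (hpt z); rewrite Du minkxx xu uu in E.
have zE : hpt z = lin <<z, x>> x (- <<z, u>>) u.
  have X1 := congr1 (fun u : vec => u.1.1) E; have X2 := congr1 (fun u : vec => u.1.2) E.
  have X3 := congr1 (fun u : vec => u.2) E; move: X1 X2 X3; rewrite /lin/= => X1 X2 X3.
  by apply: vec_eq => /=; lra.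
have n1 : <<z, x>> ^+ 2 - <<z, u>> ^+ 2 = 1.
  by have := minkxx z; rewrite {2}zE mink_linr; lra.
have A1 := minkowski_ge1 z x; move: zE n1 A1.
set a := <<z, x>>; set b := <<z, u>> => zE n1 a1.
have s2 : sh (arcosh a) ^+ 2 = b ^+ 2 by have := ch2 (arcosh a); rewrite arcoshK//; lra.
have s0 : 0 <= sh (arcosh a) by rewrite sh_ge0 arcosh_ge0.
have [b0|b0] := leP b 0.
  exists (arcosh a); apply: hpt_inj; rewrite rayE// arcoshK// zE; congr (lin _ _ _ _).
  by apply/esym/eqP; rewrite -(@eqrXn2 _ 2) ?sqrrN ?s2// oppr_ge0.
exists (- arcosh a); apply: hpt_inj; rewrite rayE// chN shN arcoshK// zE; congr (lin _ _ (- _) _).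
by apply/esym/eqP; rewrite -(@eqrXn2 _ 2) ?s2// ltW.
Qed.

Lemma collinear_seg C : compact C -> C !=set0 ->
  (forall x y z, C x -> C y -> C z -> det3 x y z = 0) ->
  exists x y, [/\ C x, C y & C `<=` seg x y].
Proof.
move=> kC [c Cc] col; have [[d [Cd cd]]|h] := pselect (exists d, C d /\ c != d); last first.
  exists c, c; split => // z Cz; have [<-|cz] := eqVneq c z; first exact: segxx.
  by exfalso; apply: h; exists z.
have tu := tangent_hdir cd.
have onray z : C z -> exists s, z = ray c (hdir c d) s.
  by move=> Cz; apply: line_ray => //; exact: col.
move: (hdir c d) tu onray => u tu onray; have [cu uu] := tu.
have sE s : <<u, ray c u s>> = - sh s by rewrite rayE// mink_linr (minkowskiC u c) cu uu; ring.
(* Along the line this functional is [- sh s], so its extrema over the compact set are attained at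
   the extreme parameters. *)
have [x Cx hx] := compact_max (mink_continuous (u := u)) kC (ex_intro _ c Cc).
have [y Cy hy] := compact_min (mink_continuous (u := u)) kC (ex_intro _ c Cc).
exists x, y; split => // z Cz; have := hx z Cz; have := hy z Cz.
have [s1 ->] := onray x Cx; have [s2 ->] := onray y Cy; have [s ->] := onray z Cz.
rewrite !sE !lerN2 !sh_ler => h1 h2; apply: seg_ray => //; exact/andP.
Qed.

Lemma boundary_closedE K : closed K -> boundary K = K `\` K°.
Proof. by move=> /closure_id cK; rewrite /boundary -cK. Qed.

Lemma closed_boundary K : closed (boundary K).
Proof.
rewrite /boundary setDE; apply: closedI; first exact: closed_closure.
by rewrite closedC; exact: open_interior.
Qed.

Lemma boundary_outside K P : closed K -> closed P ->
  boundary K `\` P `<=` boundary (K `|` P).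
Proof.
move=> cK cP x []; rewrite !boundary_closedE//; last exact: closedU.
move=> [Kx nKx] nPx; split; first by left.
move=> U; apply: nKx; rewrite /interior.
have Px : nbhs x (~` P) by apply: open_nbhs_nbhs; split => //; rewrite openC.
by apply: filterS (filterI U Px) => z [[]].
Qed.

(** Prolong the geodesic from [z] slightly beyond [x]. If the union were a neighbourhood of [x], the
    new point would lie in [K] or in [P], and [x], lying between it and the interior point [z],
    would be interior to that set. *)
Lemma boundary_crossing K P x z : geodesically_convex K -> geodesically_convex P ->
  K° z -> P° z -> ~ K° x -> ~ P° x -> ~ (K `|` P)° x.
Proof.
move=> cK cP Kz Pz nKx nPx U.
pose v (e : R) : vec := lin 1 x e (lin (-1) z 0 z).
have [] := @hnormal_cvg R _ (0^'+) _ v x.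
- by rewrite /v /lin/= mul1r; exact: cvg_lin0.
- by rewrite /v /lin/= mul1r; exact: cvg_lin0.
- by rewrite /v /lin/= mul1r; exact: cvg_lin0.
move=> h1 /(_ _ U) h2; near (0 : R)^'+ => e.
have [vv vz] : 0 < <<v e, v e>> /\ 0 < <<v e, x>> by near: e.
have e0 : 0 < e by near: e; exact: nbhs_right_gt.
have s0 : 0 < Num.sqrt <<v e, v e>> by rewrite sqrtr_gt0.
have xE : hpt x = lin e z (Num.sqrt <<v e, v e>>) (hnormal (v e)).
  rewrite (hnormalE vv vz); move: s0; set s := Num.sqrt _ => s0.
  by apply: vec_eq; rewrite /v /lin/=; field; rewrite gt_eqF.
have [Ky|Py] : (K `|` P) (hnormal (v e)) by near: e.
  by apply: nKx; apply: (interior_lin cK Kz Ky e0 (ltW s0) xE).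
by apply: nPx; apply: (interior_lin cP Pz Py e0 (ltW s0) xE).
Unshelve. all: by end_near. Qed.

(** The boundaries of the union and of the intersection have the same union and the same
    intersection as those of [K] and [P]; [hausdorff1_UI] on both sides does the rest. The common
    interior point feeds [boundary_crossing]. *)
Lemma Per_modular K P : closed K -> closed P -> geodesically_convex K ->
  geodesically_convex P -> (K `&` P)° !=set0 ->
  (Per (K `|` P) + Per (K `&` P) = Per K + Per P)%E.
Proof.
move=> cK cP vK vP [z]; rewrite interiorI => -[Kz Pz].
rewrite /Per -(hausdorff1_UI _ (@closed_boundary (K `|` P))).
rewrite -(hausdorff1_UI _ (@closed_boundary K)).
have bK := boundary_outside cK cP; have := boundary_outside cP cK; rewrite setUC => bP.
have cU := closedU cK cP; have cI := closedI cK cP.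
suff [-> ->] : boundary (K `|` P) `|` boundary (K `&` P) = boundary K `|` boundary P /\
  boundary (K `|` P) `&` boundary (K `&` P) = boundary K `&` boundary P by [].
split; apply/seteqP; split => x.
- rewrite !boundary_closedE//; move=> [[[Kx|Px] nU]|[[Kx Px]]].
  + left; split => // Kx'; apply: nU; exact: (interiorS (@subsetUl _ K P)).
  + right; split => // Px'; apply: nU; exact: (interiorS (@subsetUr _ K P)).
  + rewrite interiorI => nI; have [Kx'|] := pselect (K° x); last by left.
    by right; split => // Px'; apply: nI.
- have nI : boundary K x \/ boundary P x -> K x -> P x -> boundary (K `&` P) x.
    rewrite !boundary_closedE// interiorI => -[] [_ h] Kx Px; split => //;
    by move=> -[].
  move=> b; have [Kx|nKx] := pselect (K x); have [Px|nPx] := pselect (P x).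
  + by right; apply: nI.
  + left; apply: bK; split => //; case: b => //.
    by rewrite boundary_closedE// => -[].
  + left; apply: bP; split => //; case: b => //.
    by rewrite boundary_closedE// => -[].
  + by case: b; rewrite boundary_closedE// => -[].
- rewrite !boundary_closedE//; move=> [[_ nU] [[Kx Px] _]]; split; split => //.
    by move=> Kx'; apply: nU; exact: (interiorS (@subsetUl _ K P)).
  by move=> Px'; apply: nU; exact: (interiorS (@subsetUr _ K P)).
- rewrite !boundary_closedE// interiorI; move=> [[Kx nKx] [Px nPx]]; split.
    by split; [left|apply: (boundary_crossing vK vP Kz Pz)].
  by split => // -[].
Qed.

End perimeter_deviation.

(** * Convex hulls, extreme points and supporting lines *)

Section convex_hulls.
Context {R : realType}.
Local Notation vec := (R * R * R)%type.
Local Notation H := (hplane R).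
Local Notation "<< x , y >>" := (minkowski x y).
Local Coercion hpt : hplane >-> prod.
Implicit Types (x y z a b : H) (u : vec) (A C K P V W : set H).

Lemma convex_hull_convex V : geodesically_convex (convex_hull V).
Proof.
apply/geodesically_convexP => x y hx hy z xyz C [cC VC].
by move/geodesically_convexP : (cC); apply; [apply: hx|apply: hy|exact: xyz].
Qed.

Lemma sub_convex_hull V : V `<=` convex_hull V.
Proof. exact: sub_gen_smallest. Qed.

Lemma convex_hull_sub V C : geodesically_convex C -> V `<=` C -> convex_hull V `<=` C.
Proof. exact: smallest_sub. Qed.

Lemma halfspace_convex u : geodesically_convex [set x : H | 0 <= <<u, x>>].
Proof.
apply/geodesically_convexP => x y /= hx hy z [a [b [a0 b0 E]]] /=.
by rewrite E mink_linr addr_ge0// mulr_ge0.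
Qed.

Lemma convex_setI C K : geodesically_convex C -> geodesically_convex K ->
  geodesically_convex (C `&` K).
Proof. by move=> cC cK x y [Cx Kx] [Cy Ky] z xyz; split; [exact: cC xyz|exact: cK xyz]. Qed.

Lemma convex_hull_halfspace u V : (forall x, V x -> 0 <= <<u, x>>) ->
  forall x, convex_hull V x -> 0 <= <<u, x>>.
Proof. by move=> h; apply: convex_hull_sub; [exact: halfspace_convex|exact: h]. Qed.

Lemma seg_neq x y z (a b : R) : 0 <= a -> 0 <= b -> hpt z = lin a x b y ->
  z != x -> 0 < b.
Proof.
move=> a0 b0 E zx; rewrite lt_neqAle b0 andbT; apply: contra zx => /eqP b0'.
apply/eqP; apply: seg_refl; exists a, 0; split => //.
by rewrite E -b0'; apply: vec_eq; rewrite /lin/=; ring.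
Qed.

(** Applied to the hull [W] of the remaining generators, the join contains the whole hull, which
    gives each of its points a coefficient with respect to [v]. *)
Lemma join_convex v W : geodesically_convex W ->
  geodesically_convex [set z | z = v \/ exists2 w, W w & seg v w z].
Proof.
move=> /geodesically_convexP cW; apply/geodesically_convexP => z1 z2 h1 h2 z [c [d [c0 d0 E]]].
case: h1 h2 => [z1v|[w1 Ww1 [a1 [b1 [a10 b10 E1]]]]] [z2v|[w2 Ww2 [a2 [b2 [a20 b20 E2]]]]];
  rewrite ?z1v ?z2v in E.
- by left; apply: seg_refl; exists c, d.
- right; exists w2 => //; exists (c + d * a2), (d * b2).
  rewrite addr_ge0 ?mulr_ge0//; split => //.
  by rewrite E E2; apply: vec_eq; rewrite /lin/=; ring.
- right; exists w1 => //; exists (d + c * a1), (c * b1).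
  rewrite addr_ge0 ?mulr_ge0//; split => //.
  by rewrite E E1; apply: vec_eq; rewrite /lin/=; ring.
- have k1 : 0 <= c * b1 by exact: mulr_ge0.
  have k2 : 0 <= d * b2 by exact: mulr_ge0.
  have : 0 <= c * b1 + d * b2 by exact: addr_ge0.
  rewrite le_eqVlt => /orP[/eqP/esym k0|k0].
    have {k0}[e1 e2] : c * b1 = 0 /\ d * b2 = 0 by split; lra.
    left; apply: seg_refl; exists (c * a1 + d * a2), 0.
    rewrite addr_ge0 ?mulr_ge0//; split => //; rewrite E E1 E2.
    apply: vec_eq; rewrite /lin/= !mulrDr !mulrA e1 e2; ring.
  have [s s0 [w ws wE]] := normal_seg w1 w2 k1 k2 k0.
  right; exists w; first exact: cW ws.
  exists (c * a1 + d * a2), s^-1; rewrite addr_ge0 ?mulr_ge0// invr_ge0 (ltW s0); split => //.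
  by rewrite E E1 E2 wE; apply: vec_eq; rewrite /lin/=; field; rewrite gt_eqF.
Qed.

(** Removing an extreme point leaves a convex set, which would be a smaller hull if the point were
    not a generator. *)
Lemma vertices_hull V : vertices (convex_hull V) `<=` V.
Proof.
move=> v [hv ext]; apply: contrapT => nVv.
have c : geodesically_convex (convex_hull V `\ v).
  apply/geodesically_convexP => x y [hx /= xv] [hy /= yv] z xyz; split.
    by move/geodesically_convexP : (@convex_hull_convex V); apply; [exact: hx|exact: hy|].
  move=> /= zv; have [] := ext x y hx hy; first by rewrite geodesic_segmentE -zv.
    by move=> /esym.
  by move=> /esym.
have := convex_hull_sub c; move=> /(_ V) h.
have [] : (convex_hull V `\ v) v.
  apply: h => // x Vx; split; first exact: sub_convex_hull.
  by move=> /= xv; apply: nVv; rewrite -xv.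
by move=> _; exact.
Qed.

Lemma extreme_vertex V v : ~ convex_hull (V `\ v) v -> V v ->
  vertices (convex_hull V) v.
Proof.
move=> nv Vv; split; first exact: sub_convex_hull.
set W := convex_hull (V `\ v).
have hJ : convex_hull V `<=` [set z | z = v \/ exists2 w, W w & seg v w z].
  apply: convex_hull_sub; first by apply: join_convex; exact: convex_hull_convex.
  move=> x Vx; have [->|xv] := eqVneq x v; first by left.
  right; exists x; last exact: segr.
  by apply: sub_convex_hull; split => //; exact/eqP.
move=> x y /hJ hx /hJ hy; rewrite geodesic_segmentE => -[c [d [c0 d0 E]]].
have [->|xv] := eqVneq v x; first by left.
have [->|yv] := eqVneq v y; first by right.
case: hx => [xv'|[x' Wx' [a1 [b1 [a10 b10 E1]]]]]; first by rewrite xv' eqxx in xv.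
case: hy => [yv'|[y' Wy' [a2 [b2 [a20 b20 E2]]]]]; first by rewrite yv' eqxx in yv.
have d1 : 0 < d by apply: (seg_neq c0 d0 E).
have c1 : 0 < c.
  by apply: (@seg_neq y x v d c) => //; rewrite E; apply: vec_eq; rewrite /lin/=; ring.
have b11 : 0 < b1 by apply: (seg_neq a10 b10 E1); rewrite eq_sym.
have b21 : 0 < b2 by apply: (seg_neq a20 b20 E2); rewrite eq_sym.
(* Collecting the multiples of [v] leaves k v as a positive combination of x' and y'. Pairing with
   [v] shows k > 0, and so [v] would lie in [W]. *)
exfalso; apply: nv; pose k := 1 - c * a1 - d * a2.
have kE : lin k v 0 v = lin (c * b1) x' (d * b2) y'.
  have X1 := congr1 (fun u : vec => u.1.1) E; have X2 := congr1 (fun u : vec => u.1.2) E.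
  have X3 := congr1 (fun u : vec => u.2) E; move: X1 X2 X3; rewrite E1 E2 /lin/= => X1 X2 X3.
  by apply: vec_eq; rewrite /k /=; lra.
have k0 : 0 < k.
  have := congr1 (fun u : vec => <<u, v>>) kE; rewrite !mink_lin minkxx.
  rewrite mul0r addr0 mulr1 => ->; rewrite addr_gt0// !mulr_gt0//; exact: mink_gt0.
apply: (convex_lin (@convex_hull_convex _) Wx' Wy' (a := c * b1 / k) (b := d * b2 / k)).
- by rewrite divr_ge0 ?(ltW k0)// mulr_ge0.
- by rewrite divr_ge0 ?(ltW k0)// mulr_ge0.
have X1 := congr1 (fun u : vec => u.1.1) kE; have X2 := congr1 (fun u : vec => u.1.2) kE.
have X3 := congr1 (fun u : vec => u.2) kE; move: X1 X2 X3; rewrite /lin/= !mul0r !addr0.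
move=> X1 X2 X3.
by apply: vec_eq; rewrite /=; apply: (mulfI (lt0r_neq0 k0)); rewrite ?X1 ?X2 ?X3; field; rewrite gt_eqF.
Qed.

(** In a generating list of least length no entry lies in the hull of the others, and by
    [extreme_vertex] all entries are then extreme. *)
Lemma hull_vertices V : finite_set V -> exists s : seq H,
  [/\ uniq s, [set` s] = vertices (convex_hull V), convex_hull V = convex_hull [set` s] &
      forall v, v \in s -> ~ convex_hull ([set` s] `\ v) v].
Proof.
move=> /finite_seqP[s0 ->].
pose Q k := `[< exists s : seq H, size s = k /\ convex_hull [set` s0] = convex_hull [set` s] >].
have exQ : exists k, Q k by exists (size s0); apply/asboolP; exists s0.
have [k /asboolP[s [sk sE]] kmin] := ex_minnP exQ.
have us : uniq s.
  rewrite -[uniq s]negbK -ltn_size_undup -leqNgt sk; apply: kmin; apply/asboolP; exists (undup s).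
  split => //; rewrite sE; congr convex_hull; apply/seteqP; split => x /=;
  by rewrite mem_undup.
have ext v : v \in s -> ~ convex_hull ([set` s] `\ v) v.
  move=> vs hv; have : Q (size (rem v s)).
    apply/asboolP; exists (rem v s); split => //; rewrite sE.
    have -> : [set` rem v s] = [set` s] `\ v.
      apply/seteqP; split => x /=; rewrite (mem_rem_uniq _ us) inE.
        by move=> /andP[/eqP].
      by move=> [-> /eqP->].
    apply/seteqP; split; apply: convex_hull_sub; try exact: convex_hull_convex.
      move=> x /= xs; have [->//|xv] := eqVneq x v.
      by apply: sub_convex_hull; split => //; exact/eqP.
    by move=> x [xs _]; exact: sub_convex_hull.
  have s_gt0 : (0 < size s)%N by case: (s) vs.
  by move=> /kmin; rewrite size_rem// -sk -ltnS prednK// ltnn.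
exists s; split => //; rewrite sE; apply/seteqP; split; last exact: vertices_hull.
move=> v /= vs; apply: extreme_vertex => //; exact: ext.
Qed.

Lemma card_uniq_le (s : seq H) n : uniq s -> ([set` s] #<= `I_n)%card -> (size s <= n)%N.
Proof.
move=> us; rewrite -card_le_II; apply: card_le_trans.
case: s us => [|x0 s] us; first by rewrite II0 card_ge0.
set t := x0 :: s in us *; have : (nth x0 t @` `I_(size t) #= `I_(size t))%card.
  apply: inj_card_eq => i j; rewrite !inE /= => it jt /eqP.
  by rewrite nth_uniq// => /eqP.
rewrite card_eq_le => /andP[_ h]; apply: (card_le_trans h); apply: subset_card_le.
by move=> _ [i /= it <-]; exact: mem_nth.
Qed.

Lemma interior_crosses K z u : K° z -> u <> (0, 0, 0) -> <<u, z>> = 0 ->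
  exists2 p, K p & <<u, p>> < 0.
Proof.
(* With this w, [<<u, w>>] is minus the Euclidean square of [u], so moving from [z] along w makes
   the functional negative. *)
move=> Kz u0 uz; pose w : vec := (u.1.1, u.1.2, - u.2).
have uw : <<u, w>> < 0.
  rewrite /minkowski /w /=; have [e1|e1] := eqVneq u.1.1 0; last first.
    have : 0 < u.1.1 ^+ 2 by rewrite exprn_even_gt0.
    by have := sqr_ge0 u.1.2; have := sqr_ge0 u.2; lra.
  have [e2|e2] := eqVneq u.1.2 0; last first.
    have : 0 < u.1.2 ^+ 2 by rewrite exprn_even_gt0.
    by have := sqr_ge0 u.1.1; have := sqr_ge0 u.2; lra.
  have [e3|e3] := eqVneq u.2 0; first by exfalso; apply: u0; apply: vec_eq.
  have : 0 < u.2 ^+ 2 by rewrite exprn_even_gt0.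
  by have := sqr_ge0 u.1.1; have := sqr_ge0 u.1.2; lra.
pose v (e : R) : vec := lin 1 z e w.
have [] := @hnormal_cvg R _ (0^'+) _ v z.
- by rewrite /v /lin/= mul1r; exact: cvg_lin0.
- by rewrite /v /lin/= mul1r; exact: cvg_lin0.
- by rewrite /v /lin/= mul1r; exact: cvg_lin0.
move=> h1 /(_ _ Kz) h2; near (0 : R)^'+ => e.
have [vv vz] : 0 < <<v e, v e>> /\ 0 < <<v e, z>> by near: e.
have e0 : 0 < e by near: e; exact: nbhs_right_gt.
exists (hnormal (v e)); first by near: e.
have s0 : 0 < (Num.sqrt <<v e, v e>>)^-1 by rewrite invr_gt0 sqrtr_gt0.
rewrite (hnormalE vv vz) mink_linr mul0r addr0 pmulr_rlt0// /v mink_linr uz.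
by rewrite mulr0 add0r pmulr_rlt0.
Unshelve. all: by end_near. Qed.

Lemma mcross_neq0 x y : x != y -> mcross x y <> (0, 0, 0).
Proof.
move=> xy E; have m1 := mink_gt1 xy.
have : <<mcross x y, mcross x y>> = <<x, x>> * <<y, y>> - <<x, y>> ^+ 2.
  by rewrite /mcross /minkowski/=; ring.
rewrite !minkxx E {1}/minkowski/= => h; have : 1 < <<x, y>> ^+ 2 by rewrite expr_gt1//; lra.
by lra.
Qed.

Lemma support_not_interior K z u : (forall x, K x -> 0 <= <<u, x>>) ->
  u <> (0, 0, 0) -> <<u, z>> = 0 -> ~ K° z.
Proof.
move=> h u0 uz Kz; have [p Kp] := interior_crosses Kz u0 uz.
by rewrite ltNge h.
Qed.

Lemma det3_eq0_line x y a b (c : H) : x != y -> det3 x y a = 0 -> det3 x y b = 0 ->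
  det3 x y c = 0 -> det3 a b c = 0.
Proof.
move=> xy /(line_ray xy)[s1 ->] /(line_ray xy)[s2 ->] /(line_ray xy)[s3 ->].
by rewrite !rayE; [rewrite !det3_lin !det3_0; ring|exact: tangent_hdir..].
Qed.

Lemma det3_triangle x y z : mdist x y = mdist x z + mdist z y -> det3 x z y = 0.
Proof.
move=> E; apply/eqP; rewrite -sqrf_eq0 expr2 gram_det !minkxx.
rewrite !(minkowskiC z x) !(minkowskiC y x) !(minkowskiC y z).
have := ch_mdist x y; rewrite E chD !ch_mdist => <-.
have h1 := ch2 (mdist x z); have h2 := ch2 (mdist z y); move: h1 h2.
rewrite !ch_mdist; set a := <<x, z>>; set b := <<z, y>>; set s := sh _; set t := sh _.
move=> h1 h2; apply/eqP.
have -> : 1 * (1 * 1 - b * b) - a * (a * 1 - b * (a * b + s * t)) +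
  (a * b + s * t) * (a * b - 1 * (a * b + s * t)) =
  (a ^+ 2 - 1) * (b ^+ 2 - 1) - s ^+ 2 * t ^+ 2 by ring.
by rewrite h1 h2; ring.
Qed.

Lemma mdist_strict x y z : det3 x z y != 0 -> mdist x y < mdist x z + mdist z y.
Proof.
move=> D0; rewrite lt_neqAle metric_triangle andbT.
by apply: contra D0 => /eqP/det3_triangle/eqP.
Qed.

End convex_hulls.

(** * Cyclic order, convex polygons and their perimeters *)

Section cyclic_sequences.
Context {R : realType}.
Local Notation vec := (R * R * R)%type.
Local Notation H := (hplane R).
Local Notation "<< x , y >>" := (minkowski x y).
Local Coercion hpt : hplane >-> prod.
Implicit Types (x y z a b : H) (u : vec) (A C K P V W : set H) (m i j k : nat).

(** Vertex cycles are indexed by all natural numbers, so that successors and windows of m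
    consecutive indices avoid modular arithmetic. *)
Definition periodic m (v : nat -> H) := forall i, v (i + m)%N = v i.

(* Convex position, in counterclockwise order: strict and with coincidences allowed. *)
Definition scyclic m (v : nat -> H) := forall i j k, (i < j < k)%N -> (k < i + m)%N ->
  0 < det3 (v i) (v j) (v k).

Definition wcyclic m (v : nat -> H) := forall i j k, (i <= j <= k)%N -> (k <= i + m)%N ->
  0 <= det3 (v i) (v j) (v k).

Lemma periodicM m (v : nat -> H) i k : periodic m v -> v (i + k * m)%N = v i.
Proof.
move=> pv; elim: k => [|k IH]; first by rewrite mul0n addn0.
by rewrite mulSn (addnC m) addnA pv.
Qed.

Lemma periodic_window m (v : nat -> H) i k : (0 < m)%N -> periodic m v ->
  exists2 k', (i <= k' < i + m)%N & v k = v k'.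
Proof.
(* Here [m.-1 * i] stands for - i modulo m. *)
move=> m0 pv; exists (i + (k + m.-1 * i) %% m)%N.
  by rewrite leq_addr ltn_add2l ltn_pmod.
rewrite -(periodicM k i pv) -(periodicM (i + _) ((k + m.-1 * i) %/ m) pv).
congr v; rewrite -addnA (addnC (_ %% _)%N) -divn_eq.
by case: m m0 {pv} => // m _; rewrite mulnS mulnC; lia.
Qed.

Lemma range_periodic m (v : nat -> H) : (0 < m)%N -> periodic m v -> range v = v @` `I_m.
Proof.
move=> m0 pv; apply/seteqP; split => _ [i _ <-]; last by exists i.
by have [j jm ->] := periodic_window 0 i m0 pv; exists j.
Qed.

Lemma scyclicW m (v : nat -> H) : periodic m v -> scyclic m v -> wcyclic m v.
Proof.
move=> pv sv i j k; rewrite leq_eqVlt => /andP[/orP[/eqP->|ij]].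
  by move=> _ _; rewrite det3_0.
rewrite leq_eqVlt => /orP[/eqP->|jk]; first by move=> _; rewrite det3_0.
rewrite leq_eqVlt => /orP[/eqP->|ki]; first by rewrite pv det3_0.
by apply: ltW; apply: sv => //; rewrite ij.
Qed.

(** Subtracting a multiple of m and rotating the three arguments of [det3] brings any admissible
    triple into a single period. *)
Lemma scyclic_mod m (b : nat -> H) :
  (forall i j k, (i < j < k)%N -> (k < m)%N -> 0 < det3 (b i) (b j) (b k)) ->
  scyclic m (fun i => b (i %% m)%N).
Proof.
move=> hb i0 j0 k0 /andP[ij jk] ki.
have m0 : (0 < m)%N by lia.
have [q [i [j [k [-> -> -> im [ij' jk' ki']]]]]] : exists q i j k,
    [/\ i0 = (q * m + i)%N, j0 = (q * m + j)%N, k0 = (q * m + k)%N, (i < m)%N &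
     [/\ (i < j)%N, (j < k)%N & (k < i + m)%N]].
  have := divn_eq i0 m; have := ltn_pmod i0 m0; set r := (i0 %% m)%N.
  set q := (i0 %/ m)%N => rm E; exists q, r, (j0 - q * m)%N, (k0 - q * m)%N.
  by split; [|lia|lia| |split]; lia.
rewrite !modnMDl (modn_small im).
have [km|mk] := ltnP k m.
  rewrite (modn_small km) (modn_small (ltn_trans jk' km)); apply: hb => //.
  by rewrite ij'.
have -> : (k %% m)%N = (k - m)%N by rewrite -{1}(subnK mk) modnDr modn_small//; lia.
have [jm|mj] := ltnP j m.
  by rewrite (modn_small jm) -det3C; apply: hb => //; lia.
have -> : (j %% m)%N = (j - m)%N by rewrite -{1}(subnK mj) modnDr modn_small//; lia.
by rewrite det3C; apply: hb => //; lia.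
Qed.

Lemma det3N' (x y z : vec) : det3 x y z = - det3 x z y.
Proof. by rewrite /det3; ring. Qed.

Lemma det3_cramer a b c (v : H) : det3 a b c != 0 -> hpt v =
  lin 1 (lin (det3 v b c / det3 a b c) a (det3 a v c / det3 a b c) b) (det3 a b v / det3 a b c) c.
Proof.
move=> D0; have E := cramer (hpt a) b c v.
have X1 := congr1 (fun u : vec => u.1.1) E; have X2 := congr1 (fun u : vec => u.1.2) E.
have X3 := congr1 (fun u : vec => u.2) E; move: X1 X2 X3; rewrite /lin/= !mul0r !addr0.
move=> X1 X2 X3.
by apply: vec_eq; rewrite /=; apply: (mulfI D0); rewrite ?X1 ?X2 ?X3; field.
Qed.

Section sorting.
Variables (V : set H).
Implicit Types v : H.
Hypothesis freeV : forall v, V v -> ~ convex_hull (V `\ v) v.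

Let free_lin3 v a b c (p q r : R) : V v -> (V `\ v) a -> (V `\ v) b -> (V `\ v) c ->
  0 <= p -> 0 <= q -> 0 <= r -> hpt v = lin 1 (lin p a q b) r c -> False.
Proof.
move=> Vv Va Vb Vc p0 q0 r0 E; apply: (freeV Vv).
by apply: (convex_lin3 (@convex_hull_convex _ _) _ _ _ p0 q0 r0 E); exact: sub_convex_hull.
Qed.

Let free_seg v a b : V v -> (V `\ v) a -> (V `\ v) b -> ~ seg a b v.
Proof.
move=> Vv Va Vb h; apply: (freeV Vv).
have /geodesically_convexP := @convex_hull_convex _ (V `\ v).
by apply; [exact: sub_convex_hull Va|exact: sub_convex_hull Vb|].
Qed.

Let free_det a b c : V a -> V b -> V c -> a != b -> a != c -> b != c ->
  det3 a b c != 0.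
Proof.
move=> Va Vb Vc ab ac bc; apply/eqP => D0.
have [s cE] := line_ray ab D0; have tu := tangent_hdir ab.
have S s1 s2 s3 := @seg_ray R a (hdir a b) s1 s2 s3 tu.
have d0 := mdist_ge0 a b.
have [s0|s0] := leP s 0.
  apply: (@free_seg a c b) => //; [by split=> //; exact/nesym/eqP|by split => //; exact/nesym/eqP|].
  by have := S s 0 (mdist a b); rewrite -cE ray0// ray_hdir//; apply; rewrite s0.
have [sd|sd] := leP s (mdist a b).
  apply: (@free_seg c a b) => //; [by split=> //; exact/eqP|by split => //; exact/eqP|].
  by have := S 0 s (mdist a b); rewrite -cE ray0// ray_hdir//; apply; rewrite (ltW s0).
apply: (@free_seg b a c) => //; [by split=> //; exact/eqP|by split => //; exact/nesym/eqP|].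
by have := S 0 (mdist a b) s; rewrite -cE ray0// ray_hdir//; apply; rewrite d0 ltW.
Qed.

(** If transitivity failed, a, b, c would wind around [v], and [v] would lie in their triangle. This
    is what makes the angular sort legitimate. *)
Let free_trans v a b c : V v -> (V `\ v) a -> (V `\ v) b -> (V `\ v) c ->
  0 < det3 v a b -> 0 < det3 v b c -> 0 < det3 v a c.
Proof.
move=> Vv Va Vb Vc h1 h2; rewrite ltNge le_eqVlt; apply/negP => h.
have ac : a != c by apply: contraTneq h1 => ->; rewrite det3N' -leNgt oppr_le0 ltW.
have h3 : det3 v a c < 0.
  case/orP: h => // /eqP h; exfalso; move: h; apply/eqP.
  case: Va Vc => Va /nesym/eqP va [Vc /nesym/eqP vc].
  exact: free_det.
have E := cramer (hpt a) b c v.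
have D0 : 0 < det3 a b c.
  have := congr1 (fun u : vec => <<u, v>>) E.
  rewrite !mink_lin minkxx mul0r addr0 mulr1 mul1r => ->.
  rewrite (det3N a v c) -(det3C v a b) mulNr.
  have := mulr_gt0 h2 (mink_gt0 a v); have := mulr_gt0 h1 (mink_gt0 c v).
  have : det3 v a c * <<b, v>> < 0 by rewrite nmulr_rlt0// mink_gt0.
  lra.
apply: (free_lin3 Vv Va Vb Vc _ _ _ (det3_cramer v (lt0r_neq0 D0))).
- by rewrite divr_ge0// ltW.
- by rewrite divr_ge0 ?(ltW D0)// det3N oppr_ge0 ltW.
- by rewrite divr_ge0 ?(ltW D0)// -det3C ltW.
Qed.

(** Otherwise b would lie in the triangle v a c. *)
Let free_triple v a b c : V b -> (V `\ b) v -> (V `\ b) a -> (V `\ b) c ->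
  0 < det3 v a b -> 0 < det3 v b c -> 0 < det3 v a c -> 0 < det3 a b c.
Proof.
move=> Vb Vv Va Vc h1 h2 h3; rewrite ltNge; apply/negP => h4.
apply: (free_lin3 Vb Vv Va Vc _ _ _ (det3_cramer b (lt0r_neq0 h3))).
- by rewrite divr_ge0 ?(ltW h3)// det3N oppr_ge0.
- by rewrite divr_ge0// ltW.
- by rewrite divr_ge0// ltW.
Qed.

(* Angular sort around the first point. *)
Lemma sort_scyclic (s : seq H) : uniq s -> [set` s] = V -> (0 < size s)%N ->
  exists v : nat -> H, [/\ periodic (size s) v, scyclic (size s) v & range v = V].
Proof.
case: s => // v0 s /= /andP[v0s us] sV _.
have Vv0 : V v0 by rewrite -sV /= inE eqxx.
have Vs x : x \in s -> (V `\ v0) x.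
  move=> xs; split; first by rewrite -sV /= inE xs orbT.
  by move=> /= xv; rewrite -xv xs in v0s.
pose r x y := 0 <= det3 (hpt v0) (hpt x) (hpt y).
have rstrict x y : x \in s -> y \in s -> x != y -> r x y -> 0 < det3 v0 x y.
  move=> xs ys xy; rewrite /r le_eqVlt => /orP[/eqP h|//]; exfalso.
  have [Vx /nesym/eqP vx] := Vs x xs; have [Vy /nesym/eqP vy] := Vs y ys.
  by have := free_det Vv0 Vx Vy vx vy xy; rewrite -h eqxx.
have rtot : {in mem s &, total r}.
  by move=> x y _ _; rewrite /r (det3N' v0 y x) oppr_ge0; exact: le_total.
have rtrans : {in mem s & &, transitive r}.
  move=> y x z ys xs zs xy yz.
  have [exy|nxy] := eqVneq x y; first by rewrite exy.
  have [eyz|nyz] := eqVneq y z; first by rewrite -eyz.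
  rewrite /r ltW//; apply: (free_trans Vv0 (Vs x xs) (Vs y ys) (Vs z zs)).
    exact: rstrict.
  exact: rstrict.
pose t := sort r s.
have us' : uniq t by rewrite sort_uniq.
have ts x : (x \in t) = (x \in s) by rewrite mem_sort.
have st : size t = size s by rewrite size_sort.
have pt : pairwise r t.
  rewrite -(sorted_pairwise_in rtrans); last by apply/allP => x; rewrite ts.
  by apply: (sort_sorted_in rtot); apply/allP.
pose b i := nth v0 (v0 :: t) i.
have bt i : (i < size s)%N -> b i.+1 \in s by move=> h; rewrite -ts /b /= mem_nth// st.
have hb0 j k : (j < k)%N -> (k < size s)%N -> 0 < det3 v0 (b j.+1) (b k.+1).
  move=> jk ks; have js := ltn_trans jk ks.
  apply: rstrict; [exact: bt|exact: bt| |].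
    by rewrite /b /= nth_uniq// ?st// ltn_eqF.
  by rewrite /b/=; apply/(pairwiseP v0 pt) => //; rewrite inE st.
exists (fun i => b (i %% (size s).+1)%N); split.
- by move=> i; rewrite modnDr.
- apply: scyclic_mod => i j k /andP[ij jk] ks.
  case: i j k => [|i] [|j] [|k]// in ij jk ks *; first exact: hb0.
  have jl : (j < size s)%N by lia.
  have il : (i < size s)%N by lia.
  have [Vj vj] := Vs _ (bt j jl); have [Vi vi] := Vs _ (bt i il); have [Vk vk] := Vs _ (bt k ks).
  apply: (@free_triple v0); rewrite ?hb0//; try lia; split => //=.
  + by move=> /esym.
  + by move=> /eqP; rewrite /b/= nth_uniq ?st// => /eqP; lia.
  + by move=> /eqP; rewrite /b/= nth_uniq ?st// => /eqP; lia.
- rewrite -sV; apply/seteqP; split.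
    move=> _ [i _ <-] /=; have := ltn_pmod i (ltn0Sn (size s)).
    case: (i %% _)%N => [|j] jl; first by rewrite inE eqxx.
    by rewrite inE bt ?orbT.
  move=> x /=; rewrite inE => /orP[/eqP->|xs].
    by exists 0%N => //; rewrite mod0n.
  exists (index x t).+1 => //.
  by rewrite modn_small ?ltnS -?st ?index_mem ?ts// /b/= nth_index// ts.
Qed.

End sorting.

Section strict.
Variables (m : nat) (v : nat -> H).
Hypotheses (m3 : (3 <= m)%N) (pv : periodic m v) (sv : scyclic m v).
Let P := convex_hull (range v).

Lemma scyclic_side i k : 0 <= det3 (v i) (v i.+1) (v k).
Proof.
have [k' /andP[ik ki] ->] := periodic_window i k (leq_trans (ltn0Sn _) m3) pv.
have [<-|ne] := eqVneq i k'; first by rewrite det3_0.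
by apply: (scyclicW pv sv); lia.
Qed.

Lemma scyclic_neq i : v i != v i.+1.
Proof.
have := @sv i i.+1 i.+2; apply: contraPneq => -> h.
have : 0 < det3 (v i.+1) (v i.+1) (v i.+2) by apply: h; lia.
by rewrite det3_0 ltxx.
Qed.

Lemma scyclic_hull z : P z <-> forall i, 0 <= det3 (v i) (v i.+1) z.
Proof.
split.
  move=> Pz i; rewrite -mink_cross; apply: convex_hull_halfspace Pz => _ [k _ <-].
  by rewrite mink_cross; exact: scyclic_side.
move=> h.
(* A discrete intermediate value argument: from index 1 to m.-1 the sign of [det3 (v 0) (v i) z]
   turns from nonnegative to nonpositive. Where it turns, the fan triangle with apex [v 0] contains
   z. *)
have fan k : (2 <= k < m)%N -> det3 (v 0%N) (v k) z <= 0 ->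
    exists2 i, (0 < i < k)%N & 0 <= det3 (v 0%N) (v i) z /\ det3 (v 0%N) (v i.+1) z <= 0.
  elim: k => // k IH km dk; have [k2|k2] := ltnP k 2.
    have k1 : k = 1%N by lia.
    by exists 1%N; [lia|split; [exact: (h 0%N)|rewrite -k1]].
  have [dk0|dk0] := leP 0 (det3 (v 0%N) (v k) z); first by exists k; [lia|].
  have [||i ik di] := IH; [by lia|exact: ltW|].
  by exists i; [lia|].
have [||i im [d1 d2]] := fan m.-1; first by lia.
  have := h m.-1; rewrite prednK; last by lia.
  have vm : v m = v 0%N by exact: (pv 0%N).
  by rewrite vm det3N oppr_ge0.
have D0 : 0 < det3 (v 0%N) (v i) (v i.+1) by apply: sv; lia.
apply: (convex_lin3 (@convex_hull_convex _ _) _ _ _ _ _ _ (det3_cramer z (lt0r_neq0 D0)));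
  try by apply: sub_convex_hull; eexists.
- by rewrite divr_ge0 ?(ltW D0)// det3C; exact: h.
- by rewrite divr_ge0 ?(ltW D0)// det3N'; lra.
- by rewrite divr_ge0 ?(ltW D0).
Qed.

Lemma scyclic_on_side i z : P z -> det3 (v i) (v i.+1) z = 0 -> seg (v i) (v i.+1) z.
Proof.
move=> /scyclic_hull h D0; have m1 := mink_gt1 (scyclic_neq i).
have E := decomp2 (hpt (v i)) (v i.+1) z; rewrite D0 !minkxx in E.
pose n := 1 - <<v i, v i.+1>> ^+ 2.
have n0 : n != 0 by rewrite subr_eq0 eq_sym gt_eqF// expr_gt1//; lra.
have [a [b zE]] : exists a b : R, hpt z = lin a (v i) b (v i.+1).
  exists ((<<z, v i>> - <<v i, v i.+1>> * <<z, v i.+1>>) / n),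
    ((<<z, v i.+1>> - <<v i, v i.+1>> * <<z, v i>>) / n).
  have X1 := congr1 (fun u : vec => u.1.1) E; have X2 := congr1 (fun u : vec => u.1.2) E.
  have X3 := congr1 (fun u : vec => u.2) E; move: X1 X2 X3; rewrite /lin/=.
  rewrite !(mul0r, addr0, mulr1, mul1r) -/n => X1 X2 X3.
  by apply: vec_eq; rewrite /=; apply: (mulfI n0); rewrite ?X1 ?X2 ?X3; field.
(* Each coefficient is tested against the neighbouring side whose line contains the other end. *)
have Da : 0 < det3 (v i) (v i.+1) (v i.+2) by apply: sv; lia.
have Db : 0 < det3 (v (i + m.-1)%N) (v i) (v i.+1).
  have := @sv (i + m.-1)%N (i + m)%N (i.+1 + m)%N; rewrite !pv; apply; lia.
exists a, b; split => //.
  have := h i.+1; rewrite zE det3_lin3 det3_0 mulr0 addr0 -(det3C (v i)).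
  by rewrite pmulr_lge0.
have := h (i + m.-1)%N; rewrite -addnS prednK; last by lia.
by rewrite pv zE det3_lin3 det3_0 mulr0 add0r pmulr_lge0.
Qed.

Lemma scyclic_open z : (forall i, 0 < det3 (v i) (v i.+1) z) -> P° z.
Proof.
move=> h; rewrite /interior.
have : \forall x \near z, forall i : 'I_m, 0 < det3 (v i) (v i.+1) (hpt x).
  apply: (@filter_forall H _ (fun (i : 'I_m) (x : H) => 0 < det3 (v i) (v i.+1) x)
    (nbhs z) (nbhs_filter z)) => i.
  apply: open_nbhs_nbhs; split; last exact: h.
  rewrite (_ : (fun x : H => _) = [set x : H | 0 < <<mcross (v i) (v i.+1), x>>]).
    exact: open_halfspace.
  by apply/seteqP; split => x /=; rewrite mink_cross.
apply: filterS => x hx; apply/scyclic_hull => i; apply: ltW.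
have m0 : (0 < m)%N by lia.
have := hx (Ordinal (ltn_pmod i m0)); rewrite /= {3 4}(divn_eq i m) addnC.
by rewrite -addSn !periodicM.
Qed.

Lemma scyclic_boundary z : P z -> ~ P° z -> exists2 i, (i < m)%N & seg (v i) (v i.+1) z.
Proof.
move=> Pz nPz; apply: contrapT => hn; apply: nPz; apply: scyclic_open => i.
have m0 : (0 < m)%N by lia.
rewrite (divn_eq i m) addnC -addSn !periodicM//.
rewrite lt_neqAle ((scyclic_hull z).1 Pz) andbT; apply/eqP => D0; apply: hn.
exists (i %% m)%N; first exact: ltn_pmod.
by apply: scyclic_on_side.
Qed.

Lemma scyclic_closed : closed P.
Proof.
rewrite (_ : P = \bigcap_i [set x : H | 0 <= <<mcross (v i) (v i.+1), x>>]).
  by apply: closed_bigI => i _; exact: closed_halfspace.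
apply/seteqP; split => x.
  by move=> /scyclic_hull h i _ /=; rewrite mink_cross.
by move=> h; apply/scyclic_hull => i; have := h i I; rewrite /= mink_cross.
Qed.

End strict.

Section weak.
Variables (m : nat) (w : nat -> H).
Hypotheses (m0 : (0 < m)%N) (pw : periodic m w) (cw : wcyclic m w).
Let Q := convex_hull (range w).

Lemma wcyclic_side i k : 0 <= det3 (w i) (w i.+1) (w k).
Proof.
have [k' /andP[ik ki] ->] := periodic_window i k m0 pw.
have [<-|ne] := eqVneq i k'; first by rewrite det3_0.
by apply: cw; lia.
Qed.

Lemma wcyclic_seg_boundary i : w i != w i.+1 -> seg (w i) (w i.+1) `<=` boundary Q.
Proof.
move=> wi z wz; have Qz : Q z.
  have /geodesically_convexP := @convex_hull_convex R (range w).
  by apply; [apply: sub_convex_hull; exists i|apply: sub_convex_hull; exists i.+1|exact: wz].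
split; first exact: subset_closure.
apply: (@support_not_interior R Q z (mcross (w i) (w i.+1))).
- apply: convex_hull_halfspace => _ [k _ <-]; rewrite mink_cross; exact: wcyclic_side.
- exact: mcross_neq0.
- by case: wz => a [b [_ _ E]]; rewrite mink_cross E det3_lin !det3_0; ring.
Qed.

(* Two points common to two different sides are aligned with every [w k]. *)
Let overlap_aux i j k p q : (i < j)%N -> (j.+1 <= k <= i + m)%N ->
  seg (w i) (w i.+1) p -> seg (w j) (w j.+1) p ->
  seg (w i) (w i.+1) q -> seg (w j) (w j.+1) q -> det3 p q (w k) = 0.
Proof.
move=> ij /andP[jk ki] ip jp iq jq.
suff h p' q' : seg (w i) (w i.+1) p' -> seg (w j) (w j.+1) q' -> 0 <= det3 p' q' (w k).
  by apply/le_anti; rewrite (h p q)// andbT det3N oppr_le0 (h q p).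
move=> [a [b [a0 b0 E]]] [c [d [c0 d0 E']]].
rewrite E E' !det3_lin; apply: addr_ge0; apply: mulr_ge0 => //; apply: addr_ge0;
  apply: mulr_ge0 => //; apply: cw; lia.
Qed.

Let overlap i j k p q : (i < j < i + m)%N ->
  seg (w i) (w i.+1) p -> seg (w j) (w j.+1) p ->
  seg (w i) (w i.+1) q -> seg (w j) (w j.+1) q -> det3 p q (w k) = 0.
Proof.
move=> /andP[ij ji] ip jp iq jq.
have [k' /andP[ik ki] ->] := periodic_window i.+1 k m0 pw.
have [jk|kj] := ltnP j k'; first by apply: (overlap_aux ij) => //; lia.
rewrite -(pw k'); apply: (@overlap_aux j (i + m)%N) => //; try lia.
  by rewrite -addSn !pw.
by rewrite -addSn !pw.
Qed.

Hypothesis noncol : exists i j k, det3 (w i) (w j) (w k) != 0.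

Lemma wcyclic_seg_meet i j p q : (i < j < i + m)%N ->
  seg (w i) (w i.+1) p -> seg (w j) (w j.+1) p ->
  seg (w i) (w i.+1) q -> seg (w j) (w j.+1) q -> p = q.
Proof.
move=> ij ip jp iq jq; have [//|pq] := eqVneq p q.
have [a [b [c]]] := noncol.
by rewrite (det3_eq0_line pq) ?eqxx//; apply: (overlap (i := i) (j := j)).
Qed.

(** The sides lie on the boundary, and two of them share at most one point by [wcyclic_seg_meet],
    hence a null set; so their lengths add up. *)
Lemma Per_ge_wcyclic : ((\sum_(i < m) mdist (w i) (w i.+1))%:E <= Per Q)%E.
Proof.
(* A degenerate side contributes no length and has no line to support the hull, so it is
   discarded. *)
pose S i := if w i == w i.+1 then set0 else seg (w i) (w i.+1).
have Sseg i : S i `<=` seg (w i) (w i.+1) by rewrite /S; case: ifP => _ x.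
have HS i : hausdorff1 (S i) = (mdist (w i) (w i.+1))%:E.
  rewrite /S; case: eqP => [->|_]; last exact: hausdorff1_seg.
  by rewrite mdistxx hausdorff1_set0.
pose A k := \bigcup_(i in `I_k) S i.
have AS k : A k.+1 = S k `|` A k.
  by rewrite /A IIS bigcup_setU bigcup_set1 setUC.
have HA k : (k <= m)%N -> ((\sum_(i < k) mdist (w i) (w i.+1))%:E <= hausdorff1 (A k))%E.
  elim: k => [|k IH] km; first by rewrite big_ord0 hausdorff1_ge0.
  rewrite big_ord_recr/= EFinD AS.
  have null : hausdorff1 (S k `&` A k) = 0%E.
    apply/eqP; rewrite eq_le hausdorff1_ge0 andbT.
    have null1 i : (i < k)%N -> (hausdorff1 (S k `&` S i) <= 0)%E.
      move=> ik; have [[p [kp ip]]|none] := pselect ((S k `&` S i) !=set0); last first.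
        rewrite (_ : _ `&` _ = set0) ?hausdorff1_set0//.
        by rewrite -subset0 => x hx; apply: none; exists x.
      rewrite -(hausdorff1_set1 p); apply: le_hausdorff1 => q [kq iq] /=.
      by apply/esym; apply: (@wcyclic_seg_meet i k); try exact: Sseg; lia.
    suff nullA l : (l <= k)%N -> (hausdorff1 (S k `&` A l) <= 0)%E by exact: nullA.
    elim: l => [|l IHl] lk; first by rewrite /A II0 bigcup_set0 setI0 hausdorff1_set0.
    rewrite AS setIUr; apply: (le_trans (hausdorff1U _ _)).
    by rewrite -[leRHS](adde0 0%E) leeD ?null1// IHl// ltnW.
  have := hausdorff1_UI (A k) (_ : closed (S k)).
  rewrite null adde0 => ->; last by rewrite /S; case: ifP => _; [exact: closed0|exact: seg_closed].
  by rewrite HS addeC leeD2l// IH// ltnW.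
apply: (le_trans (HA m (leqnn m))); apply: le_hausdorff1 => x [i _].
by rewrite /S; case: eqP => // /eqP wi; exact: wcyclic_seg_boundary.
Qed.

Lemma wcyclic_polygon n : (m <= n)%N -> polygons n Q.
Proof.
move=> mn; split; last first.
  apply: (@card_le_trans _ _ _ `I_m); last by rewrite card_le_II.
  apply: (card_le_trans (subset_card_le (@vertices_hull R _))).
  by rewrite (range_periodic m0 pw) card_image_le.
split; last first.
  by exists (range w) => //; rewrite (range_periodic m0 pw); exact: finite_image.
have [i [j [k]]] := noncol.
have Qw l : Q (w l) by apply: sub_convex_hull; exists l.
rewrite neq_lt => /orP[D|D]; last exact: (triangle_interior (@convex_hull_convex R _) (Qw i) (Qw j) (Qw k)).
apply: (triangle_interior (@convex_hull_convex R _) (Qw j) (Qw i) (Qw k)).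
by rewrite det3N oppr_gt0.
Qed.

End weak.

Lemma Per_le_scyclic m (v : nat -> H) : (3 <= m)%N -> periodic m v -> scyclic m v ->
  (Per (convex_hull (range v)) <= (\sum_(i < m) mdist (v i) (v i.+1))%:E)%E.
Proof.
move=> m3 pv sv.
have bS : boundary (convex_hull (range v)) `<=` \bigcup_(i in `I_m) seg (v i) (v i.+1).
  move=> x; rewrite boundary_closedE; last exact: scyclic_closed pv sv.
  by move=> [Px nPx]; have [i im h] := scyclic_boundary m3 pv sv Px nPx; exists i.
apply: (le_trans (le_hausdorff1 bS)); elim: (m) => [|k IH].
  by rewrite II0 bigcup_set0 hausdorff1_set0 big_ord0.
rewrite IIS bigcup_setU bigcup_set1 big_ord_recr/= EFinD.
by apply: (le_trans (hausdorff1U _ _)); rewrite hausdorff1_seg leeD.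
Qed.

Lemma scyclic_noncol m (v : nat -> H) : (3 <= m)%N -> scyclic m v ->
  exists i j k, det3 (v i) (v j) (v k) != 0.
Proof. by move=> m3 sv; exists 0%N, 1%N, 2%N; rewrite gt_eqF//; apply: sv; lia. Qed.

Lemma Per_scyclic m (v : nat -> H) : (3 <= m)%N -> periodic m v -> scyclic m v ->
  Per (convex_hull (range v)) = (\sum_(i < m) mdist (v i) (v i.+1))%:E.
Proof.
move=> m3 pv sv; apply/eqP; rewrite eq_le Per_le_scyclic//= Per_ge_wcyclic//.
- by lia.
- exact: scyclicW.
- exact: scyclic_noncol sv.
Qed.

Lemma polygon_scyclic n P : polygons n P -> exists m (v : nat -> H),
  [/\ (3 <= m <= n)%N, periodic m v, scyclic m v, P = convex_hull (range v) &
      vertices P = range v].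
Proof.
move=> [[[z Pz] [V0 fV0 PE]] cP].
have [s [us sE hE free]] := hull_vertices fV0.
rewrite PE -sE in cP; have sn := card_uniq_le us cP.
have Pz' : (convex_hull [set` s])° z by rewrite -hE -PE.
have s3 : (3 <= size s)%N.
  rewrite ltnNge; apply/negP => s2.
  (* At most two points lie in a plane through the origin. Its normal vanishes on the whole hull,
     which then has no interior point. *)
  suff [u [u0 hu]] : exists u : vec, u <> (0, 0, 0) /\ forall x, x \in s -> <<u, x>> = 0.
    have hull0 : convex_hull [set` s] z by exact: interior_subset Pz'.
    apply: (@support_not_interior R (convex_hull [set` s]) z u _ u0 _ Pz').
      by apply: convex_hull_halfspace => x /= xs; rewrite hu.
    apply/le_anti/andP; split; last first.
      by apply: convex_hull_halfspace hull0 => x /= xs; rewrite hu.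
    have : 0 <= <<lin (-1) u 0 u, z>>.
      apply: convex_hull_halfspace hull0 => x /= xs.
      by rewrite mink_lin hu// mulr0 mul0r addr0.
    by rewrite mink_lin mul0r addr0 mulN1r oppr_ge0.
  case: s us s2 {sE hE free cP sn Pz'} => [|x [|y [|//]]] us _.
  - by exists (1, 0, 0); split => // -[] /eqP; rewrite oner_eq0.
  - exists ((hpt x).2, 0, (hpt x).1.1); split.
      by move=> [] /eqP; rewrite gt_eqF// hpt2_gt0.
    by move=> t; rewrite inE => /eqP->; rewrite /minkowski/=; ring.
  - exists (mcross x y); split; first by apply: mcross_neq0; move: us; rewrite /= inE andbT.
    by move=> t; rewrite !inE => /orP[] /eqP->; rewrite mink_cross det3_0.
have [v [pv sv rv]] := sort_scyclic free us erefl (leq_trans (ltn0Sn _) s3).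
by exists (size s), v; rewrite s3 sn PE rv -sE hE.
Qed.

End cyclic_sequences.

(** * Metric estimates for cutting a corner *)

Section corner_cutting.
Context {R : realType}.
Local Notation vec := (R * R * R)%type.
Local Notation H := (hplane R).
Local Notation "<< x , y >>" := (minkowski x y).
Local Coercion hpt : hplane >-> prod.
Implicit Types (x y z a b v w : H) (u e : vec) (C K P : set H).

(** The velocity of [ray x u] at time s, that is, the parallel transport of [u] along the ray. *)
Definition transport x u (s : R) : vec := lin (sh s) x (ch s) u.

Lemma tangent_transport x u s : tangent x u -> tangent (ray x u s) (transport x u s).
Proof.
move=> xu; have [xu0 uu] := xu; rewrite /tangent rayE// /transport !mink_lin minkxx.
rewrite (minkowskiC u) xu0 uu; split; first by ring.
have -> : sh s * (sh s * 1 + ch s * 0) + ch s * (sh s * 0 + ch s * -1) =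
  sh s ^+ 2 - ch s ^+ 2 by ring.
by rewrite ch2; ring.
Qed.

(* Write [w] and [w'] in a Lorentz frame along the geodesic through [q] and [ray q e D]. *)
Lemma mdist_ge_joint q e (D e1 e2 : R) w w' : tangent q e -> 0 <= D -> 0 <= e1 -> 0 <= e2 ->
  sh e1 <= <<w, e>> -> sh e2 <= - <<w', transport q e D>> ->
  D + e1 + e2 <= mdist w w'.
Proof.
move=> te D0 e10 e20 h1 h2; have [qe ee] := te.
rewrite -ch_ler ?mdist_ge0//; last by rewrite !addr_ge0.
rewrite ch_mdist; have G := gram_det w q e w' q e.
have G1 := gram_det w q e w q e; have G2 := gram_det w' q e w' q e.
move: G G1 G2; rewrite !minkxx !(minkowskiC e q) qe ee !(minkowskiC q) !(minkowskiC e w).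
rewrite !(minkowskiC e w').
have X0 := mink_gt0 w q; have X'0 := mink_gt0 w' (ray q e D).
move: h2 X'0; rewrite /transport (rayE _ te) !mink_linr.
move: h1 X0; set X := <<w, q>>; set Y := <<w, e>>; set x' := <<w', q>>; set y' := <<w', e>>.
set Z := det3 w q e; set z' := det3 w' q e; set W := <<w, w'>>.
have := ch2 D; have := sh_ge0 D; rewrite D0; have := ch_ge1 D.
set cD := ch D; set sD := sh D => cD1 sD0 cD2 h1 X0 h2 X'0 G G1 G2.
pose X' := cD * x' + sD * y'; pose Y' := - (sD * x' + cD * y').
rewrite -/X' in X'0; rewrite -/Y' in h2.
have WE : W = cD * (X * X' + Y * Y') + sD * (X * Y' + Y * X') - Z * z'.
  have xE : x' = cD * X' + sD * Y'.
    rewrite /X' /Y'; transitivity ((cD ^+ 2 - sD ^+ 2) * x'); last by ring.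
    by rewrite cD2; ring.
  have yE : y' = - (sD * X' + cD * Y').
    rewrite /X' /Y'; transitivity ((cD ^+ 2 - sD ^+ 2) * y'); last by ring.
    by rewrite cD2; ring.
  have -> : W = X * x' - Y * y' - Z * z' by lra.
  by rewrite xE yE; ring.
have X2 : X ^+ 2 = 1 + Y ^+ 2 + Z ^+ 2 by lra.
have X'2 : X' ^+ 2 = 1 + Y' ^+ 2 + z' ^+ 2.
  have : X' ^+ 2 - Y' ^+ 2 = x' ^+ 2 - y' ^+ 2.
    rewrite /X' /Y'; transitivity ((cD ^+ 2 - sD ^+ 2) * (x' ^+ 2 - y' ^+ 2)); first by ring.
    by rewrite cD2; ring.
  by lra.
have c1 := ch_gt0 e1; have c2 := ch_gt0 e2.
have s1 : 0 <= sh e1 by rewrite sh_ge0. have s2 : 0 <= sh e2 by rewrite sh_ge0.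
have := ch2 e1; have := ch2 e2; rewrite !chD !shD -/cD -/sD.
move: h1 h2 c1 c2 s1 s2; set C1 := ch e1; set C2 := ch e2; set S1 := sh e1; set S2 := sh e2.
move=> h1 h2 c1 c2 s1 s2 E2 E1.
have Y2 : S1 ^+ 2 <= Y ^+ 2 by rewrite ler_sqr ?nnegrE//; lra.
have Y'2 : S2 ^+ 2 <= Y' ^+ 2 by rewrite ler_sqr ?nnegrE//; lra.
pose N := `|Z * z'|; have N0 : 0 <= N by exact: normr_ge0.
have ZN : Z * z' <= N by exact: ler_norm.
(* Cauchy-Schwarz for the vectors (C1, |Z|) and (C2, |z'|), whose lengths are at most X and X'. *)
have XX : C1 * C2 + N <= X * X'.
  rewrite -ler_sqr ?nnegrE; last 2 first.
  - by rewrite addr_ge0// mulr_ge0// ltW.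
  - by rewrite mulr_ge0// ltW.
  have N2 : N ^+ 2 = Z ^+ 2 * z' ^+ 2 by rewrite real_normK ?num_real// exprMn.
  have amgm : 2 * (C1 * C2) * N <= C1 ^+ 2 * z' ^+ 2 + C2 ^+ 2 * Z ^+ 2.
    have : 0 <= (C1 * `|z'| - C2 * `|Z|) ^+ 2 by exact: sqr_ge0.
    rewrite sqrrB !exprMn !real_normK ?num_real// /N normrM.
    have -> : (C1 * `|z'| * (C2 * `|Z|)) *+ 2 = 2 * (C1 * C2) * (`|Z| * `|z'|).
      by rewrite mulr2n; ring.
    by lra.
  have k1 : C1 ^+ 2 + Z ^+ 2 <= X ^+ 2 by lra.
  have k2 : C2 ^+ 2 + z' ^+ 2 <= X' ^+ 2 by lra.
  have k3 : (C1 ^+ 2 + Z ^+ 2) * (C2 ^+ 2 + z' ^+ 2) <= (X * X') ^+ 2.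
    by rewrite exprMn; apply: ler_pM => //; rewrite addr_ge0// sqr_ge0.
  apply: le_trans k3; rewrite sqrrD N2 exprMn -mulr_natl.
  by move: amgm; lra.
have XC1 : C1 <= X.
  by rewrite -ler_sqr ?nnegrE ?(ltW X0) ?(ltW c1)//; have := sqr_ge0 Z; lra.
have XC2 : C2 <= X'.
  by rewrite -ler_sqr ?nnegrE ?(ltW X'0) ?(ltW c2)//; have := sqr_ge0 z'; lra.
have t1 : S1 * S2 <= Y * Y' by exact: ler_pM.
have t2 : C1 * S2 <= X * Y' by apply: ler_pM => //; exact: ltW.
have t3 : S1 * C2 <= Y * X' by apply: ler_pM => //; exact: ltW.
have t4 : cD * (C1 * C2 + S1 * S2 + N) <= cD * (X * X' + Y * Y').
  by rewrite ler_wpM2l//; lra.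
have t5 : sD * (C1 * S2 + S1 * C2) <= sD * (X * Y' + Y * X').
  by rewrite ler_wpM2l//; lra.
have t6 : N <= cD * N by rewrite ler_peMl.
by rewrite WE; lra.
Qed.

Lemma sh_mdist_lin x y z (s t : R) : 0 <= s -> 0 <= t -> hpt z = lin s x t y ->
  sh (mdist x z) = t * sh (mdist x y).
Proof.
move=> s0 t0 E; apply/eqP; rewrite -(@eqrXn2 _ 2) ?mulr_ge0 ?sh_ge0 ?mdist_ge0//.
have := ch2 (mdist x z); rewrite !ch_mdist E mink_linr minkxx => h1.
have := ch2 (mdist x y); rewrite ch_mdist.
have := minkxx z; rewrite {1 2}E !mink_lin !minkxx (minkowskiC y x).
by set c := <<x, y>> in h1 *; set d := sh (mdist x y) => h c2; apply/eqP; rewrite exprMn; nra.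
Qed.

(* With [l] half the length of the base and [h] the length of the legs of an isosceles
   triangle, [c] is the cosine of the base angle. *)
Lemma isosceles_lt (l h c : R) : 0 <= l -> l < h -> c = sh l * ch h / (sh h * ch l) ->
  0 <= c <= 1 /\ 2 * l < l * c + h.
Proof.
move=> l0 lh cE; have h0 : 0 < h by exact: le_lt_trans lh.
have sl : 0 <= sh l by rewrite sh_ge0. have shp : 0 < sh h by rewrite sh_gt0.
have cl := ch_ge1 l; have chh := ch_gt0 h.
have den : 0 < sh h * ch l by rewrite mulr_gt0// ch_gt0.
have c1E : (1 - c) * (sh h * ch l) = sh (h - l).
  by rewrite cE shB mulrBl divfK ?gt_eqF//; ring.
have d0 : 0 < sh (h - l) by rewrite sh_gt0 subr_gt0.
have c1 : 0 < 1 - c by rewrite -(pmulr_lgt0 _ den) c1E.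
have c0 : 0 <= c by rewrite cE divr_ge0 ?(ltW den)// mulr_ge0// ltW.
split; first by rewrite c0; lra.
suff : l * (1 - c) < h - l by lra.
rewrite -(ltr_pM2r den) -mulrA c1E.
have k : 0 <= (h - l) / h <= 1.
  rewrite divr_ge0 ?subr_ge0 ?(ltW lh) ?(ltW h0)//= ler_pdivrMr// mul1r; lra.
have := sh_convex k (ltW h0); rewrite divfK ?gt_eqF// => sc.
apply: (@le_lt_trans _ _ (l * ((h - l) / h * sh h))); first by rewrite ler_wpM2l.
have -> : l * ((h - l) / h * sh h) = (h - l) * sh h * (l / h) by field; rewrite gt_eqF.
rewrite [X in _ < X]mulrA ltr_pM2l; last by rewrite mulr_gt0// subr_gt0.
by apply: lt_le_trans cl; rewrite ltr_pdivrMr// mul1r.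
Qed.

(** Let c be the cosine of the base angle. The product of w with the side direction at [p] is
    [c * sh (mdist p w)], and convexity of [sh] allows a = c |pw|; likewise b = c |qw|. Then a + b
    is c times the base, and [isosceles_lt] compares this with the legs. *)
Lemma corner_gain v e1 e2 (h : R) w : tangent v e1 -> tangent v e2 ->
  -1 < <<e1, e2>> < 1 -> 0 <= h -> seg (ray v e1 h) (ray v e2 h) w ->
  exists a b : R, [/\ 0 <= a, 0 <= b, sh a <= <<w, transport v e1 h>>,
    sh b <= <<w, transport v e2 h>> &
    2 * mdist (ray v e1 h) (ray v e2 h) <= a + b + 2 * h /\
    (0 < h -> 2 * mdist (ray v e1 h) (ray v e2 h) < a + b + 2 * h)].
Proof.
move=> t1 t2 /andP[k1 k2]; rewrite le_eqVlt => /orP[/eqP<-|h0].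
  rewrite !ray0// => /seg_refl->; exists 0, 0; have [v1 _] := t1; have [v2 _] := t2.
  rewrite mdistxx /transport !mink_linr v1 v2 ltxx sh0; split => //; try by rewrite mulr0 mul0r addr0.
  by split => //; lra.
set p := ray v e1 h; set q := ray v e2 h => -[s [t [s0 t0 E]]].
have [v1 ee1] := t1; have [v2 ee2] := t2.
have pqE : <<p, q>> = 1 + (1 + <<e1, e2>>) * sh h ^+ 2.
  rewrite /p /q !rayE// !mink_lin minkxx (minkowskiC e1 v) v1 v2.
  by have := ch2 h; lra.
pose l := mdist p q / 2; have l2 : mdist p q = l + l by rewrite /l; field.
have l0 : 0 <= l by rewrite divr_ge0// mdist_ge0.
have lE : 2 * sh l ^+ 2 = (1 + <<e1, e2>>) * sh h ^+ 2.
  by have := ch_mdist p q; rewrite l2 ch_double pqE; lra.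
have shp : 0 < sh h by rewrite sh_gt0.
have shh2 : 0 < sh h ^+ 2 by rewrite exprn_gt0.
have k10 : 0 < 1 + <<e1, e2>> by lra.
have lpos : 0 < l.
  rewrite lt_neqAle l0 andbT; apply/eqP => l00; move: lE.
  rewrite -l00 sh0 expr0n mulr0 => /esym/eqP.
  by rewrite mulf_eq0 !gt_eqF.
have lh : l < h.
  rewrite -sh_ltr -ltr_sqr ?nnegrE ?sh_ge0 ?(ltW h0)//.
  have : <<e1, e2>> * sh h ^+ 2 < sh h ^+ 2 by rewrite gtr_pMl.
  lra.
pose c := sh l * ch h / (sh h * ch l).
have [c01 gain] := isosceles_lt l0 lh (erefl c).
have /andP[c0 c1] := c01.
have sum : mdist p w + mdist q w = l + l.
  by rewrite -l2 (metric_sym q); apply/esym/seg_mdist; exists s, t.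
have r1 : sh (mdist p w) = t * sh (l + l) by rewrite -l2; exact: sh_mdist_lin E.
have r2 : sh (mdist q w) = s * sh (l + l).
  rewrite -l2 (metric_sym p); apply: (sh_mdist_lin t0 s0).
  by rewrite E; apply: vec_eq; rewrite /lin/=; ring.
have cs : c * sh (l + l) = (1 + <<e1, e2>>) * sh h * ch h.
  rewrite shD /c; apply: (mulfI (lt0r_neq0 shp)).
  transitivity (2 * sh l ^+ 2 * ch h); first by field; rewrite !gt_eqF ?ch_gt0.
  by rewrite lE; ring.
exists (c * mdist p w), (c * mdist q w); split.
- by rewrite mulr_ge0// mdist_ge0.
- by rewrite mulr_ge0// mdist_ge0.
- apply: (le_trans (sh_convex c01 (mdist_ge0 _ _))); rewrite r1 mulrCA cs E.
  rewrite mink_linl /p /q !rayE// /transport !mink_lin minkxx !(minkowskiC _ v) v1 v2 ee1.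
  by rewrite (minkowskiC e2); lra.
- apply: (le_trans (sh_convex c01 (mdist_ge0 _ _))); rewrite r2 mulrCA cs E.
  rewrite mink_linl /p /q !rayE// /transport !mink_lin minkxx !(minkowskiC _ v) v1 v2 ee2.
  by lra.
rewrite -mulrDr sum l2; split=> [|_]; lra.
Qed.

Lemma hdir_rev x y : x != y -> hdir y x = lin (- sh (mdist x y)) x (- ch (mdist x y)) (hdir x y).
Proof.
move=> xy; have d0 := sh_mdist_gt0 xy; rewrite {1}/hdir (metric_sym y x).
rewrite -[in X in lin _ _ _ X](ray_hdir xy) (rayE _ (tangent_hdir xy)).
have c2 := ch2 (mdist x y).
transitivity (lin ((1 - ch (mdist x y) ^+ 2) / sh (mdist x y)) x (- ch (mdist x y)) (hdir x y)).
  by apply: vec_eq; rewrite /lin/=; field; rewrite gt_eqF.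
by rewrite c2; apply: vec_eq; rewrite /lin/=; field; rewrite gt_eqF.
Qed.

Lemma ray_rev x y (s : R) : x != y -> ray y (hdir y x) s = ray x (hdir x y) (mdist x y - s).
Proof.
move=> xy; have tx := tangent_hdir xy.
have ty : tangent y (hdir y x) by apply: tangent_hdir; rewrite eq_sym.
apply: hpt_inj; rewrite !rayE// hdir_rev// -{1}(ray_hdir xy) (rayE _ tx) chB shB.
by apply: vec_eq; rewrite /lin/=; ring.
Qed.

Lemma transport_rev x y (s : R) : x != y ->
  transport y (hdir y x) s =
  lin (-1) (transport x (hdir x y) (mdist x y - s)) 0 (hdir x y).
Proof.
move=> xy; have tx := tangent_hdir xy.
rewrite /transport hdir_rev// -{1}(ray_hdir xy) (rayE _ tx) chB shB.
by apply: vec_eq; rewrite /lin/=; ring.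
Qed.

Lemma transportD x u (s t : R) : tangent x u ->
  transport (ray x u s) (transport x u s) t = transport x u (s + t).
Proof.
move=> xu; rewrite /transport rayE// chD shD.
by apply: vec_eq; rewrite /lin/=; ring.
Qed.

Lemma side_gain x y (h h' e1 e2 : R) w w' : x != y -> h + h' <= mdist x y ->
  0 <= e1 -> 0 <= e2 -> sh e1 <= <<w, transport x (hdir x y) h>> ->
  sh e2 <= <<w', transport y (hdir y x) h'>> ->
  mdist x y - h - h' + e1 + e2 <= mdist w w'.
Proof.
move=> xy hh e10 e20 h1 h2; have tx := tangent_hdir xy.
apply: (mdist_ge_joint (tangent_transport h tx)) => //; first by lra.
rewrite transportD//; move: h2; rewrite transport_rev// mink_lin mul0r addr0 mulN1r.
by rewrite (_ : mdist x y - h' = h + (mdist x y - h - h'))//; ring.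
Qed.

End corner_cutting.

(** * Supporting a convex set across a corner *)

Section circumscribed_polygon.
Context {R : realType}.
Local Notation vec := (R * R * R)%type.
Local Notation H := (hplane R).
Local Notation "<< x , y >>" := (minkowski x y).
Local Coercion hpt : hplane >-> prod.
Implicit Types (x y z : H) (u e : vec) (C K P : set H).

Lemma det3_hdir2 x y (z : vec) : det3 x (hdir x y) z = det3 x y z / sh (mdist x y).
Proof. by rewrite /hdir det3_lin2 det3_0; ring. Qed.

Lemma det3_hdir3 x y (z : vec) : det3 x z (hdir x y) = det3 x z y / sh (mdist x y).
Proof. by rewrite /hdir det3_lin3 det3_0; ring. Qed.

Lemma seg_ray_mdist x y z : x != y -> seg x y z -> z = ray x (hdir x y) (mdist x z).
Proof.
move=> xy /(seg_rayP _ xy)[s /andP[s0 _] ->]; have tu := tangent_hdir xy.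
by have := mdist_ray 0 s tu; rewrite ray0// sub0r normrN ger0_norm// => ->.
Qed.

Lemma tangent_lt1 x e1 e2 : tangent x e1 -> tangent x e2 -> det3 x e1 e2 != 0 ->
  -1 < <<e1, e2>> < 1.
Proof.
move=> [x1 e11] [x2 e22] D0.
have := gram_det x e1 e2 x e1 e2; rewrite minkxx !(minkowskiC e1 x) !(minkowskiC e2 x).
rewrite (minkowskiC e2 e1) x1 x2 e11 e22 -expr2 => G.
have : 0 < det3 x e1 e2 ^+ 2 by rewrite exprn_even_gt0.
rewrite G => h; have : <<e1, e2>> ^+ 2 < 1 by lra.
by move=> k; apply/andP; split; nra.
Qed.

(* [psi] is the line meeting both sides of the corner at distance [h] from the vertex [v];
   it supports [C] at [w]. *)
Record corner v e1 e2 C (h : R) (w : H) (psi : vec) : Prop := Corner {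
  corner_ge0 : 0 <= h ;
  corner_in : C w ;
  corner_seg : seg (ray v e1 h) (ray v e2 h) w ;
  corner_support : forall z, C z -> 0 <= <<psi, z>> ;
  corner_on : forall z : H, 0 <= det3 (hpt v) e2 z -> 0 <= det3 (hpt v) z e1 ->
    <<psi, z>> = 0 -> seg (ray v e1 h) (ray v e2 h) z ;
  corner_side1 : forall s, 0 <= <<psi, ray v e1 s>> -> h <= s ;
  corner_side2 : forall s, 0 <= <<psi, ray v e2 s>> -> h <= s }.

(** The functional [G] vanishes at [v] and equals [sh s] at distance s along both legs, so the
    isosceles cut with legs h is the zero set of G - T v with T = tanh h. The supporting cut has for
    T the minimum of the quotient over [C]; the point of [C] on a leg ensures that this T is a
    hyperbolic tangent. *)
Lemma corner_exists (v : H) e1 e2 C t : tangent v e1 -> tangent v e2 ->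
  0 < det3 v e2 e1 -> compact C ->
  (forall z, C z -> 0 <= det3 v e2 z) -> (forall z, C z -> 0 <= det3 v z e1) ->
  0 <= t -> C (ray v e2 t) ->
  exists h w psi, corner v e1 e2 C h w psi.
Proof.
move=> t1 t2 D0 kC h2 h1 t0 Ct; set D := det3 v e2 e1 in D0.
have [v1 ee1] := t1; have [v2 ee2] := t2.
pose G : vec := lin D^-1 (mcross v e2) D^-1 (mcross e1 v).
have GE z : <<G, z>> = (det3 v e2 z + det3 v z e1) / D.
  by rewrite /G mink_linl !mink_cross (det3C e1 v z); ring.
have dec z : hpt z = lin 1 (lin <<v, z>> v (det3 v e2 z / D) e1) (det3 v z e1 / D) e2.
  have E := cramer (hpt v) e2 e1 z; rewrite -/D in E.
  have aE : det3 z e2 e1 = D * <<v, z>>.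
    have := congr1 (fun u : vec => <<u, v>>) E; rewrite !mink_lin minkxx.
    by rewrite (minkowskiC e2) (minkowskiC e1) v1 v2 (minkowskiC z); lra.
  rewrite aE in E; have X1 := congr1 (fun u : vec => u.1.1) E.
  have X2 := congr1 (fun u : vec => u.1.2) E; have X3 := congr1 (fun u : vec => u.2) E.
  move: X1 X2 X3; rewrite /lin/= !mul0r !addr0 => X1 X2 X3.
  by apply: vec_eq; rewrite /=; apply: (mulfI (lt0r_neq0 D0)); rewrite ?X1 ?X2 ?X3;
    field; rewrite gt_eqF.
have G2 s : <<G, ray v e2 s>> = sh s.
  by rewrite GE rayE// !det3_lin !det3_0 -/D; field; rewrite gt_eqF.
have G1 s : <<G, ray v e1 s>> = sh s.
  rewrite GE rayE// !det3_lin !det3_0 -/D; field; rewrite gt_eqF//.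
have vr e s : tangent v e -> <<v, ray v e s>> = ch s.
  by move=> te; have [ve _] := te; rewrite rayE// mink_linr minkxx ve; ring.
have rho_cont : continuous (fun z : H => <<G, z>> / <<v, z>> : R).
  move=> z; apply: cvgM; first exact: mink_continuous.
  by apply: cvgV; [rewrite gt_eqF// mink_gt0|exact: mink_continuous].
have [w Cw hw] := compact_min rho_cont kC (ex_intro _ _ Ct).
set T := <<G, w>> / <<v, w>> in hw.
have Gge z : C z -> 0 <= <<G, z>>.
  by move=> Cz; rewrite GE divr_ge0 ?(ltW D0)// addr_ge0 ?h1 ?h2.
have T0 : 0 <= T by rewrite /T divr_ge0 ?Gge// ltW// mink_gt0.
pose psi : vec := lin 1 G (- T) v.
have psiE (z : vec) : <<psi, z>> = <<G, z>> - T * <<v, z>> by rewrite /psi mink_linl; ring.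
have sup z : C z -> 0 <= <<psi, z>>.
  by move=> Cz; rewrite psiE subr_ge0 -ler_pdivlMr ?mink_gt0//; exact: hw.
pose f (s : R) := sh s - T * ch s.
have cf : continuous f.
  move=> s; apply: cvgB; first exact: continuous_sh.
  by apply: cvgM; [exact: cvg_cst|exact: continuous_ch].
have ft : 0 <= f t by have := sup _ Ct; rewrite psiE G2 vr.
have f0 : f 0 <= 0 by rewrite /f sh0 ch0; lra.
have [|h] := @IVT R f 0 t 0 t0 (continuous_subspaceT cf).
  by rewrite ge_min f0/= le_max ft orbT.
rewrite in_itv/= => /andP[h0 ht] fh.
have hT : sh h = T * ch h by move: fh; rewrite /f; lra.
have side s : 0 <= sh s - T * ch s -> h <= s.
  move=> hs; rewrite -subr_ge0 -sh_ge0 shB hT.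
  have : 0 <= (sh s - T * ch s) * ch h by rewrite mulr_ge0// ltW// ch_gt0.
  by lra.
have on z : 0 <= det3 v e2 z -> 0 <= det3 v z e1 -> <<psi, z>> = 0 ->
    seg (ray v e1 h) (ray v e2 h) z.
  move=> d1 d2; rewrite psiE GE => E; have zE := dec z.
  have b0 : 0 <= det3 v e2 z / D by rewrite divr_ge0// ltW.
  have g0 : 0 <= det3 v z e1 / D by rewrite divr_ge0// ltW.
  move: zE E b0 g0; rewrite [X in X - _ = _]mulrDl; set b := det3 v e2 z / D; set g := det3 v z e1 / D.
  set al := <<v, z>> => zE E b0 g0.
  move: h0; rewrite le_eqVlt => /orP[/eqP h00|h0].
    have T00 : T = 0 by move: hT; rewrite -h00 sh0 ch0; lra.
    have [bb gg] : b = 0 /\ g = 0 by rewrite T00 in E; split; lra.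
    rewrite -h00 !ray0//; exists al, 0; split => //; first exact: ltW (mink_gt0 _ _).
    by rewrite zE bb gg; apply: vec_eq; rewrite /lin/=; ring.
  have shp : 0 < sh h by rewrite sh_gt0.
  have chp := ch_gt0 h.
  exists (b / sh h), (g / sh h); split.
  - by apply: divr_ge0 => //; exact: ltW.
  - by apply: divr_ge0 => //; exact: ltW.
  rewrite zE !rayE//; have -> : al = (b + g) * ch h / sh h.
    apply: (mulIf (lt0r_neq0 shp)); rewrite divfK ?gt_eqF// hT.
    by move: E => /(congr1 ( *%R^~ (ch h))); lra.
  by apply: vec_eq; rewrite /lin/=; field; rewrite gt_eqF.
exists h, w, psi; split => //.
- have psiw : <<psi, w>> = 0 by rewrite psiE /T divfK ?subrr// gt_eqF// mink_gt0.
  by apply: on => //; [exact: h2|exact: h1].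
- by move=> s; rewrite psiE G1 vr//; exact: side.
- by move=> s; rewrite psiE G2 vr//; exact: side.
Qed.

(** Used for the functionals that cut out the truncated polygon, restricted to a ray: their minimum
    [M k] is continuous, so the intermediate value theorem gives a point of the polygon on one of
    the lines. *)
Lemma first_zero k (f : nat -> R -> R) (s1 : R) : 0 <= s1 -> (forall i, continuous (f i)) ->
  (forall i, (i <= k)%N -> 0 <= f i 0) -> (exists2 i, (i <= k)%N & f i s1 < 0) ->
  exists s, [/\ 0 <= s, forall i, (i <= k)%N -> 0 <= f i s & exists2 i, (i <= k)%N & f i s = 0].
Proof.
move=> s10 cf f0 [j jk fj].
pose M : nat -> R -> R := fix M n := if n is n'.+1 then fun s => Num.min (M n' s) (f n s) else f 0%N.
have cM n : continuous (M n).
  elim: n => [|n IH]; first exact: cf.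
  by move=> s; apply: (@continuous_min _ _ (M n) (f n.+1)); [exact: IH|exact: cf].
have Mle n i s : (i <= n)%N -> M n s <= f i s.
  elim: n => [|n IH]; first by rewrite leqn0 => /eqP->.
  rewrite leq_eqVlt ltnS => /orP[/eqP->|/IH h] /=; rewrite ge_min ?lexx ?orbT//.
  by rewrite h.
have Mex n s : exists2 i, (i <= n)%N & M n s = f i s.
  elim: n => [|n [i ni E]]; first by exists 0%N.
  rewrite /=; have [h|h] := leP (M n s) (f n.+1 s).
    by exists i; [exact: leqW|].
  by exists n.+1.
have M0 : 0 <= M k 0 by have [i ik ->] := Mex k 0; exact: f0.
have M1 : M k s1 <= 0 by apply: (le_trans (Mle _ _ _ jk)); exact: ltW.
have [|s] := @IVT R (M k) 0 s1 0 s10 (continuous_subspaceT (cM k)).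
  by rewrite ge_min M1 orbT/= le_max M0.
rewrite in_itv/= => /andP[s0 _] Ms; exists s; split => // [i ik|].
  by rewrite -Ms; exact: Mle.
by have [i ik E] := Mex k s; exists i => //; rewrite -E.
Qed.

Lemma ball_convex x (B : R) : geodesically_convex [set z : H | <<z, x>> <= B].
Proof.
apply/geodesically_convexP => y z /= hy hz t [a [b [a0 b0 E]]] /=.
rewrite E mink_linl.
(* The product of two points is at least 1, so the square of a + b is at most the square of the
   resulting point, which is 1. *)
have ab1 : a + b <= 1.
  have := minkxx t; rewrite {1 2}E !mink_lin !minkxx (minkowskiC z y).
  have : a * b <= a * b * <<y, z>> by rewrite ler_peMr ?mulr_ge0// minkowski_ge1.
  move=> h1 h2; rewrite -(@ler_pXn2r _ 2) ?nnegrE ?addr_ge0// expr1n; lra.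
have B0 : 0 <= B by apply: le_trans hy; exact: ltW (mink_gt0 _ _).
have h1 : a * <<y, x>> <= a * B by rewrite ler_wpM2l.
have h2 : b * <<z, x>> <= b * B by rewrite ler_wpM2l.
have : (a + b) * B <= 1 * B by rewrite ler_wpM2r.
by lra.
Qed.

End circumscribed_polygon.

(** * The truncated polygon and its points of contact *)

Section inscribed_sequence.
Context {R : realType}.
Local Notation vec := (R * R * R)%type.
Local Notation H := (hplane R).
Local Notation "<< x , y >>" := (minkowski x y).
Local Coercion hpt : hplane >-> prod.
Implicit Types (x y z : H) (u e : vec) (K : set H).

Lemma periodic_choice (T : Type) m (Phi : nat -> T -> Prop) : (0 < m)%N ->
  (forall i (x : T), Phi i x -> Phi (i + m)%N x) -> (forall i, exists x : T, Phi i x) ->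
  exists f : nat -> T, (forall i, f (i + m)%N = f i) /\ forall i, Phi i (f i).
Proof.
move=> m0 shift ex.
have Ti : inhabited T by have [x _] := ex 0%N; exact: (inhabits x).
have [g gP] : exists g : nat -> T, forall i, Phi i (g i).
  exists (fun i => projT1 (cid (ex i))) => i; exact: projT2 (cid (ex i)).
exists (fun i => g (i %% m)%N); split => i; first by rewrite modnDr.
rewrite {1}(divn_eq i m) addnC; elim: (i %/ m)%N => [|k IH].
  by rewrite mul0n addn0.
by rewrite mulSn (addnC m) addnA; exact: shift.
Qed.

Lemma sum_periodicS m (f : nat -> R) : (forall i, f (i + m)%N = f i) ->
  \sum_(i < m) f i.+1 = \sum_(i < m) f i.
Proof.
case: m => [|m] fp; first by rewrite !big_ord0.
rewrite big_ord_recr [RHS]big_ord_recl /= addrC; congr (_ + _).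
by have := fp 0%N; rewrite add0n.
Qed.

Lemma sum_periodicD m (f : nat -> R) k : (forall i, f (i + m)%N = f i) ->
  \sum_(i < m) f (k + i)%N = \sum_(i < m) f i.
Proof.
move=> fp; elim: k => // k IH; rewrite -[RHS]IH.
under eq_bigr do rewrite addSnnS.
apply: (@sum_periodicS m (fun i => f (k + i)%N)) => i.
by rewrite addnA fp.
Qed.

Section circumscribed.
Variables (m : nat) (v : nat -> H) (C : set H) (t : nat -> H).
Hypotheses (m3 : (3 <= m)%N) (pv : periodic m v) (sv : scyclic m v).
Let P := convex_hull (range v).
Hypotheses (kC : compact C) (cC : geodesically_convex C) (CP : C `<=` P).
Hypothesis (Ct : forall i, C (t i)).
Hypothesis (ts : forall i, seg (v i) (v i.+1) (t i)).

Let m0 : (0 < m)%N. Proof. by apply: leq_trans m3. Qed.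
(** Corner [i] sits at [v i.+1], which avoids predecessors: [e1] points back to [v i], [e2] forward
    to [v i.+2]. *)
Let e1 i := hdir (v i.+1) (v i).
Let e2 i := hdir (v i.+1) (v i.+2).
Let vn i : v i != v i.+1. Proof. exact: scyclic_neq sv i. Qed.
Let vn' i : v i.+1 != v i. Proof. by rewrite eq_sym. Qed.
Let te1 i : tangent (v i.+1) (e1 i). Proof. exact: tangent_hdir (vn' i). Qed.
Let te2 i : tangent (v i.+1) (e2 i). Proof. exact: tangent_hdir. Qed.

Let t_e1 i : t i = ray (v i.+1) (e1 i) (mdist (v i.+1) (t i)).
Proof. by apply: seg_ray_mdist => //; rewrite segC. Qed.

Let t_e2 i : t i.+1 = ray (v i.+1) (e2 i) (mdist (v i.+1) (t i.+1)).
Proof. exact: seg_ray_mdist. Qed.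

Let det_gt0 i : 0 < det3 (v i.+1) (e2 i) (e1 i).
Proof.
rewrite /e1 /e2 det3_hdir2 det3_hdir3 !divr_gt0 ?sh_mdist_gt0//.
by rewrite -det3C; apply: sv; lia.
Qed.

Let det2 i z : P z -> 0 <= det3 (v i.+1) (e2 i) z.
Proof.
move=> Pz; rewrite /e2 det3_hdir2 divr_ge0 ?(ltW (sh_mdist_gt0 _))//.
by move/(scyclic_hull m3 pv sv) : Pz.
Qed.

Let det1 i z : P z -> 0 <= det3 (v i.+1) z (e1 i).
Proof.
move=> Pz; rewrite /e1 det3_hdir3 divr_ge0 ?(ltW (sh_mdist_gt0 _))//.
by rewrite -det3C; move/(scyclic_hull m3 pv sv) : Pz.
Qed.

Let lt1 i : -1 < <<e1 i, e2 i>> < 1.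
Proof.
by apply: (tangent_lt1 (te1 i) (te2 i)); rewrite det3N' oppr_eq0 gt_eqF.
Qed.

Lemma corner_family : exists (h : nat -> R) (w : nat -> H) (psi : nat -> vec),
  [/\ forall i, h (i + m)%N = h i, periodic m w, forall i, psi (i + m)%N = psi i &
      forall i, corner (v i.+1) (e1 i) (e2 i) C (h i) (w i) (psi i)].
Proof.
have [|i|f [fp fP]] := @periodic_choice (R * H * vec)%type m
    (fun i (x : R * H * vec) => corner (v i.+1) (e1 i) (e2 i) C x.1.1 x.1.2 x.2) m0.
- by move=> i x; rewrite /e1 /e2 -!addSn !pv.
- have [h [w [psi hc]]] := corner_exists (te1 i) (te2 i) (det_gt0 i) kC
    (fun z Cz => det2 i (CP Cz)) (fun z Cz => det1 i (CP Cz)) (mdist_ge0 (v i.+1) (t i.+1))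
    (eq_ind _ C (Ct i.+1) _ (t_e2 i)).
  by exists (h, w, psi).
exists (fun i => (f i).1.1), (fun i => (f i).1.2), (fun i => (f i).2).
by split => // i; rewrite fp.
Qed.

Variables (h : nat -> R) (w : nat -> H) (psi : nat -> vec).
Hypotheses (ph : forall i, h (i + m)%N = h i) (pw : periodic m w) (ppsi : forall i, psi (i + m)%N = psi i).
Hypothesis (hc : forall i, corner (v i.+1) (e1 i) (e2 i) C (h i) (w i) (psi i)).

Let p i := ray (v i.+1) (e1 i) (h i).
Let q i := ray (v i.+1) (e2 i) (h i).
Let D i := mdist (v i.+1) (v i.+2) - h i - h i.+1.

Let hle1 i : h i <= mdist (v i.+1) (t i).
Proof. by apply: (corner_side1 (hc i)); rewrite -t_e1; exact: corner_support (hc i) _ (Ct i). Qed.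

Let hle2 i : h i <= mdist (v i.+1) (t i.+1).
Proof. by apply: (corner_side2 (hc i)); rewrite -t_e2; exact: corner_support (hc i) _ (Ct i.+1). Qed.

(** The two cuts along a side cannot overlap, because the point [t i.+1] of [C] on it lies beyond
    both. *)
Let D_ge0 i : h i + h i.+1 <= mdist (v i.+1) (v i.+2).
Proof.
by rewrite (seg_mdist (ts i.+1)) lerD// metric_sym.
Qed.

Let pE i : p i.+1 = ray (v i.+1) (e2 i) (mdist (v i.+1) (v i.+2) - h i.+1).
Proof. by rewrite /p /e1 ray_rev. Qed.

Let qp i : mdist (q i) (p i.+1) = D i.
Proof.
rewrite pE /q mdist_ray// distrC ger0_norm; first by rewrite /D; ring.
by have := D_ge0 i; lra.
Qed.

(** The boundary of the truncated polygon: the bases, and what remains of the sides. *)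
Let S := \bigcup_(i in `I_m) (seg (p i) (q i) `|` seg (q i) (p i.+1)).

Let S_all i : seg (p i) (q i) `|` seg (q i) (p i.+1) `<=` S.
Proof.
move=> x hx; exists (i %% m)%N; first exact: ltn_pmod.
have per (f : nat -> H) : periodic m f -> f (i %% m)%N = f i.
  by move=> pf; rewrite [in RHS](divn_eq i m) addnC periodicM.
have pp : periodic m p by move=> j; rewrite /p /e1 -!addSn !pv ph.
have pq : periodic m q by move=> j; rewrite /q /e2 -!addSn !pv ph.
have ppS : periodic m (fun i => p i.+1) by move=> j; rewrite -addSn pp.
by rewrite (per _ pp) (per _ pq) (per _ ppS).
Qed.

(** This is the condition of [Per_le]. A ray from [C] starts inside all half-planes of the truncated
    polygon and must leave it. If it does so on a supporting line, it hits a base; if on a side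
    line, it hits the part between two cuts. *)
Let exit a u : C a -> tangent a u -> exists2 s, 0 <= s & S (ray a u s).
Proof.
move=> Ca tu; pose f i s := Num.min (det3 (v i) (v i.+1) (ray a u s)) <<psi i, ray a u s>>.
have cray : continuous (ray a u).
  by apply: curve_continuous => s s'; rewrite mdist_ray.
have cmink u' : continuous (fun s => <<u', ray a u s>> : R).
  move=> s; apply: (@continuous_comp _ _ _ (ray a u) (fun z : H => <<u', z>> : R)).
    exact: cray.
  exact: mink_continuous.
have cf i : continuous (f i).
  move=> s; apply: (@continuous_min _ _ (fun s => det3 (v i) (v i.+1) (ray a u s))
    (fun s => <<psi i, ray a u s>>)); last exact: cmink.
  rewrite (_ : (fun s => _) = (fun s => <<mcross (v i) (v i.+1), ray a u s>> : R)).
    exact: cmink.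
  by apply/funext => s'; rewrite mink_cross.
have f0 i : (i <= m)%N -> 0 <= f i 0.
  move=> _; rewrite /f ray0// le_min (corner_support (hc i) Ca) andbT.
  by have /(scyclic_hull m3 pv sv) := CP Ca.
(* Balls are convex, so one around [a] that contains all vertices contains [P]; at time [s1] the ray
   is outside it. *)
have [s1 s10 hs1] := ch_unbounded (\sum_(i < m) <<v i, a>>).
have fper i s : f (i %% m)%N s = f i s.
  have per (T : Type) (g : nat -> T) : (forall i, g (i + m)%N = g i) -> g (i %% m)%N = g i.
    move=> pg; rewrite [in RHS](divn_eq i m) addnC.
    by elim: (i %/ m)%N => [|k IH]; rewrite ?mul0n ?addn0// mulSn (addnC m) addnA pg.
  have pf k : f (k + m)%N = f k by apply/funext => s'; rewrite /f -addSn !pv ppsi.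
  by have := per _ f pf; move=> /(congr1 (fun g => g s)).
have fall s : (forall i, (i <= m)%N -> 0 <= f i s) -> forall i, 0 <= f i s.
  by move=> h0 i; rewrite -fper; apply: h0; apply: ltnW; exact: ltn_pmod.
have inP s : (forall i, 0 <= f i s) -> P (ray a u s).
  by move=> fs; apply/(scyclic_hull m3 pv sv) => i; have := fs i; rewrite /f le_min => /andP[].
have f1 : exists2 i, (i <= m)%N & f i s1 < 0.
  apply: contrapT => hn; have /inP : forall i, 0 <= f i s1.
    by apply: fall => i im; rewrite leNgt; apply/negP => fi; apply: hn; exists i.
  have hb : P `<=` [set z : H | <<z, a>> <= \sum_(i < m) <<v i, a>>].
    apply: convex_hull_sub; first exact: ball_convex.
    move=> _ [i _ <-] /=; have [j jm ->] := periodic_window 0 i m0 pv.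
    rewrite (bigD1 (Ordinal jm))//= lerDl sumr_ge0// => k _.
    exact: ltW (mink_gt0 _ _).
  move=> /hb/=; have := mink_ray s1 0 tu; rewrite ray0// subr0 => ->.
  by rewrite leNgt hs1.
have [s [s0 fs [i im fi]]] := first_zero s10 cf f0 f1.
have {}fs := fall s fs; have Pz := inP s fs; exists s => //; move: Pz fs fi.
rewrite /f; move: (ray a u s) => z Pz fs.
have psiz j : 0 <= <<psi j, z>> by have := fs j; rewrite le_min => /andP[].
have [_ d0|_ d0] := leP (det3 (v i) (v i.+1) z) <<psi i, z>>; last first.
  apply: (S_all (i := i)); left; apply: (corner_on (hc i)) d0; [exact: det2|exact: det1].
(* The index i - 1 modulo m: corner [j] is the one at [v i]. *)
pose j := (i + m.-1)%N; have jE : j.+1 = (i + m)%N by rewrite /j -addnS prednK.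
have vj : v j.+1 = v i by rewrite jE pv.
have vj' : v j.+2 = v i.+1 by rewrite jE -addSn pv.
have zs : seg (v j.+1) (v j.+2) z by rewrite vj vj'; exact: (scyclic_on_side m3 pv sv Pz d0).
apply: (S_all (i := j)); right.
have zE := seg_ray_mdist (vn j.+1) zs.
have zE' : z = ray (v j.+2) (e1 j.+1) (mdist (v j.+2) z).
  by apply: seg_ray_mdist => //; rewrite segC.
have k1 : h j <= mdist (v j.+1) z by apply: (corner_side2 (hc j)); rewrite -zE.
have k2 : h j.+1 <= mdist (v j.+2) z by apply: (corner_side1 (hc j.+1)); rewrite -zE'.
rewrite pE zE; apply: seg_ray => //; rewrite k1/= (seg_mdist zs) (metric_sym z).
by lra.
Qed.

Lemma Per_circumscribed : (Per C <= (\sum_(i < m) (mdist (p i) (q i) + D i))%:E)%E.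
Proof.
have C0 : C !=set0 by exists (t 0%N).
have kS : compact S.
  rewrite /S; elim: (m) => [|k IH]; first by rewrite II0 bigcup_set0; exact: compact0.
  rewrite IIS bigcup_setU bigcup_set1; apply: compactU => //.
  by apply: compactU; exact: seg_compact.
apply: (le_trans (Per_le kC cC C0 kS (fun a u Ca tu _ => exit Ca tu))).
rewrite /S; elim: (m) => [|k IH]; first by rewrite II0 bigcup_set0 hausdorff1_set0 big_ord0.
rewrite IIS bigcup_setU bigcup_set1 big_ord_recr/= EFinD.
apply: (le_trans (hausdorff1U _ _)); apply: leeD => //.
apply: (le_trans (hausdorff1U _ _)).
by rewrite !hausdorff1_seg qp EFinD.
Qed.

(** [side_gain] bounds the steps of [w] from below and [corner_gain] the bases from above. In the
    cyclic sums the shifts of [a] and [h] disappear, so the gains cancel. *)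
Lemma sum_gain :
  2 * \sum_(i < m) (mdist (p i) (q i) + D i) <=
    \sum_(i < m) mdist (w i) (w i.+1) + \sum_(i < m) mdist (v i) (v i.+1) /\
  ((exists i, 0 < h i) -> 2 * \sum_(i < m) (mdist (p i) (q i) + D i) <
    \sum_(i < m) mdist (w i) (w i.+1) + \sum_(i < m) mdist (v i) (v i.+1)).
Proof.
have [|i|ab [pab hab]] := @periodic_choice (R * R)%type m (fun i (x : R * R) =>
    [/\ 0 <= x.1, 0 <= x.2, sh x.1 <= <<w i, transport (v i.+1) (e1 i) (h i)>>,
    sh x.2 <= <<w i, transport (v i.+1) (e2 i) (h i)>> &
    2 * mdist (p i) (q i) <= x.1 + x.2 + 2 * h i /\
    (0 < h i -> 2 * mdist (p i) (q i) < x.1 + x.2 + 2 * h i)]) m0.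
- by move=> i x; rewrite /p /q /e1 /e2 -!addSn !pv ph pw.
- have [a [b H1]] := corner_gain (te1 i) (te2 i) (lt1 i) (corner_ge0 (hc i)) (corner_seg (hc i)).
  by exists (a, b).
pose a i := (ab i).1; pose b i := (ab i).2.
have side i : D i + b i + a i.+1 <= mdist (w i) (w i.+1).
  have [_ b0 _ hb _] := hab i; have [a0 _ ha _ _] := hab i.+1.
  by apply: (@side_gain _ (v i.+1) (v i.+2)) => //; exact: D_ge0.
have Sv : \sum_(i < m) mdist (v i) (v i.+1) = \sum_(i < m) (D i + h i + h i.+1).
  rewrite -(@sum_periodicS m (fun i => mdist (v i) (v i.+1))).
    by apply: eq_bigr => i _; rewrite /D; ring.
  by move=> i; rewrite -addSn !pv.
have Sa : \sum_(i < m) a i.+1 = \sum_(i < m) a i.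
  by apply: (@sum_periodicS m a) => i; rewrite /a pab.
have Sh : \sum_(i < m) h i.+1 = \sum_(i < m) h i by exact: sum_periodicS.
have S1 : \sum_(i < m) (D i + b i + a i.+1) <= \sum_(i < m) mdist (w i) (w i.+1).
  by apply: ler_sum.
have S2 : \sum_(i < m) 2 * mdist (p i) (q i) <= \sum_(i < m) (a i + b i + 2 * h i).
  by apply: ler_sum => i _; have [_ _ _ _ []] := hab i.
move: S1 S2; rewrite Sv !big_split/= Sa Sh -!mulr_sumr => S1 S2.
split=> [|[i hi]]; first by lra.
have S3 : \sum_(i < m) 2 * mdist (p i) (q i) < \sum_(i < m) (a i + b i + 2 * h i).
  pose i0 := Ordinal (ltn_pmod i m0).
  rewrite (bigD1 i0)//= [X in _ < X](bigD1 i0)//=; apply: ltr_leD; last first.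
    by apply: ler_sum => j _; have [_ _ _ _ []] := hab j.
  have [_ _ _ _ [_]] := hab (i %% m)%N; apply.
  have : h (i %% m)%N = h i.
    rewrite [in RHS](divn_eq i m) addnC.
    by elim: (i %/ m)%N => [|k IH]; rewrite ?mul0n ?addn0// mulSn (addnC m) addnA ph.
  by move=> ->.
by move: S3; rewrite !big_split/= -!mulr_sumr; lra.
Qed.

(** The cut meets the legs no farther from the vertex than the points [t], so [w i] lies in the
    triangle of [t i], [v i.+1], [t i.+1]. From this the cyclic order of the [w i] is derived. *)
Lemma corner_cone i : exists a b c : R, [/\ 0 <= a, 0 <= b, 0 <= c &
  hpt (w i) = lin 1 (lin a (t i) b (v i.+1)) c (t i.+1)].
Proof.
have h0 := corner_ge0 (hc i).
have [a1 [b1 [a10 b10 E1]]] : seg (v i.+1) (t i) (p i).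
  by rewrite t_e1 -[X in seg X](ray0 (te1 i)); apply: seg_ray => //; rewrite h0 hle1.
have [a2 [b2 [a20 b20 E2]]] : seg (v i.+1) (t i.+1) (q i).
  by rewrite t_e2 -[X in seg X](ray0 (te2 i)); apply: seg_ray => //; rewrite h0 hle2.
have [s [r [s0 r0 E]]] := corner_seg (hc i).
exists (s * b1), (s * a1 + r * a2), (r * b2); rewrite !mulr_ge0// addr_ge0 ?mulr_ge0//.
split => //; rewrite E -/(p i) -/(q i) E1 E2.
by apply: vec_eq; rewrite /lin/=; ring.
Qed.

Lemma corner_gt0 : (exists i, ~ C (v i)) -> exists i, 0 < h i.
Proof.
move=> [i nCv]; exists (i + m.-1)%N; rewrite lt_neqAle (corner_ge0 (hc _)) andbT.
apply/eqP => h0; apply: nCv; have := corner_seg (hc (i + m.-1)%N); rewrite -h0 !ray0//.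
move=> /seg_refl wE; have := corner_in (hc (i + m.-1)%N).
by rewrite wE -addnS prednK// pv.
Qed.

End circumscribed.

(* Cutting the corners of a circumscribed polygon gives an inscribed cyclic sequence [w] and
   a circumscribed polygon of perimeter [x]; convexity of distances bounds the average of the
   two lengths from below by [x]. *)
Lemma inscribed_sequence m (v t : nat -> H) C : (3 <= m)%N -> periodic m v -> scyclic m v ->
  compact C -> geodesically_convex C -> C `<=` convex_hull (range v) ->
  (forall i, C (t i)) -> (forall i, seg (v i) (v i.+1) (t i)) ->
  exists (w : nat -> H) (x : R), [/\ periodic m w, forall i, C (w i),
    forall i, exists a b c : R, [/\ 0 <= a, 0 <= b, 0 <= c &
      hpt (w i) = lin 1 (lin a (t i) b (v i.+1)) c (t i.+1)],
    (Per C <= x%:E)%E &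
    2 * x <= \sum_(i < m) mdist (w i) (w i.+1) + \sum_(i < m) mdist (v i) (v i.+1) /\
    ((exists i, ~ C (v i)) ->
     2 * x < \sum_(i < m) mdist (w i) (w i.+1) + \sum_(i < m) mdist (v i) (v i.+1))].
Proof.
move=> m3 pv sv kC cC CP Ct ts.
have [h [w [psi [ph pw ppsi hc]]]] := corner_family m3 pv sv kC CP Ct ts.
eexists w, _; split => //.
- by move=> i; exact: corner_in (hc i).
- exact: (corner_cone m3 sv Ct ts hc).
- exact: (Per_circumscribed m3 pv sv kC cC CP Ct ts ph ppsi hc).
have [g1 g2] := sum_gain m3 pv sv Ct ts ph pw hc.
split; first exact: g1.
by move=> /(corner_gt0 m3 pv sv hc); exact: g2.
Qed.

End inscribed_sequence.

(** * Cyclic order of the contact points and their degenerate position *)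

Section refinement.
Context {R : realType}.
Local Notation vec := (R * R * R)%type.
Local Notation H := (hplane R).
Local Coercion hpt : hplane >-> prod.
Implicit Types (x y z : H) (K C : set H) (i j k m : nat).

(** Three generators, possibly repeated, cover vertices, points of sides and points of corners; the
    index window is what controls the order. *)
Definition cone3 (v : nat -> H) lo hi (z : H) := exists k1 k2 k3 (a b c : R),
  [/\ (lo <= k1 <= hi)%N, (lo <= k2 <= hi)%N, (lo <= k3 <= hi)%N &
  [/\ 0 <= a, 0 <= b, 0 <= c & hpt z = lin 1 (lin a (v k1) b (v k2)) c (v k3)]].

Lemma cone3_ge0 (L : vec -> R) (v : nat -> H) lo hi z :
  (forall a (x : vec) b (y : vec), L (lin a x b y) = a * L x + b * L y) ->
  (forall k, (lo <= k <= hi)%N -> 0 <= L (v k)) -> cone3 v lo hi z -> 0 <= L z.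
Proof.
move=> Ll h [k1 [k2 [k3 [a [b [c [h1 h2 h3 [a0 b0 c0 ->]]]]]]]].
move: (mulr_ge0 a0 (h _ h1)) (mulr_ge0 b0 (h _ h2)) (mulr_ge0 c0 (h _ h3)).
by rewrite !Ll; lra.
Qed.

(** By multilinearity each [det3] of the new points is a nonnegative combination of those of the old
    ones, whose indices are in order because consecutive windows at most touch. *)
Lemma wcyclic_refine M m (y w : nat -> H) (lo hi : nat -> nat) :
  wcyclic M y -> periodic m w -> (forall i, cone3 y (lo i) (hi i) (w i)) ->
  (forall i j, (i < j)%N -> (hi i <= lo j)%N) ->
  (forall i, lo (i + m) = lo i + M)%N -> wcyclic m w.
Proof.
move=> cy pw hw hl lM i j k; rewrite leq_eqVlt => /andP[/orP[/eqP->|ij]].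
  by move=> _ _; rewrite det3_0.
rewrite leq_eqVlt => /orP[/eqP->|jk]; first by move=> _; rewrite det3_0.
rewrite leq_eqVlt => /orP[/eqP->|ki]; first by rewrite pw det3_0.
have l1 := hl _ _ ij; have l2 := hl _ _ jk; have l3 := hl _ _ ki; have l4 := lM i.
apply: (cone3_ge0 (L := fun x : vec => det3 x (w j) (w k)) _ _ (hw i)).
  by move=> *; rewrite det3_lin1.
move=> i' hi'; apply: (cone3_ge0 (L := fun x : vec => det3 (y i') x (w k)) _ _ (hw j)).
  by move=> *; rewrite det3_lin2.
move=> j' hj'; apply: (cone3_ge0 (L := fun x : vec => det3 (y i') (y j') x) _ _ (hw k)).
  by move=> *; rewrite det3_lin3.
by move=> k' hk'; apply: cy; lia.
Qed.

Section interleave.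
Variables (m : nat) (v t w : nat -> H).
Hypotheses (m3 : (3 <= m)%N) (pv : periodic m v) (pt : periodic m t) (pw : periodic m w).
Hypotheses (sv : scyclic m v) (ts : forall i, seg (v i) (v i.+1) (t i)).
Hypothesis (hw : forall i, exists a b c : R, [/\ 0 <= a, 0 <= b, 0 <= c &
      hpt (w i) = lin 1 (lin a (t i) b (v i.+1)) c (t i.+1)]).

(** The cycle t 0, v 1, t 1, v 2, ... of twice the length, in which [w i] belongs to the window from
    [i.*2] to [i.*2.+2]. *)
Let y e := if odd e then v e./2.+1 else t e./2.

Let y_even i : y i.*2 = t i.
Proof. by rewrite /y odd_double doubleK. Qed.

Let y_odd i : y i.*2.+1 = v i.+1.
Proof. by rewrite /y /= odd_double /= uphalf_double. Qed.

(** The window from [uphalf e] to [e./2.+1] is a single index for a vertex and the two ends of the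
    side for a point [t]. *)
Let y_wcyclic : wcyclic m.*2 y.
Proof.
apply: (@wcyclic_refine m _ v y uphalf (fun e => e./2.+1)); first exact: scyclicW.
- move=> e; rewrite /y oddD odd_double addbF halfD odd_double andbF add0n doubleK.
  by rewrite -addSn pv pt.
- move=> e; rewrite /y; have E := odd_double_half e; case: ifP => oe.
    exists e./2.+1, e./2.+1, e./2.+1, 1, 0, 0; split => //; try by rewrite uphalf_half oe leqnn.
    by split => //; apply: vec_eq; rewrite /lin/=; ring.
  have [a [b [a0 b0 tE]]] := ts e./2.
  exists e./2, e./2.+1, e./2.+1, a, b, 0; rewrite uphalf_half oe add0n leqnn leqnSn.
  by split; rewrite ?leqnn ?leqnSn//; split => //; rewrite tE; apply: vec_eq; rewrite /lin/=; ring.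
- by move=> e f ef; rewrite uphalf_half; have := odd_double_half e; have := odd_double_half f; case: (odd e) => /=; case: (odd f) => /=; lia.
- by move=> e; rewrite !uphalf_half oddD odd_double addbF halfD odd_double andbF add0n doubleK addnA.
Qed.

Let w_cone i : cone3 y i.*2 i.*2.+2 (w i).
Proof.
have [a [b [c [a0 b0 c0 E]]]] := hw i.
exists i.*2, i.*2.+1, i.*2.+2, a, b, c; split; try lia.
by rewrite y_odd -doubleS !y_even.
Qed.

Lemma inscribed_wcyclic : wcyclic m w.
Proof.
apply: (wcyclic_refine y_wcyclic pw w_cone) => [i j ij|i]; last by rewrite doubleD.
by rewrite -doubleS leq_double.
Qed.

Lemma inscribed_view k i j : (k < i <= j)%N -> (j < k + m)%N ->
  0 <= det3 (v k.+1) (w i) (w j).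
Proof.
move=> /andP[ki]; rewrite leq_eqVlt => /orP[/eqP->|ij] jk; first by rewrite det3_0.
rewrite -y_odd.
apply: (cone3_ge0 (L := fun x : vec => det3 (y k.*2.+1) x (w j)) _ _ (w_cone i)).
  by move=> *; rewrite det3_lin2.
move=> i' hi'; apply: (cone3_ge0 (L := fun x : vec => det3 (y k.*2.+1) (y i') x) _ _ (w_cone j)).
  by move=> *; rewrite det3_lin3.
by move=> j' hj'; apply: y_wcyclic; lia.
Qed.

Let sum_monotone (s : nat -> R) k n : (forall i j, (k < i <= j)%N -> (j <= k + n.+1)%N -> s i <= s j) ->
  \sum_(i < n) `|s (k + i.+1)%N - s (k + i.+2)%N| = s (k + n.+1)%N - s k.+1.
Proof.
elim: n => [|n IH] mono; first by rewrite big_ord0 addn1 subrr.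
rewrite big_ord_recr/= IH; last by move=> i j ij jn; apply: mono => //; lia.
by rewrite ler0_norm; [ring|rewrite subr_le0; apply: mono; lia].
Qed.

(* Seen from a vertex [v k.+1] off the line, the points of [w] other than [w k] occur in
   monotone order along the line. *)
Lemma collinear_sum : (forall i j k, det3 (w i) (w j) (w k) = 0) ->
  exists i j, \sum_(l < m) mdist (w l) (w l.+1) <= 2 * mdist (w i) (w j).
Proof.
move=> col; have [[a [b wab]]|eqw] := pselect (exists a b, w a != w b); last first.
  exists 0%N, 0%N; rewrite mdistxx mulr0 big1// => l _.
  have [->|wl] := eqVneq (w l) (w l.+1); first exact: mdistxx.
  by case: eqw; exists l, l.+1.
pose u := hdir (w a) (w b); have tu : tangent (w a) u by exact: tangent_hdir.
have [s sE] : exists s : nat -> R, forall i, w i = ray (w a) u (s i).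
  exists (fun i => projT1 (cid (line_ray wab (col a b i)))) => i.
  exact: projT2 (cid (line_ray wab (col a b i))).
have dE i j : mdist (w i) (w j) = `|s i - s j|.
  by rewrite (sE i) (sE j) mdist_ray.
have detE (x : vec) i j : det3 x (w i) (w j) = det3 x (w a) u * sh (s j - s i).
  rewrite (sE i) (sE j) !rayE// shB /det3 /lin/=; ring.
have [k kv] : exists k, det3 (v k.+1) (w a) u != 0.
  apply: contrapT => /forallNP h.
  have {}h k : det3 (w a) (w b) (v k) = 0.
    have -> : det3 (w a) (w b) (v k) = det3 (v k) (w a) (w b) by rewrite -det3C.
    rewrite detE -pv; have /negP/negPn/eqP := h (k + m).-1.
    by rewrite prednK ?addn_gt0 ?(leq_trans _ m3) ?orbT// => ->; rewrite mul0r.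
  have [i [j [l /eqP]]] := scyclic_noncol m3 sv; apply.
  exact: (det3_eq0_line wab).
have mono i j : (k < i <= j)%N -> (j < k + m)%N ->
    0 <= det3 (v k.+1) (w a) u * sh (s j - s i).
  by move=> ij jk; rewrite -detE; exact: inscribed_view.
have [s' [s'E s'_le]] : exists s' : nat -> R, (forall i j, `|s i - s j| = `|s' i - s' j|) /\
    forall i j, (k < i <= j)%N -> (j < k + m)%N -> s' i <= s' j.
  have [kp|kn] := ltP 0 (det3 (v k.+1) (w a) u).
    exists s; split => // i j ij jk; have := mono i j ij jk.
    by rewrite pmulr_rge0// -{1}(@sh0 R) sh_ler subr_ge0.
  exists (fun i => - s i); split => [i j|i j ij jk]; first by rewrite -opprD normrN.
  have := mono i j ij jk; rewrite nmulr_rge0; last by rewrite lt_neqAle kv.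
  by rewrite -{1}(@sh0 R) sh_ler subr_le0 lerN2.
under eq_bigr do rewrite dE s'E.
have [n mE] : exists n, m = n.+2 by exists m.-2; lia.
(* Between the indices [k.+1] and k + m - 1 the positions are monotone and telescope. There remain
   three points on a line, the last being [w k]. *)
have key : \sum_(l < m) `|s' l - s' l.+1| =
    `|s' k.+1 - s' (k + n.+1)%N| + `|s' (k + n.+1)%N - s' (k + n.+2)%N| + `|s' (k + n.+2)%N - s' k.+1|.
  have per i : `|s' (i + m)%N - s' (i + m).+1| = `|s' i - s' i.+1|.
    by rewrite -!s'E -!dE -addSn !pw.
  rewrite -(sum_periodicD k.+1 per) mE !big_ord_recr/=.
  rewrite (_ : \sum_(i < n) _ = \sum_(i < n) `|s' (k + i.+1)%N - s' (k + i.+2)%N|); last first.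
    by apply: eq_bigr => i _; rewrite !addnS !addSn.
  rewrite sum_monotone => [|i j ij jn]; last by apply: s'_le => //; lia.
  have -> : `|s' (k.+1 + n.+1)%N - s' (k.+1 + n.+1).+1| = `|s' (k + n.+2)%N - s' k.+1|.
    rewrite -!s'E -!dE -(pw k.+1); congr (mdist (w _) (w _)); lia.
  have -> : (k.+1 + n)%N = (k + n.+1)%N by lia.
  rewrite -(addnS k n.+1); congr (_ + _ + _).
  by rewrite distrC ger0_norm// subr_ge0 s'_le//; lia.
rewrite key.
set p := s' k.+1; set q := s' (k + n.+1)%N; set r := s' (k + n.+2)%N.
have [h|[h|h]] : `|p - q| + `|q - r| + `|r - p| <= 2 * `|p - q| \/
   `|p - q| + `|q - r| + `|r - p| <= 2 * `|q - r| \/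
   `|p - q| + `|q - r| + `|r - p| <= 2 * `|r - p|.
- have N (x : R) : `|x| = x /\ 0 <= x \/ `|x| = - x /\ x <= 0.
    by have [x0|x0] := leP 0 x; [left; rewrite ger0_norm|right; rewrite ltr0_norm// ltW].
  have [[-> ?]|[-> ?]] := N (p - q); have [[-> ?]|[-> ?]] := N (q - r);
    have [[-> ?]|[-> ?]] := N (r - p);
    first [by left; lra|by right; left; lra|by right; right; lra].
- by exists k.+1, (k + n.+1)%N; rewrite dE s'E.
- by exists (k + n.+1)%N, (k + n.+2)%N; rewrite dE s'E.
- by exists (k + n.+2)%N, k.+1; rewrite dE s'E.
Qed.

End interleave.
Lemma scyclic_polygon m n (v : nat -> H) : (3 <= m <= n)%N -> periodic m v -> scyclic m v ->
  polygons n (convex_hull (range v)).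
Proof.
move=> /andP[m3 mn] pv sv; apply: (@wcyclic_polygon _ m) => //; first by case: m m3 {mn pv sv}.
exact: scyclic_noncol sv.
Qed.

Lemma triangle_polygon K n x y z : (3 <= n)%N -> geodesically_convex K ->
  K x -> K y -> K z -> det3 x y z != 0 ->
  exists Q, [/\ polygons n Q, Q `<=` K & Per Q = (mdist x y + mdist y z + mdist z x)%:E].
Proof.
move=> n3 cK; wlog : x y z / 0 < det3 x y z.
  move=> wl Kx Ky Kz; rewrite neq_lt => /orP[D|D]; last by apply: wl => //; rewrite gt_eqF.
  have D' : 0 < det3 y x z by rewrite det3N oppr_gt0.
  have [Q [h1 h2 h3]] := wl y x z D' Ky Kx Kz (lt0r_neq0 D').
  exists Q; split => //; rewrite h3 (metric_sym y x) (metric_sym x z) (metric_sym z y); congr EFin; ring.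
move=> D Kx Ky Kz _.
pose b i := nth x [:: x; y; z] i; pose v i := b (i %% 3)%N.
have pv : periodic 3 v by move=> i; rewrite /v modnDr.
have sv : scyclic 3 v.
  apply: scyclic_mod => i j k ijk k3.
  have [-> -> ->] : [/\ i = 0, j = 1 & k = 2]%N by split; lia.
  exact: D.
exists (convex_hull (range v)); split.
- by apply: (@scyclic_polygon 3) => //; rewrite n3.
- apply: convex_hull_sub => // _ [i _ <-]; rewrite /v /b.
  by case: (i %% 3)%N => [|[|[|l]]] //=; case: l.
- by rewrite (@Per_scyclic _ 3)// !big_ord_recr big_ord0/= add0r.
Qed.

(** Interior points supply a third vertex in [K] off the line [xy], and the strict triangle
    inequality does the rest. If x = y, a second point is produced first. *)
Lemma long_triangle K n x y : (3 <= n)%N -> geodesically_convex K -> K° !=set0 -> K x -> K y ->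
  exists Q q, [/\ polygons n Q, Q `<=` K, Per Q = q%:E & 2 * mdist x y < q].
Proof.
move=> n3 cK [z0 Kz0] Kx Ky.
have Kz0' : K z0 by exact: interior_subset.
wlog xy : x y Kx Ky / x != y.
  move=> wl; have [->|] := eqVneq x y; last exact: wl.
  have [y' [Ky' yy']] : exists y', K y' /\ y' != y.
    have [E|] := eqVneq z0 y; last by exists z0.
    rewrite {}E in Kz0 Kz0'.
    have [||p Kp hp] := @interior_crosses _ K y ((hpt y).2, 0, (hpt y).1.1) Kz0.
    - by move=> [h _]; have := hpt2_gt0 y; rewrite h ltxx.
    - by rewrite /minkowski/=; ring.
    exists p; split => //; apply: contraTneq hp => ->.
    by rewrite -leNgt /minkowski/= mul0r subr0 mulrC subrr.
  have [Q [q [h1 h2 h3 h4]]] := wl _ _ Ky' Ky yy'.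
  exists Q, q; split => //; rewrite mdistxx mulr0; apply: le_lt_trans h4.
  by rewrite mulr_ge0 ?mdist_ge0.
have [z Kz D] : exists2 z, K z & det3 x y z != 0.
  have [D0|] := eqVneq (det3 x y z0) 0; last by exists z0.
  have [||p Kp hp] := @interior_crosses _ K z0 (mcross x y) Kz0.
  - exact: mcross_neq0.
  - by rewrite mink_cross.
  by exists p => //; move: hp; rewrite mink_cross => /ltr0_neq0.
have [Q [h1 h2 h3]] := triangle_polygon n3 cK Kx Ky Kz D.
exists Q, (mdist x y + mdist y z + mdist z x); split => //.
have D' : det3 x z y != 0 by rewrite det3N' oppr_eq0.
have := mdist_strict D'; rewrite (metric_sym z x) (metric_sym y z); lra.
Qed.

End refinement.

(** * Polygons of minimal deviation *)

Section minimal_polygon.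
Context {R : realType}.
Local Notation vec := (R * R * R)%type.
Local Notation H := (hplane R).
Local Notation "<< x , y >>" := (minkowski x y).
Local Coercion hpt : hplane >-> prod.
Implicit Types (x y z : H) (K P Q : set H) (m n i j k : nat).

Lemma dev_inner K Q (p q : R) : Q `<=` K -> Per K = p%:E -> Per Q = q%:E ->
  dev K Q = (p - q)%:E.
Proof.
by move=> QK pE qE; rewrite /dev setUC (setUidr QK) (setIidr QK) pE qE.
Qed.

Lemma dev_overlap K P (p q c : R) : closed K -> closed P -> geodesically_convex K ->
  geodesically_convex P -> (K `&` P)° !=set0 -> Per K = p%:E -> Per P = q%:E ->
  Per (K `&` P) = c%:E -> dev K P = (p + q - 2 * c)%:E.
Proof.
move=> clK clP cK cP i0 pE qE cE; have := Per_modular clK clP cK cP i0.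
rewrite /dev pE qE cE; case: (Per _) => [u| |] //= [E].
by congr EFin; lra.
Qed.

Lemma periodic_shift m (v : nat -> H) k : periodic m v -> periodic m (fun i => v (k + i)%N).
Proof. by move=> pv i; rewrite addnA pv. Qed.

Lemma scyclic_shift m (v : nat -> H) k : scyclic m v -> scyclic m (fun i => v (k + i)%N).
Proof. by move=> sv i j l ijl li; apply: sv; lia. Qed.

Lemma range_shift m (v : nat -> H) k : (0 < m)%N -> periodic m v ->
  range (fun i => v (k + i)%N) = range v.
Proof.
move=> m0 pv; apply/seteqP; split => _ [i _ <-]; first by exists (k + i)%N.
have [j /andP[kj _] ->] := periodic_window k i m0 pv.
by exists (j - k)%N => //; rewrite subnKC.
Qed.

(** The vertex is exchanged together with its copies at all multiples of m, which keeps the sequence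
    periodic. *)
Definition replace0 m (v : nat -> H) y i := if (m %| i)%N then y else v i.

Section replace0.
Variables (m : nat) (v : nat -> H) (y : H).
Hypotheses (m3 : (3 <= m)%N) (pv : periodic m v).
Local Notation r := (replace0 m v y).

Lemma replace0_periodic : periodic m r.
Proof. by move=> i; rewrite /replace0 dvdn_addl// pv. Qed.

Lemma replace0_mod i : r i = r (i %% m)%N.
Proof. by rewrite {1}(divn_eq i m) addnC periodicM//; exact: replace0_periodic. Qed.

Lemma replace0_0 : r 0 = y. Proof. by rewrite /replace0 dvdn0. Qed.

Lemma replace0_small i : (0 < i < m)%N -> r i = v i.
Proof. by move=> /andP[i0 im]; rewrite /replace0 gtnNdvd. Qed.

Lemma replace0_scyclic : scyclic m v ->
  (forall j k, (0 < j < k)%N -> (k < m)%N -> 0 < det3 y (v j) (v k)) -> scyclic m r.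
Proof.
move=> sv h; rewrite (_ : replace0 m v y = fun i => r (i %% m)%N); last first.
  by apply/funext => i; rewrite replace0_mod.
apply: scyclic_mod => -[|i] j k ijk km.
  by rewrite replace0_0 !replace0_small; [exact: h|lia|lia].
by rewrite !replace0_small; [apply: sv|..]; lia.
Qed.

Lemma replace0_side (Phi : H -> H -> Prop) : Phi y (v 1%N) -> Phi (v m.-1) y ->
  (forall i, (0 < i)%N -> (i.+1 < m)%N -> Phi (v i) (v i.+1)) -> forall i, Phi (r i) (r i.+1).
Proof.
move=> h0 h1 h i; have im : (i %% m < m)%N by rewrite ltn_pmod//; lia.
have -> : r i.+1 = r (i %% m).+1.
  by rewrite (replace0_mod i.+1) (replace0_mod (_ %% _).+1) -[in LHS]addn1 -[in RHS]addn1 modnDml.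
rewrite replace0_mod; case: (i %% m)%N im => [|k] km.
  by rewrite replace0_0 replace0_small//; lia.
have [E|km'] := eqVneq k.+2 m.
  have -> : r k.+2 = y by rewrite E -[m in r m]add0n replace0_periodic replace0_0.
  by rewrite replace0_small//; move: h1; rewrite -E.
rewrite !replace0_small; [by apply: h; lia|by lia..].
Qed.

Lemma replace0_sum : \sum_(i < m) mdist (r i) (r i.+1) =
  \sum_(i < m) mdist (v i) (v i.+1) + mdist (v m.-1) y + mdist y (v 1%N)
    - mdist (v m.-1) (v 0%N) - mdist (v 0%N) (v 1%N).
Proof.
have [k E] : exists k, m = k.+2 by exists m.-2; lia.
have rm : r m = y by rewrite -[m in r m]add0n replace0_periodic replace0_0.
have vm : v m = v 0%N by rewrite -[m in v m]add0n pv.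
have r1 : r 1%N = v 1%N by rewrite replace0_small//; lia.
have rl : r m.-1 = v m.-1 by rewrite replace0_small//; lia.
have S (f : nat -> R) : \sum_(i < m) f i = f 0%N + \sum_(i < k) f i.+1 + f m.-1.
  by rewrite E big_ord_recl big_ord_recr/= addrA.
rewrite (S (fun i => mdist (r i) (r i.+1))) (S (fun i => mdist (v i) (v i.+1))).
have mP : m.-1.+1 = m by lia.
rewrite mP rm vm rl r1 replace0_0.
rewrite (_ : \sum_(i < k) mdist (r _) _ = \sum_(i < k) mdist (v i.+1) (v i.+2)); first ring.
by apply: eq_bigr => i _; rewrite !replace0_small// E; have := ltn_ord i; lia.
Qed.

End replace0.

Section minimal.
Variables (K P : set H) (n : nat).
Hypotheses (dK : convex_disc K) (n3 : (3 <= n)%N) (clP : closed P).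
Hypothesis (cP : geodesically_convex P).
Hypothesis minP : forall Q, polygons n Q -> (dev K P <= dev K Q)%E.

Let kK : compact K. Proof. by case: dK. Qed.
Let cK : geodesically_convex K. Proof. by case: dK. Qed.
Let iK : K° !=set0. Proof. by case: dK. Qed.
Let clK : closed K. Proof. exact: compact_closedH. Qed.
Let clC : closed (K `&` P). Proof. exact: closedI. Qed.
Let kC : compact (K `&` P).
Proof. by apply: subclosed_compact clC kK _ => z []. Qed.
Let cC : geodesically_convex (K `&` P). Proof. exact: convex_setI. Qed.

Let Per_fin Q : compact Q -> geodesically_convex Q -> Q !=set0 -> exists q, Per Q = q%:E.
Proof.
move=> kQ cQ Q0; exists (fine (Per Q)); rewrite fineK// ge0_fin_numE ?Per_finite//.
exact: hausdorff1_ge0.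
Qed.

Let PerK : exists p, Per K = p%:E.
Proof. by apply: Per_fin => //; case: iK => z /interior_subset; exists z. Qed.

Lemma overlap_interior : (K `&` P)° !=set0.
Proof.
apply: contrapT => iC; have [p pE] := PerK.
have [x [y [Kx Ky HC]]] : exists x y, [/\ K x, K y &
    (hausdorff1 (K `&` P) <= (mdist x y)%:E)%E].
  have [C0|C0] := pselect ((K `&` P) !=set0); last first.
    have [z /interior_subset Kz] := iK; exists z, z; split => //.
    move/nonemptyPn : C0 => ->; rewrite hausdorff1_set0 mdistxx.
    exact: lexx.
  have col x y z : (K `&` P) x -> (K `&` P) y -> (K `&` P) z -> det3 x y z = 0.
    move=> Cx Cy Cz; apply/eqP/negP => /negP; rewrite neq_lt => /orP[D|D]; apply: iC.
      by apply: (triangle_interior cC Cy Cx Cz); rewrite det3N oppr_gt0.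
    exact: (triangle_interior cC Cx Cy Cz).
  have [x [y [[Kx _] [Ky _] Cxy]]] := collinear_seg kC C0 col.
  by exists x, y; split => //; rewrite -hausdorff1_seg; exact: le_hausdorff1.
have PerC : (Per (K `&` P) <= (mdist x y)%:E)%E.
  apply: le_trans HC; apply: le_hausdorff1.
  by rewrite boundary_closedE// => z [].
have PerU : (p%:E <= Per (K `|` P) + (mdist x y)%:E)%E.
  rewrite -pE /Per (hausdorff1_split (boundary K) clP) addeC.
  apply: leeD; first by apply: le_hausdorff1; exact: boundary_outside.
  apply: le_trans HC; apply: le_hausdorff1.
  by move=> z [+ Pz]; rewrite boundary_closedE// => -[].
have [Q [q [polQ QK qE dq]]] := long_triangle n3 cK iK Kx Ky.
have := minP polQ; rewrite (dev_inner QK pE qE) /dev.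
have C0 : (0 <= Per (K `&` P))%E by exact: hausdorff1_ge0.
move: (Per (K `|` P)) (Per (K `&` P)) C0 PerC PerU => [u| |] [c| |] //=.
by rewrite -!EFinD !lee_fin; lra.
Qed.

(** The deviations compared are Per K - Per Q for the inner polygon and Per K + p - 2 c for [P]. *)
Lemma minimal_inner Q (q p c : R) : polygons n Q -> Q `<=` K -> (q%:E <= Per Q)%E ->
  Per P = p%:E -> Per (K `&` P) = c%:E -> q + p <= 2 * c.
Proof.
move=> polQ QK qQ pE cE; have [k kE] := PerK.
have := minP polQ; rewrite (dev_overlap clK clP cK cP overlap_interior kE pE cE).
rewrite /dev setUC (setUidr QK) (setIidr QK) kE.
by case: (Per Q) qQ => [x| |] //=; rewrite -?EFinB !lee_fin => ? ?; lra.
Qed.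

Lemma minimal_trim Q (p q : R) : polygons n Q -> closed Q -> geodesically_convex Q ->
  K `&` Q = K `&` P -> Per P = p%:E -> Per Q = q%:E -> p <= q.
Proof.
move=> polQ clQ cQ KQ pE qE; have [k kE] := PerK.
have [c cE] : exists c, Per (K `&` P) = c%:E.
  by apply: Per_fin => //; case: overlap_interior => z /interior_subset; exists z.
have := minP polQ; rewrite (dev_overlap clK clP cK cP overlap_interior kE pE cE).
have i0 := overlap_interior; rewrite -KQ in cE i0.
by rewrite (dev_overlap clK clQ cK cQ i0 kE qE cE) lee_fin; lra.
Qed.

Section sides.
Variable m : nat.
Hypothesis mn : (3 <= m <= n)%N.

Let m3 : (3 <= m)%N. Proof. by case/andP: mn. Qed.

(* Otherwise the vertex [v 0] could be moved towards [v 1] without changing the overlap. *)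
Let last_side_meets (v : nat -> H) : periodic m v -> scyclic m v -> P = convex_hull (range v) ->
  exists z, K z /\ seg (v m.-1) (v 0%N) z.
Proof.
move=> pv sv PE; apply: contrapT => no.
have vm : v m.-1.+1 = v 0%N by rewrite prednK ?(leq_trans _ m3)// -[m in v m]add0n pv.
have Pv i : P (v i) by rewrite PE; apply: sub_convex_hull; exists i.
have PD := scyclic_hull m3 pv sv; rewrite -PE in PD.
have Dpos z : (K `&` P) z -> 0 < det3 (v m.-1) (v 0%N) z.
  move=> [Kz Pz]; rewrite lt_neqAle; have := (PD z).1 Pz m.-1; rewrite vm => ->.
  rewrite andbT; apply/eqP => D0; apply: no; exists z; split => //.
  by rewrite -vm; apply: (scyclic_on_side m3 pv sv); [rewrite -PE|rewrite vm].
have C0 : (K `&` P) !=set0 by case: overlap_interior => z /interior_subset; exists z.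
have contD (a b : H) : continuous (fun z : H => det3 a b z : R).
  rewrite (_ : (fun z : H => det3 a b z) = fun z => <<mcross a b, z>>).
    exact: mink_continuous.
  by apply/funext => z; rewrite mink_cross.
have [z0 Cz0 z0P] := compact_min (contD (v m.-1) (v 0%N)) kC C0.
have [z1 Cz1 z1P] := compact_min (contD (v m.-1) (v 1%N)) kC C0.
have d0 := Dpos _ Cz0.
move: z0P z1P d0; set d := det3 (v m.-1) (v 0%N) z0; set l := det3 (v m.-1) (v 1%N) z1.
move=> z0P z1P d0.
have l1 : 0 < 1 + `|l| by rewrite ltr_pwDl.
(* Moving [v 0] by e changes the functional of the last side on the overlap from at least d to at
   least d - e |l|, up to a positive factor; with this choice the bound equals e, so the overlap
   stays inside. *)
pose e := d / (1 + `|l|).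
have e0 : 0 < e by rewrite divr_gt0.
have [s s0 [y ys yE]] := @normal_seg R (v 0%N) (v 1%N) 1 e ler01 (ltW e0) (addr_gt0 ltr01 e0).
have yD (a b : H) : det3 y a b = s * (det3 (v 0%N) a b + e * det3 (v 1%N) a b).
  by rewrite yE det3_lin1; ring.
have ylast z : (K `&` P) z -> 0 <= det3 (v m.-1) y z.
  move=> Cz; rewrite yE det3_lin2 mulr1 -mulrA -mulrDr mulr_ge0 ?(ltW s0)//.
  have := z0P z Cz; have := z1P z Cz; have := ler_norm (- l); rewrite normrN => h1 h2 h3.
  have E : d = e * (1 + `|l|) by rewrite /e divfK ?gt_eqF.
  have : 0 <= e * (1 + `|l| + det3 (v m.-1) (v 1%N) z).
    by apply: mulr_ge0; [exact: ltW|lra].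
  by rewrite !mulrDr -/d mulr1; lra.
pose w := replace0 m v y; pose Q := convex_hull (range w).
have pw : periodic m w by exact: replace0_periodic.
have sw : scyclic m w.
  apply: replace0_scyclic => // j k /andP[j0 jk] km.
  rewrite yD pmulr_rgt0// ltr_pwDl//; first by apply: sv; lia.
  by rewrite mulr_ge0 ?(ltW e0)//; apply: (scyclicW pv sv); lia.
have QP : Q `<=` P.
  apply: convex_hull_sub => // _ [i _ <-]; rewrite /w /replace0; case: ifP => // _.
  by have /geodesically_convexP/(_ (v 0%N) (v 1%N)) := cP; apply.
have CQ : K `&` P `<=` Q.
  move=> z Cz; apply/(scyclic_hull m3 pw sw).
  have D i := (PD z).1 Cz.2 i.
  apply: (replace0_side m3 pv (Phi := fun a b : H => 0 <= det3 a b z)) => // [|/=]; last exact: ylast.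
  by rewrite yD det3_0 mulr0 addr0 mulr_ge0 ?(ltW s0).
have KQ : K `&` Q = K `&` P.
  by apply/seteqP; split => z Cz; split; [exact: Cz.1|exact: QP Cz.2|exact: Cz.1|exact: CQ].
have pE : Per P = (\sum_(i < m) mdist (v i) (v i.+1))%:E.
  by rewrite PE; exact: Per_scyclic pv sv.
have := minimal_trim (scyclic_polygon mn pw sw) (scyclic_closed m3 pw sw)
  (@convex_hull_convex _ _) KQ pE (Per_scyclic m3 pw sw).
apply/negP; rewrite -ltNge.
rewrite (replace0_sum y m3 pv) (seg_mdist ys).
have : det3 (v m.-1) (v 0%N) y != 0.
  rewrite yE det3_lin3 det3_0 mulr0 add0r !mulf_neq0 ?gt_eqF// -vm.
  by rewrite (_ : v 1%N = v m.-1.+2) ?sv//; [lia..|rewrite -[LHS]pv; congr v; lia].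
by move/mdist_strict; rewrite (metric_sym (v m.-1) (v 0%N)); lra.
Qed.

Lemma side_meets (v : nat -> H) i : periodic m v -> scyclic m v -> P = convex_hull (range v) ->
  exists z, K z /\ seg (v i) (v i.+1) z.
Proof.
move=> pv sv PE.
have [] := last_side_meets (periodic_shift i.+1 pv) (scyclic_shift i.+1 sv).
  by rewrite (range_shift _ _ pv) ?(leq_trans _ m3).
move=> z [Kz]; rewrite addn0 (_ : (i.+1 + m.-1)%N = (i + m)%N); last by lia.
by rewrite pv; exists z.
Qed.

Lemma vertex_inside (v : nat -> H) i : periodic m v -> scyclic m v -> P = convex_hull (range v) ->
  K (v i).
Proof.
move=> pv sv PE; apply: contrapT => nKv; have m0 : (0 < m)%N by apply: leq_trans m3.
have Pv j : P (v j) by rewrite PE; apply: sub_convex_hull; exists j.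
have [t [pt tP]] : exists t : nat -> H, (forall j, t (j + m)%N = t j) /\
    forall j, K (t j) /\ seg (v j) (v j.+1) (t j).
  apply: (periodic_choice (Phi := fun j z => K z /\ seg (v j) (v j.+1) z) m0) => [j z|j].
    by rewrite -addSn !pv.
  exact: side_meets.
have Ct j : (K `&` P) (t j).
  split; first by case: (tP j).
  by have /geodesically_convexP/(_ (v j) (v j.+1)) := cP; apply=> //; case: (tP j).
have CP : K `&` P `<=` convex_hull (range v) by rewrite -PE => z [].
have ts j : seg (v j) (v j.+1) (t j) by case: (tP j).
have [w [x [pw Cw hw Cx [_ Cx']]]] := inscribed_sequence m3 pv sv kC cC CP Ct ts.
have {}Cx' : 2 * x < \sum_(j < m) mdist (w j) (w j.+1) + \sum_(j < m) mdist (v j) (v j.+1).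
  by apply: Cx'; exists i => -[].
have pE : Per P = (\sum_(j < m) mdist (v j) (v j.+1))%:E.
  by rewrite PE; exact: Per_scyclic pv sv.
have [c cE] : exists c, Per (K `&` P) = c%:E by apply: Per_fin => //; exists (t 0%N).
rewrite cE lee_fin in Cx.
have [nc|col] := pselect (exists i j k, det3 (w i) (w j) (w k) != 0).
  have cw := inscribed_wcyclic m3 pv pt pw sv ts hw.
  have [_ mn'] := andP mn.
  have QK : convex_hull (range w) `<=` K.
    by apply: convex_hull_sub => // _ [j _ <-]; case: (Cw j).
  have := minimal_inner (wcyclic_polygon m0 pw nc mn') QK (Per_ge_wcyclic m0 pw cw nc) pE cE.
  by lra.
(* The hull of a collinear sequence is no polygon, but the closed path is at most twice one of its
   chords, and a triangle in [K] over that chord is longer still. *)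
have {}col j k l : det3 (w j) (w k) (w l) = 0.
  by apply: contrapT => /eqP D; apply: col; exists j, k, l.
have [j [k le_jk]] := collinear_sum m3 pv pt pw sv ts hw col.
have [Q [q [polQ QK qE qjk]]] := long_triangle n3 cK iK (Cw j).1 (Cw k).1.
have := minimal_inner polQ QK _ pE cE; rewrite qE => /(_ _ (lexx _)); lra.
Qed.

(* Otherwise [v 0] could be moved away from [v m.-1], which makes the perimeter longer. *)
Let vertex0_boundary (v : nat -> H) : periodic m v -> scyclic m v -> P = convex_hull (range v) ->
  ~ K° (v 0%N).
Proof.
move=> pv sv PE iv; have m0 : (0 < m)%N by apply: leq_trans m3.
have Pv j : P (v j) by rewrite PE; apply: sub_convex_hull; exists j.
have Kv j : K (v j) by exact: vertex_inside.
have PK : P `<=` K by rewrite PE; apply: convex_hull_sub => // _ [j _ <-].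
(* The vector v 0 + e (v 0 - v m.-1) projects to a point beyond [v 0] on the line of the last
   side. *)
pose u e := lin 1 (v 0%N) e (lin 1 (v 0%N) (-1) (v m.-1)).
have [] := @hnormal_cvg R R (0^'+) _ u (v 0%N).
- by rewrite /u /lin/= mul1r; exact: cvg_lin0.
- by rewrite /u /lin/= mul1r; exact: cvg_lin0.
- by rewrite /u /lin/= mul1r; exact: cvg_lin0.
move=> u0 ucvg.
have Ku : \forall e \near 0^'+, K (hnormal (u e)).
  by apply: ucvg; exact: iv.
(* Strict convex position is an open condition, and only finitely many pairs of indices within a
   period matter. *)
have Du : \forall e \near 0^'+, forall jk : 'I_m * 'I_m, (0 < jk.1 < jk.2)%N ->
    0 < det3 (u e) (v jk.1) (v jk.2).
  apply: filter_forall => -[j k] /=.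
  have [jk|_] := boolP (0 < j < k)%N; last by apply: nearW.
  have D : 0 < det3 (v 0%N) (v j) (v k) by apply: sv; have := ltn_ord k; lia.
  have := @cvg_lin0 R (det3 (v 0%N) (v j) (v k))
    (det3 (lin 1 (v 0%N) (-1) (v m.-1)) (v j) (v k)).
  move/cvgr_gt => /(_ _ D); apply: filterS => e + _.
  by rewrite [det3 (u e) _ _]det3_lin1 mul1r.
near (0 : R)^'+ => e.
have e0 : 0 < e by near: e; exact: nbhs_right_gt.
have [uu uv] : 0 < <<u e, u e>> /\ 0 < <<u e, v 0%N>> by near: e.
have Ke : K (hnormal (u e)) by near: e.
have De : forall jk : 'I_m * 'I_m, (0 < jk.1 < jk.2)%N -> 0 < det3 (u e) (v jk.1) (v jk.2).
  by near: e.
set y := hnormal (u e) in Ke; set s := (Num.sqrt <<u e, u e>>)^-1.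
have s0 : 0 < s by rewrite invr_gt0 sqrtr_gt0.
have yE : hpt y = lin s (u e) 0 (u e) by exact: hnormalE uu uv.
have yD (a b : H) : det3 y a b = s * det3 (u e) a b.
  by rewrite yE det3_lin1 mul0r addr0.
have ys : seg (v m.-1) y (v 0%N).
  exists (e / (1 + e)), (s * (1 + e))^-1.
  have e1 : 1 + e != 0 by rewrite gt_eqF// addr_gt0.
  split; [by rewrite divr_ge0 ?addr_ge0 ?(ltW e0)|by rewrite invr_ge0 mulr_ge0 ?(ltW s0) ?addr_ge0 ?(ltW e0)|].
  rewrite yE /u; apply: vec_eq; rewrite /lin/=; field; rewrite e1 gt_eqF//.
pose w := replace0 m v y; pose Q := convex_hull (range w).
have pw : periodic m w by exact: replace0_periodic.
have sw : scyclic m w.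
  apply: replace0_scyclic => // j k /andP[j0 jk] km.
  have jm : (j < m)%N by exact: ltn_trans km.
  rewrite yD mulr_gt0//; apply: (De (Ordinal jm, Ordinal km)).
  by rewrite /= j0.
have QK : Q `<=` K.
  by apply: convex_hull_sub => // _ [j _ <-]; rewrite /w /replace0; case: ifP.
have pE : Per P = (\sum_(j < m) mdist (v j) (v j.+1))%:E.
  by rewrite PE; exact: Per_scyclic pv sv.
have cE : Per (K `&` P) = (\sum_(j < m) mdist (v j) (v j.+1))%:E by rewrite (setIidr PK).
have := minimal_inner (scyclic_polygon mn pw sw) QK _ pE cE.
rewrite (Per_scyclic m3 pw sw) => /(_ _ (lexx _)).
rewrite (replace0_sum y m3 pv) (seg_mdist ys) (metric_sym (v m.-1)).
have : det3 (v 0%N) y (v 1%N) != 0.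
  have -> : det3 (v 0%N) y (v 1%N) = s * e * det3 (v m.-1) (v m) (v m.+1).
    rewrite yE (pv 0%N : v m = _) (pv 1%N : v m.+1 = _) /u /det3 /lin/=; ring.
  by rewrite !mulf_neq0 ?gt_eqF//; apply: sv; lia.
by move=> /mdist_strict; lra.
Unshelve. all: by end_near. Qed.

Lemma vertex_boundary (v : nat -> H) i : periodic m v -> scyclic m v -> P = convex_hull (range v) ->
  ~ K° (v i).
Proof.
move=> pv sv PE.
have := vertex0_boundary (periodic_shift i pv) (scyclic_shift i sv).
by rewrite (range_shift _ _ pv) ?(leq_trans _ m3)// addn0; exact.
Qed.

End sides.

End minimal.
End minimal_polygon.

Theorem theorem1p2 (R : realType) (K P : set (hplane R)) (n : nat) :
  convex_disc K -> (3 <= n)%N -> polygons n P ->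
  dev K P = delta_dev K n -> inscribed P K.
Proof.
move=> dK n3 polP dE.
have [m [v [mn pv sv PE VE]]] := polygon_scyclic polP.
have m3 : (3 <= m)%N by case/andP: mn.
have clP : closed P by rewrite PE; exact: scyclic_closed sv.
have cP : geodesically_convex P by rewrite PE; exact: convex_hull_convex.
have minP Q : polygons n Q -> (dev K P <= dev K Q)%E.
  by move=> polQ; rewrite dE; apply: ereal_inf_lbound; exists Q.
have Kv i : K (v i) by apply: (vertex_inside dK n3 clP cP minP mn).
have [kK cK _] := dK.
split; first by rewrite PE; apply: convex_hull_sub => // _ [i _ <-].
rewrite VE boundary_closedE; last exact: compact_closedH.
move=> _ [i _ <-]; split; first exact: Kv.
exact: (vertex_boundary dK n3 clP cP minP mn).
Qed.
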